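(* Let $1\le n\le d-1$ be an integer and $n<s\le d$. Suppose that $F\subset\mathbb{R}^d$ is a compact $s$-Ahlfors regular set. Then, for $\gamma_{d,n}$-a.e. $L\in\mathcal{G}(d,n)$, $$\dim_{\mathrm H}\big(\{x\in F:\ \overline{\dim}_{\mathrm{box}}(F\cap V_{x,L})>s-n\}\big)\le n .$$
   Context: $\mathcal{G}(d,n)$ is the Grassmannian of $n$-dimensional linear subspaces of $\mathbb{R}^d$, $\gamma_{d,n}$ is the Haar measure on it, and $V_{x,L}=x+L^\perp$. $\dim_{\mathrm H}$ is the Hausdorff dimension and $\overline{\dim}_{\mathrm{box}}$ the upper box-counting dimension. A compact set $F\subset\mathbb{R}^d$ is $s$-Ahlfors regular if there is $C\ge1$ such that $C^{-1}r^s\le\mathcal{H}^s(F\cap B(x,r))\le Cr^s$ for all $x\in F$ and $0<r\le\mathrm{diam}(F)$. *)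

(* Defs.v *)
From HB Require Import structures.
From mathcomp Require Import all_boot all_order all_algebra.
From mathcomp Require Import all_classical all_reals all_analysis.

Set Implicit Arguments.
Unset Strict Implicit.
Unset Printing Implicit Defensive.

Import Order.TTheory GRing.Theory Num.Theory.
Import numFieldNormedType.Exports.

Local Open Scope classical_set_scope.
Local Open Scope ring_scope.

(* The library norm on ['rV[R]_d] is the sup norm, hence [enorm]; both induce
   the same topology, so [compact] needs no counterpart. *)
Definition dotv (R : realType) (d : nat) (x y : 'rV[R]_d) : R :=
  \sum_(i < d) x 0 i * y 0 i.

Definition enorm (R : realType) (d : nat) (x : 'rV[R]_d) : R :=
  Num.sqrt (dotv x x).

Definition eball (R : realType) (d : nat) (x : 'rV[R]_d) (r : R) :
    set 'rV[R]_d :=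
  [set y | enorm (y - x) <= r].

(* [diam set0 = -oo]. *)
Definition diam (R : realType) (d : nat) (A : set 'rV[R]_d) : \bar R :=
  ereal_sup [set (enorm (x - y))%:E | x in A & y in A].

(* [diam(A)^s] with [diam(set0)^s = 0] and, for nonempty [A], [0^0 = 1], so
   that [hausdorff_measure 0] is the counting measure. *)
Definition diam_pow (R : realType) (d : nat) (s : R) (A : set 'rV[R]_d) :
    \bar R :=
  if `[< A = set0 >] then 0%E else poweR (diam A) s.

Definition hausdorff_premeasure (R : realType) (d : nat) (s delta : R)
    (A : set 'rV[R]_d) : \bar R :=
  ereal_inf [set (\sum_(0 <= k <oo) diam_pow s (E k))%E | E in
    [set E : nat -> set 'rV[R]_d |
      A `<=` \bigcup_k E k /\ forall k, (diam (E k) <= delta%:E)%E]].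

Definition hausdorff_measure (R : realType) (d : nat) (s : R)
    (A : set 'rV[R]_d) : \bar R :=
  ereal_sup [set hausdorff_premeasure s delta A | delta in [set t : R | 0 < t]].

Definition hausdorff_dim (R : realType) (d : nat) (A : set 'rV[R]_d) :
    \bar R :=
  ereal_inf [set s%:E | s in
    [set s : R | 0 <= s /\ hausdorff_measure s A = 0%E]].

(* Least number of closed balls of radius [delta] covering [A], and [+oo] if
   no finite number does. *)
Definition covering_number (R : realType) (d : nat) (A : set 'rV[R]_d)
    (delta : R) : \bar R :=
  ereal_inf [set (k%:R : R)%:E | k in
    [set k : nat | exists c : 'I_k -> 'rV[R]_d,
      A `<=` \bigcup_i eball (c i) delta]].

Definition upper_box_dim (R : realType) (d : nat) (A : set 'rV[R]_d) :
    \bar R :=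
  limf_esup
    (fun delta : R =>
       (lne (covering_number A delta) * ((ln delta^-1)^-1)%:E)%E)
    (0 : R)^'+.

Definition ahlfors_regular (R : realType) (d : nat) (s : R)
    (F : set 'rV[R]_d) : Prop :=
  exists2 C : R, 1 <= C &
    forall (x : 'rV[R]_d) (r : R), F x -> 0 < r -> (r%:E <= diam F)%E ->
      ((C^-1 * r `^ s)%:E <= hausdorff_measure s (F `&` eball x r) <=
       (C * r `^ s)%:E)%E.

Definition orthc (R : realType) (d : nat) (L : {vspace 'rV[R]_d}) :
    set 'rV[R]_d :=
  [set v | forall w, w \in L -> dotv v w = 0].

Definition slice (R : realType) (d : nat) (x : 'rV[R]_d)
    (L : {vspace 'rV[R]_d}) : set 'rV[R]_d :=
  [set x + v | v in orthc L].

(* Orthogonal projection: the unique [p] in [L] with [x - p] in [orthc L]. *)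
Definition oproj (R : realType) (d : nat) (L : {vspace 'rV[R]_d})
    (x : 'rV[R]_d) : 'rV[R]_d :=
  xget 0 [set p | p \in L /\ orthc L (x - p)].

(* [hn] makes the Grassmannian inhabited, as a measurable type must be. *)
Definition grassmannian (R : realType) (d n : nat) (hn : (n <= d)%N) : Type :=
  {L : {vspace 'rV[R]_d} | \dim L == n}.

Arguments grassmannian R {d n} hn.

Fact grassmannian_point (R : realType) (d n : nat) (hn : (n <= d)%N) :
  exists L : {vspace 'rV[R]_d}, \dim L == n.
Proof.
pose X := take n (vbasis {:'rV[R]_d}).
have sX : size X = n.
  by rewrite size_takel // size_tuple dimvf /dim /= mul1n.
have fX : free (X ++ drop n (vbasis {:'rV[R]_d})).
  by rewrite cat_take_drop (basis_free (vbasisP _)).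
exists <<X>>%VS.
by move/catl_free: fX; rewrite /free sX.
Qed.

HB.instance Definition _ (R : realType) (d n : nat) (hn : (n <= d)%N) :=
  Choice.copy (grassmannian R hn) {L : {vspace 'rV[R]_d} | \dim L == n}.

HB.instance Definition _ (R : realType) (d n : nat) (hn : (n <= d)%N) :=
  isPointed.Build (grassmannian R hn)
    (exist (fun L : {vspace 'rV[R]_d} => \dim L == n)
      (xchoose (grassmannian_point R hn))
      (xchooseP (grassmannian_point R hn))).

(* Operator norm of the difference of the two orthogonal projections. *)
Definition grass_dist (R : realType) (d n : nat) (hn : (n <= d)%N)
    (L M : grassmannian R hn) : R :=
  sup [set enorm (oproj (val L) x - oproj (val M) x) | x in
    [set x : 'rV[R]_d | enorm x <= 1]].

Definition grass_open (R : realType) (d n : nat) (hn : (n <= d)%N) :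
    set (set (grassmannian R hn)) :=
  [set U | forall L, U L ->
    exists2 e : R, 0 < e & forall M, grass_dist L M < e -> U M].

Arguments grass_open R {d n} hn.

Notation grass_borel R hn := (g_sigma_algebraType (grass_open R hn)).

(* The image of a set of subspaces under the action of [g] on row vectors by
   right multiplication. *)
Definition grass_image (R : realType) (d n : nat) (hn : (n <= d)%N)
    (g : 'M[R]_d) (A : set (grassmannian R hn)) : set (grassmannian R hn) :=
  [set M | exists2 L, A L & val M = (linfun (mulmxr g) @: val L)%VS].

(* The [O(d)]-invariant Borel probability measure on the Grassmannian is
   unique. *)
Definition is_haar (R : realType) (d n : nat) (hn : (n <= d)%N)
    (gamma : probability (grass_borel R hn) R) : Prop :=
  forall (g : 'M[R]_d) (A : set (grass_borel R hn)),
    g *m g^T = 1%:M -> measurable A -> gamma (grass_image g A) = gamma A.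

(* Main.v *)
Require Import Defs.
From HB Require Import structures.
From mathcomp Require Import all_boot all_order all_algebra.
From mathcomp Require Import all_classical all_reals all_analysis.
From mathcomp Require Import measurable_realfun gauss_integral.
From mathcomp Require Import normal_distribution zify ring lra.

Set Implicit Arguments.
Unset Strict Implicit.
Unset Printing Implicit Defensive.

Import Order.TTheory GRing.Theory Num.Theory.
Import numFieldNormedType.Exports.

Local Open Scope classical_set_scope.
Local Open Scope ring_scope.

(** Why the theorem holds.

    Put the mass [r ^ s] at each point of a maximal [r]-separated subset of
    [F], with [r = lam ^- J], and let [L] be random. A fibre of the projection
    to [L] that needs far more than [r ^- (s - n)] balls of radius [r] contains
    that many points of the net, up to an error [2 r]; so the projected
    measure, smoothed at the scale [r], is at least [th ^ (2 J)] there, where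
    [th = lam ^ eps] ([concentration_box_dim]). Its total mass is bounded, so
    that at the scale 1 it is bounded. Hence, along the scales [lam ^- j], the
    smoothed measure at [x] first exceeds [th ^ (j + J)] at some [j], and there
    it is much larger than at the previous scale. Such a jump is rare.

    The measure is smoothed with the kernel [kern], which depends on [|P z| ^ 2]
    for the projection [P] to [L] and on a width. It has two properties.

    - It is positive definite, jointly in the width and the position
      ([posdef_kern]), as a mixture of Gaussian kernels. In the Hilbert space
      that it defines, the evaluations at [r]-separated points of [L] are
      almost orthogonal; so the number of such points where a difference of the
      smoothed measure between neighbouring scales is at least [eta] is at most
      [r ^ (- n) * eta ^ (- 2)] times the squared norm of this difference, the
      [energy], up to a constant ([posdef_count], [large_difference_count]).

    - Its mean over all [L] is [(t + |z| ^ 2) ^ (- n / 2)] ([haar_kern]).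
      Invariance gives a recursion for the moments of the squared distance of
      a vector to [L] ([haar_moment_rec]), and summation with the binomial
      series gives the mean. Therefore the mean energy is a sum
      over pairs of net points of a difference of high order of this function,
      which decays so fast that only pairs at distance of the order [r]
      contribute: it is [O (r ^ (s - n))] ([iterated_difference_le],
      [energy_mean]).

    A fibre in which the smoothed measure is moderate at the coarser scale meets
    few balls of radius [r] ([scale_cover]). Altogether the places of
    concentration are covered by balls whose sum of [n]-th powers of radii is
    at most [W J L], where the mean of [W J] is [O (th ^- J)]
    ([concentration_cover]). So the sum of the [W J L] over [J] is finite for
    almost every [L], and a Borel-Cantelli argument shows that the points in
    infinitely many of these sets, in particular those whose fibre has box
    dimension above [s - n + 3 eps], form a set of vanishing [n]-dimensional
    Hausdorff measure ([large_slice_null]). Now let [eps] tend to 0. *)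

(** * Euclidean geometry of row vectors *)

Lemma dotvC (R : realType) d (x y : 'rV[R]_d) : dotv x y = dotv y x.
Proof. by apply: eq_bigr => i _; rewrite mulrC. Qed.

Lemma dotvDl (R : realType) d (x y z : 'rV[R]_d) :
  dotv (x + y) z = dotv x z + dotv y z.
Proof. by rewrite -big_split; apply: eq_bigr => i _; rewrite mxE mulrDl. Qed.

Lemma dotvDr (R : realType) d (x y z : 'rV[R]_d) :
  dotv z (x + y) = dotv z x + dotv z y.
Proof. by rewrite !(dotvC z) dotvDl. Qed.

Lemma dotvZl (R : realType) d (a : R) (x y : 'rV[R]_d) :
  dotv (a *: x) y = a * dotv x y.
Proof. by rewrite mulr_sumr; apply: eq_bigr => i _; rewrite mxE mulrA. Qed.

Lemma dotvZr (R : realType) d (a : R) (x y : 'rV[R]_d) :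
  dotv x (a *: y) = a * dotv x y.
Proof. by rewrite !(dotvC x) dotvZl. Qed.

Lemma dotvNl (R : realType) d (x y : 'rV[R]_d) : dotv (- x) y = - dotv x y.
Proof. by rewrite -scaleN1r dotvZl mulN1r. Qed.

Lemma dotvBl (R : realType) d (x y z : 'rV[R]_d) :
  dotv (x - y) z = dotv x z - dotv y z.
Proof. by rewrite dotvDl dotvNl. Qed.

Lemma dotvBr (R : realType) d (x y z : 'rV[R]_d) :
  dotv z (x - y) = dotv z x - dotv z y.
Proof. by rewrite !(dotvC z) dotvBl. Qed.

Lemma dot0v (R : realType) d (x : 'rV[R]_d) : dotv 0 x = 0.
Proof. by rewrite -(scale0r x) dotvZl mul0r. Qed.

Lemma dotvE (R : realType) d (x y : 'rV[R]_d) :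
  dotv x y = (x *m y^T) 0 0.
Proof. by rewrite mxE; apply: eq_bigr => i _; rewrite mxE. Qed.

Lemma dotv_mulmx (R : realType) d k (x : 'rV[R]_d) (y : 'rV[R]_k)
    (A : 'M[R]_(d, k)) : dotv (x *m A) y = dotv x (y *m A^T).
Proof. by rewrite !dotvE trmx_mul trmxK mulmxA. Qed.

Lemma dotv_ge0 (R : realType) d (x : 'rV[R]_d) : 0 <= dotv x x.
Proof. by apply: sumr_ge0 => i _; rewrite -expr2 sqr_ge0. Qed.

Lemma dotv_eq0 (R : realType) d (x : 'rV[R]_d) : dotv x x = 0 -> x = 0.
Proof.
move/eqP; rewrite psumr_eq0 => [/allP x0|i _]; last by rewrite -expr2 sqr_ge0.
apply/rowP => i; rewrite mxE; apply/eqP.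
by have := x0 i (mem_index_enum i); rewrite /= mulf_eq0 orbb.
Qed.

Lemma enorm_ge0 (R : realType) d (x : 'rV[R]_d) : 0 <= enorm x.
Proof. exact: sqrtr_ge0. Qed.

Lemma enorm_sqr (R : realType) d (x : 'rV[R]_d) : enorm x ^+ 2 = dotv x x.
Proof. by rewrite sqr_sqrtr // dotv_ge0. Qed.

Lemma enorm0 (R : realType) d : enorm (0 : 'rV[R]_d) = 0.
Proof. by rewrite /enorm dot0v sqrtr0. Qed.

Lemma enorm_eq0 (R : realType) d (x : 'rV[R]_d) : enorm x = 0 -> x = 0.
Proof. by move=> x0; apply: dotv_eq0; rewrite -enorm_sqr x0 expr0n. Qed.

Lemma enormN (R : realType) d (x : 'rV[R]_d) : enorm (- x) = enorm x.
Proof. by rewrite /enorm dotvNl dotvC dotvNl opprK. Qed.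

Lemma enormB (R : realType) d (x y : 'rV[R]_d) : enorm (x - y) = enorm (y - x).
Proof. by rewrite -enormN opprB. Qed.

Lemma enormZ (R : realType) d (a : R) (x : 'rV[R]_d) :
  enorm (a *: x) = `|a| * enorm x.
Proof.
by rewrite /enorm dotvZl dotvZr mulrA -expr2 sqrtrM ?sqr_ge0 // sqrtr_sqr.
Qed.

Lemma dotv_le (R : realType) d (x y : 'rV[R]_d) :
  dotv x y <= enorm x * enorm y.
Proof.
have [y0|y0] := eqVneq (dotv y y) 0.
  by rewrite (dotv_eq0 y0) dotvC dot0v enorm0 mulr0.
have yy : 0 < dotv y y by rewrite lt_def y0 dotv_ge0.
apply: le_trans (ler_norm _) _.
rewrite -ler_sqr ?nnegrE ?mulr_ge0 ?enorm_ge0 ?normr_ge0//.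
rewrite exprMn !enorm_sqr real_normK ?num_real//.
have := dotv_ge0 (dotv y y *: x - dotv x y *: y).
rewrite !(dotvBl, dotvBr, dotvZl, dotvZr) (dotvC y x).
set a := dotv x x; set b := dotv x y; set c := dotv y y => h.
have {}h : 0 <= c * (a * c - b ^+ 2).
  by apply: le_trans h _; rewrite le_eqVlt; apply/orP; left; apply/eqP; ring.
by rewrite -subr_ge0; move: h; rewrite pmulr_rge0.
Qed.

Lemma enormD (R : realType) d (x y : 'rV[R]_d) :
  enorm (x + y) <= enorm x + enorm y.
Proof.
rewrite -ler_sqr ?nnegrE ?addr_ge0 ?enorm_ge0//.
rewrite enorm_sqr dotvDl !dotvDr sqrrD !enorm_sqr (dotvC y x).
by have := dotv_le x y; lra.
Qed.

Lemma enorm_dist (R : realType) d (x y z : 'rV[R]_d) :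
  enorm (x - z) <= enorm (x - y) + enorm (y - z).
Proof. by apply: le_trans (enormD _ _); rewrite addrA subrK. Qed.

Lemma enorm_le_sum (R : realType) d (x : 'rV[R]_d) :
  enorm x <= \sum_(i < d) `|x 0 i|.
Proof.
have s0 : 0 <= \sum_(i < d) `|x 0 i| by exact: sumr_ge0.
rewrite -ler_sqr ?nnegrE ?enorm_ge0// enorm_sqr /dotv expr2 mulr_suml.
apply: ler_sum => i _; apply: le_trans (ler_norm _) _; rewrite normrM.
by apply: ler_wpM2l => //; rewrite (bigD1 i)//= lerDl sumr_ge0.
Qed.

Lemma coord_le_enorm (R : realType) d (x : 'rV[R]_d) i : `|x 0 i| <= enorm x.
Proof.
rewrite -ler_sqr ?nnegrE ?enorm_ge0// enorm_sqr real_normK ?num_real//.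
rewrite /dotv (bigD1 i)//= -expr2 lerDl sumr_ge0// => j _.
by rewrite -expr2 sqr_ge0.
Qed.

(** * Orthonormal frames *)

Definition frame (R : realType) (n d : nat) (L : {vspace 'rV[R]_d})
    (U : 'M[R]_(n, d)) : Prop :=
  U *m U^T = 1%:M /\ forall x, x \in L <-> x = x *m U^T *m U.

(** Split off a unit vector [u] of [L] and use induction for its orthogonal
    complement in [L]. *)
Lemma frame_exists (R : realType) (n d : nat) (L : {vspace 'rV[R]_d}) :
  \dim L = n -> exists U : 'M[R]_(n, d), frame L U.
Proof.
elim: n L => [|n IH] L dL.
  exists 0; split => [|x]; first by apply/matrixP => -[].
  rewrite mulmx0; move/eqP: dL; rewrite dimv_eq0 => /eqP ->.
  by rewrite memv0; split => /eqP.
have L0 : L != 0%VS by rewrite -dimv_eq0 dL.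
set u0 := vpick L.
have u00 : enorm u0 != 0.
  by apply/eqP => /enorm_eq0/eqP; rewrite vpick0; exact/negP.
pose u := (enorm u0)^-1 *: u0.
have uL : u \in L by rewrite memvZ // memv_pick.
have uu : u *m u^T = 1%:M.
  rewrite [LHS]mx11_scalar -dotvE dotvZl dotvZr -enorm_sqr expr2 mulKf//.
  by rewrite mulVf.
pose f := linfun (mulmxr u^T : 'rV[R]_d -> 'rV[R]_1).
have fE x : f x = x *m u^T by rewrite lfunE.
have d1 : \dim (f @: L)%VS = 1.
  apply/eqP; rewrite eqn_leq; apply/andP; split.
    by rewrite (leq_trans (dimvS (subvf _)))// dimvf /dim/= mul1n.
  rewrite lt0n dimv_eq0; apply/negP => /eqP fL0.
  have : f u \in (f @: L)%VS by rewrite memv_img.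
  by rewrite fL0 memv0 fE uu => /eqP/matrixP/(_ 0 0)/eqP; rewrite !mxE oner_eq0.
have [|V [VV VL]] := IH (L :&: lker f)%VS.
  by have := limg_ker_dim f L; rewrite d1 dL addn1 => -[].
have inL x : x *m V^T *m V \in (L :&: lker f)%VS.
  by apply/VL; rewrite -[in RHS](mulmxA _ V) VV mulmx1.
have Vu : V *m u^T = 0.
  apply/row_matrixP => i; rewrite row_mul row0 -fE; apply/eqP.
  rewrite -memv_ker.
  have -> : row i V = row i V *m V^T *m V.
    by rewrite -!row_mul VV mul1mx.
  by have := inL (row i V); rewrite memv_cap => /andP[].
have uV : u *m V^T = 0 by rewrite -[LHS]trmxK trmx_mul trmxK Vu trmx0.
pose U : 'M[R]_(1 + n, d) := col_mx u V.
have UU : U *m U^T = 1%:M.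
  by rewrite tr_col_mx mul_col_row VV uu Vu uV -scalar_mx_block.
have UE x : x *m U^T *m U = x *m u^T *m u + x *m V^T *m V.
  by rewrite tr_col_mx mul_mx_row mul_row_col.
exists U; split => // x; rewrite UE.
have xuL : x *m u^T *m u \in L.
  by rewrite [x *m u^T]mx11_scalar mul_scalar_mx memvZ.
split => [xL|->]; last first.
  by rewrite memvD//; have := inL x; rewrite memv_cap => /andP[].
have : x - x *m u^T *m u \in (L :&: lker f)%VS.
  rewrite memv_cap memvB//= memv_ker fE mulmxBl -(mulmxA _ u) uu mulmx1.
  by rewrite subrr.
move/VL; rewrite 2!mulmxBl -!mulmxA (mulmxA u) uV mul0mx !mulmx0 subr0.
by move/eqP; rewrite subr_eq addrC => /eqP.
Qed.

Lemma frame_mem (R : realType) (n d : nat) (L : {vspace 'rV[R]_d})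
    (U : 'M[R]_(n, d)) (x : 'rV[R]_d) : frame L U -> x *m U^T *m U \in L.
Proof. by move=> [UU UL]; apply/UL; rewrite -[in RHS](mulmxA _ U) UU mulmx1. Qed.

Lemma oproj_unique (R : realType) (d : nat) (L : {vspace 'rV[R]_d})
    (x p : 'rV[R]_d) : p \in L -> orthc L (x - p) -> oproj L x = p.
Proof.
move=> pL xp; apply: xget_unique => // p' [p'L xp'].
apply/eqP; rewrite -subr_eq0; apply/eqP/dotv_eq0.
have pp : p' - p \in L by rewrite memvB.
have E : p' - p = (x - p) - (x - p').
  by apply/rowP => i; rewrite !mxE; ring.
by rewrite {1}E dotvBl xp// xp'// subrr.
Qed.

Lemma oprojE (R : realType) (n d : nat) (L : {vspace 'rV[R]_d})
    (U : 'M[R]_(n, d)) (x : 'rV[R]_d) :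
  frame L U -> oproj L x = x *m U^T *m U.
Proof.
move=> LU; apply: oproj_unique; first exact: frame_mem LU.
move=> w /(LU.2 w) ->; rewrite dotvC dotv_mulmx mulmxBl -(mulmxA _ U) LU.1 mulmx1.
by rewrite subrr dotvC dot0v.
Qed.

Lemma enorm_frame (R : realType) (n d : nat) (L : {vspace 'rV[R]_d})
    (U : 'M[R]_(n, d)) (x : 'rV[R]_d) :
  frame L U -> enorm (x *m U^T) = enorm (oproj L x).
Proof.
move=> LU; rewrite (oprojE x LU) /enorm dotv_mulmx -[in RHS]mulmxA.
by rewrite [in RHS]dotv_mulmx !trmx_mul !trmxK -!mulmxA (mulmxA U) LU.1 mul1mx.
Qed.

(** The kernels below see a subspace only through this quadratic form, whose
    law for a random subspace can be computed. *)
Definition psq (R : realType) (d : nat) (L : {vspace 'rV[R]_d})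
    (x : 'rV[R]_d) : R := enorm (oproj L x) ^+ 2.

Lemma psq_ge0 (R : realType) d (L : {vspace 'rV[R]_d}) (x : 'rV[R]_d) :
  0 <= psq L x.
Proof. exact: sqr_ge0. Qed.

Lemma oprojB (R : realType) (d : nat) (L : {vspace 'rV[R]_d})
  (x y : 'rV[R]_d) : oproj L (x - y) = oproj L x - oproj L y.
Proof.
have [U LU] := frame_exists (erefl (\dim L)).
by rewrite !(oprojE _ LU) !mulmxBl.
Qed.

Lemma oproj_orth (R : realType) (d : nat) (L : {vspace 'rV[R]_d})
  (x : 'rV[R]_d) : orthc L x -> oproj L x = 0.
Proof. by move=> Lx; apply: oproj_unique; rewrite ?mem0v// subr0. Qed.

Lemma psq_decomp (R : realType) (d : nat) (L : {vspace 'rV[R]_d})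
  (x : 'rV[R]_d) : dotv x x = psq L x + dotv (x - oproj L x) (x - oproj L x).
Proof.
have [U LU] := frame_exists (erefl (\dim L)).
rewrite /psq enorm_sqr dotvBl !dotvBr.
have -> : dotv (oproj L x) (oproj L x) = dotv (oproj L x) x.
  rewrite (oprojE _ LU) dotv_mulmx [RHS]dotv_mulmx.
  by rewrite -(mulmxA _ U) LU.1 mulmx1.
by rewrite (dotvC x (oproj L x)); ring.
Qed.

Lemma psq_le (R : realType) (d : nat) (L : {vspace 'rV[R]_d})
  (x : 'rV[R]_d) : psq L x <= dotv x x.
Proof. by rewrite [leRHS](psq_decomp L) lerDl dotv_ge0. Qed.

Lemma enorm_oproj_le (R : realType) (d : nat) (L : {vspace 'rV[R]_d})
  (x : 'rV[R]_d) : enorm (oproj L x) <= enorm x.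
Proof.
by rewrite -ler_sqr ?nnegrE ?enorm_ge0// [leRHS]enorm_sqr psq_le.
Qed.

(** * Invariance under orthogonal matrices *)

Lemma grass_dist_ge (R : realType) (d n : nat) (hn : (n <= d)%N)
    (L M : grassmannian R hn) (z : 'rV[R]_d) :
  enorm (oproj (val L) z - oproj (val M) z) <= grass_dist L M * enorm z.
Proof.
have [z0|z0] := eqVneq (enorm z) 0.
  by rewrite (enorm_eq0 z0) -(subrr 0) !oprojB !subrr enorm0 mulr0.
have zp : 0 < enorm z by rewrite lt_def z0 enorm_ge0.
have oZ (K : grassmannian R hn) a : oproj (val K) (a *: z) = a *: oproj (val K) z.
  have [U KU] := frame_exists (erefl (\dim (val K))).
  by rewrite !(oprojE _ KU) -!scalemxAl.
rewrite -ler_pdivrMr// mulrC -[(enorm z)^-1]ger0_norm ?invr_ge0 ?enorm_ge0//.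
rewrite -enormZ scalerBr -!oZ; apply: ub_le_sup; last first.
  exists ((enorm z)^-1 *: z) => //=.
  by rewrite enormZ ger0_norm ?invr_ge0 ?enorm_ge0// mulVf.
exists 2 => _ [x x1 <-].
apply: le_trans (enormD _ _) _; rewrite enormN -[2]/(1 + 1).
by apply: lerD; apply: le_trans (enorm_oproj_le _ _) _.
Qed.

(** The length of a projection is Lipschitz in the subspace, so that its
    superlevel sets are open. *)
Lemma measurable_psq (R : realType) (d n : nat) (hn : (n <= d)%N)
    (z : 'rV[R]_d) :
  measurable_fun [set: grass_borel R hn]
    (fun L : grass_borel R hn => psq (val (L : grassmannian R hn)) z).
Proof.
apply: measurable_funX => mD.
apply: (measurability _ (RGenOInfty.measurableE R)) => // _ [_ [a ->] <-].
rewrite setTI; apply: sub_sigma_algebra => L /=.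
rewrite in_itv/= andbT => aL.
exists ((enorm (oproj (val L) z) - a) / (1 + enorm z)).
  by rewrite divr_gt0 ?subr_gt0// ltr_wpDr// enorm_ge0.
have zp : 0 < 1 + enorm z by rewrite ltr_wpDr// enorm_ge0.
move=> M; rewrite ltr_pdivlMr// => LM; rewrite /= in_itv/= andbT.
have h1 := enormD (oproj (val L) z - oproj (val M) z) (oproj (val M) z).
rewrite subrK in h1.
have h2 := grass_dist_ge L M z.
have h3 : 0 <= grass_dist L M.
  apply: le_trans (enorm_ge0 (oproj (val L) 0 - oproj (val M) 0)) _.
  apply: ub_le_sup; last by exists 0 => //=; rewrite enorm0.
  exists 2 => _ [x x1 <-].
  apply: le_trans (enormD _ _) _; rewrite enormN -[2]/(1 + 1).
  by apply: lerD; apply: le_trans (enorm_oproj_le _ _) _.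
by rewrite mulrDr mulr1 in LM; lra.
Qed.

Lemma mem_limg_mulmxr (R : realType) (d : nat) (g : 'M[R]_d)
    (L : {vspace 'rV[R]_d}) (w : 'rV[R]_d) :
  w \in (linfun (mulmxr g) @: L)%VS <-> exists2 u, u \in L & w = u *m g.
Proof.
split => [/memv_imgP[u uL ->]|[u uL ->]]; first by exists u; rewrite ?lfunE.
by apply/memv_imgP; exists u; rewrite ?lfunE.
Qed.

Lemma psq_limg (R : realType) (d : nat) (g : 'M[R]_d)
    (L : {vspace 'rV[R]_d}) (z : 'rV[R]_d) :
  g *m g^T = 1%:M -> psq (linfun (mulmxr g) @: L)%VS (z *m g) = psq L z.
Proof.
move=> gg; have [U LU] := frame_exists (erefl (\dim L)).
have pL : oproj L z \in L by rewrite (oprojE _ LU) (frame_mem _ LU).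
have -> : psq (linfun (mulmxr g) @: L)%VS (z *m g) =
          enorm (oproj L z *m g) ^+ 2.
  congr (enorm _ ^+ 2); apply: oproj_unique.
    by apply/mem_limg_mulmxr; exists (oproj L z).
  move=> _ /mem_limg_mulmxr[u uL ->].
  rewrite -mulmxBl dotv_mulmx -mulmxA gg mulmx1 (oprojE _ LU) dotvC.
  rewrite {1}((LU.2 u).1 uL) dotv_mulmx mulmxBl -(mulmxA _ U) LU.1 mulmx1.
  by rewrite subrr dotvC dot0v.
by rewrite /psq !enorm_sqr dotv_mulmx -mulmxA gg mulmx1.
Qed.

Lemma dim_limg_mulmxr (R : realType) (d : nat) (g : 'M[R]_d)
    (L : {vspace 'rV[R]_d}) :
  g *m g^T = 1%:M -> \dim (linfun (mulmxr g) @: L)%VS = \dim L.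
Proof.
move=> gg; apply: limg_dim_eq; apply/eqP; rewrite -subv0; apply/subvP => v.
rewrite memv_cap memv_ker lfunE/= memv0 => /andP[_ /eqP vg].
by rewrite -(mulmx1 v) -gg mulmxA vg mul0mx.
Qed.

Lemma grass_image_psq (R : realType) (d n : nat) (hn : (n <= d)%N)
    (g : 'M[R]_d) (z : 'rV[R]_d) (B : set R) : g *m g^T = 1%:M ->
  grass_image g [set L : grassmannian R hn | B (psq (val L) z)] =
  [set M : grassmannian R hn | B (psq (val M) (z *m g))].
Proof.
move=> gg; apply/seteqP; split => M /=.
  by move=> [L BL ->]; rewrite psq_limg.
move=> BM; have gg' : g^T *m g^T^T = 1%:M by rewrite trmxK mulmx1C.
have dL : \dim (linfun (mulmxr g^T) @: val M)%VS == n.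
  by rewrite dim_limg_mulmxr//; exact: valP M.
have ML : val M = (linfun (mulmxr g) @: (linfun (mulmxr g^T) @: val M))%VS.
  apply/vspaceP => w; apply/idP/idP => [wM|].
    apply/mem_limg_mulmxr; exists (w *m g^T).
      by apply/mem_limg_mulmxr; exists w.
    by rewrite -mulmxA (mulmx1C gg) mulmx1.
  move=> /mem_limg_mulmxr[_ /mem_limg_mulmxr[u uM ->] ->].
  by rewrite -mulmxA (mulmx1C gg) mulmx1.
exists (exist (fun L : {vspace 'rV[R]_d} => \dim L == n) _ dL) => //=.
by rewrite -(psq_limg _ _ gg) -ML.
Qed.

(** Orthogonal matrices act transitively on spheres, by reflections. *)
Lemma orthogonal_transitive (R : realType) (d : nat) (x y : 'rV[R]_d) :
  dotv x x = dotv y y -> exists2 g : 'M[R]_d, g *m g^T = 1%:M & x *m g = y.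
Proof.
move=> xy; pose v := x - y.
have [v0|v0] := eqVneq (dotv v v) 0.
  exists 1%:M; first by rewrite trmx1 mulmx1.
  by rewrite mulmx1; apply/eqP; rewrite -subr_eq0 -/v (dotv_eq0 v0).
pose c := 2 / dotv v v.
pose g := 1%:M - c *: (v^T *m v).
have vv : v *m v^T = (dotv v v)%:M by rewrite [LHS]mx11_scalar dotvE.
have gT : g^T = g by rewrite /g linearB/= linearZ/= trmx1 trmx_mul trmxK.
exists g.
  have ww : (v^T *m v) *m (v^T *m v) = dotv v v *: (v^T *m v).
    by rewrite -mulmxA (mulmxA v) vv mul_scalar_mx -scalemxAr.
  have wg : (v^T *m v) *m g = - (v^T *m v).
    rewrite /g mulmxBr mulmx1 -scalemxAr ww scalerA /c mulfVK//.
    by rewrite scaler_nat mulr2n opprD addrA subrr add0r.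
  rewrite gT {1}/g mulmxBl mul1mx -scalemxAl wg scalerN opprK /g.
  by rewrite subrK.
rewrite /g mulmxBr mulmx1 -scalemxAr mulmxA.
have -> : x *m v^T = (dotv x v)%:M by rewrite [LHS]mx11_scalar dotvE.
rewrite mul_scalar_mx scalerA.
have -> : c * dotv x v = 1.
  rewrite /c; have -> : dotv v v = 2 * dotv x v.
    by rewrite /v !(dotvBl, dotvBr) (dotvC y x) -xy; ring.
  have : dotv x v != 0.
    apply: contraNneq v0 => xv; apply/eqP.
    have -> : dotv v v = 2 * dotv x v.
      by rewrite /v !(dotvBl, dotvBr) (dotvC y x) -xy; ring.
    by rewrite xv mulr0.
  by move=> ?; field.
by rewrite scale1r opprB addrC subrK.
Qed.

(** Invariance identifies the laws of [psq L x] and [psq L y], since an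
    orthogonal matrix maps [x] to [y]. *)
Lemma haar_psq (R : realType) (d n : nat) (hn : (n <= d)%N)
    (gamma : probability (grass_borel R hn) R) (x y : 'rV[R]_d) (h : R -> R) :
  is_haar gamma -> measurable_fun setT h -> (forall r, 0 <= h r) ->
  dotv x x = dotv y y ->
  (\int[gamma]_L (h (psq (val (L : grassmannian R hn)) x))%:E =
   \int[gamma]_L (h (psq (val (L : grassmannian R hn)) y))%:E)%E.
Proof.
move=> inv mh h0 /orthogonal_transitive[g gg <-].
pose f z := fun L : grass_borel R hn => psq (val (L : grassmannian R hn)) z.
have mf z : measurable_fun setT (f z) by exact: measurable_psq.
have E z : (\int[gamma]_L (h (f z L))%:E =
            \int[pushforward gamma (f z)]_r (h r)%:E)%E.
  by rewrite ge0_integral_pushforward//=; [exact/measurable_EFinP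
     | move=> r _; rewrite lee_fin].
rewrite (E x) (E (x *m g)); apply: eq_measure_integral => B mB _.
transitivity (gamma (grass_image g (f x @^-1` B))).
  apply/esym/inv => //; rewrite -[_ @^-1` _]setTI; exact: mf.
by rewrite (grass_image_psq hn x B gg).
Qed.

(** * The distance to a random subspace *)

(** Bounded measurable functions: a class stable under the algebraic
    operations, on which a probability integrates linearly. *)
Definition bdmeas (R : realType) (dT : measure_display) (T : measurableType dT)
    (f : T -> R) : Prop :=
  measurable_fun setT f /\ exists M, forall x, `|f x| <= M.

Lemma bdmeas_cst (R : realType) dT (T : measurableType dT) (c : R) :
  bdmeas (fun _ : T => c).
Proof. by split; [exact: measurable_cst|exists `|c|]. Qed.

Lemma bdmeasD (R : realType) dT (T : measurableType dT) (f g : T -> R) :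
  bdmeas f -> bdmeas g -> bdmeas (fun x => f x + g x).
Proof.
move=> [mf [M fM]] [mg [N gN]]; split; first exact: measurable_funD.
by exists (M + N) => x; apply: le_trans (ler_normD _ _) _; exact: lerD.
Qed.

Lemma bdmeasM (R : realType) dT (T : measurableType dT) (f g : T -> R) :
  bdmeas f -> bdmeas g -> bdmeas (fun x => f x * g x).
Proof.
move=> [mf [M fM]] [mg [N gN]]; split; first exact: measurable_funM.
by exists (M * N) => x; rewrite normrM; exact: ler_pM.
Qed.

Lemma bdmeasX (R : realType) dT (T : measurableType dT) (f : T -> R) k :
  bdmeas f -> bdmeas (fun x => f x ^+ k).
Proof.
move=> bf; elim: k => [|k IH].
  by under eq_fun do rewrite expr0; exact: bdmeas_cst.
by under eq_fun do rewrite exprS; exact: bdmeasM.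
Qed.

Lemma bdmeas_sum (R : realType) dT (T : measurableType dT) (I : Type)
    (r : seq I) (f : I -> T -> R) :
  (forall i, bdmeas (f i)) -> bdmeas (fun x => \sum_(i <- r) f i x).
Proof.
move=> bf; elim: r => [|i r IH].
  by under eq_fun do rewrite big_nil; exact: bdmeas_cst.
by under eq_fun do rewrite big_cons; exact: bdmeasD.
Qed.

Lemma bdmeas_integrable (R : realType) dT (T : measurableType dT)
    (P : probability T R) (f : T -> R) :
  bdmeas f -> P.-integrable setT (EFin \o f).
Proof.
move=> [mf [M fM]]; apply: measurable_bounded_integrable => //.
  by rewrite (le_lt_trans (probability_le1 _ _)) ?ltry.
by exists M; split; [rewrite num_real|move=> N MN x _; exact: le_trans (fM x) (ltW MN)].
Qed.

Lemma Rintegral_bdmeas_sum (R : realType) dT (T : measurableType dT)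
    (P : probability T R) (I : Type) (r : seq I) (f : I -> T -> R) :
  (forall i, bdmeas (f i)) ->
  \int[P]_x (\sum_(i <- r) f i x) = \sum_(i <- r) \int[P]_x f i x.
Proof.
move=> bf; elim: r => [|i r IH].
  under eq_Rintegral do rewrite big_nil.
  by rewrite big_nil Rintegral_cst// mul0r.
under eq_Rintegral do rewrite big_cons.
rewrite big_cons -IH RintegralD//; first exact: bdmeas_integrable.
by apply: bdmeas_integrable; exact: bdmeas_sum.
Qed.

Lemma Rintegral_bdmeasZ (R : realType) dT (T : measurableType dT)
    (P : probability T R) (c : R) (f : T -> R) :
  bdmeas f -> \int[P]_x (c * f x) = c * \int[P]_x f x.
Proof. by move=> bf; rewrite RintegralZl//; exact: bdmeas_integrable. Qed.

(** The squared distance of [x] to [L]. *)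
Definition cpsq (R : realType) (d : nat) (L : {vspace 'rV[R]_d})
    (x : 'rV[R]_d) : R := dotv x x - psq L x.

Lemma cpsq_ge0 (R : realType) (d : nat) (L : {vspace 'rV[R]_d})
  (x : 'rV[R]_d) : 0 <= cpsq L x.
Proof. by rewrite subr_ge0 psq_le. Qed.

Lemma cpsq_le (R : realType) (d : nat) (L : {vspace 'rV[R]_d})
  (x : 'rV[R]_d) : cpsq L x <= dotv x x.
Proof. by rewrite lerBlDr lerDl psq_ge0. Qed.

(** The bilinear form of [cpsq L]. *)
Definition cdot (R : realType) (d : nat) (L : {vspace 'rV[R]_d})
    (x y : 'rV[R]_d) : R := dotv (x - oproj L x) y.

Lemma cpsqE (R : realType) (d : nat) (L : {vspace 'rV[R]_d})
  (x : 'rV[R]_d) : cpsq L x = cdot L x x.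
Proof.
have [U LU] := frame_exists (erefl (\dim L)).
rewrite /cpsq /cdot /psq enorm_sqr dotvBl; congr (_ - _).
by rewrite (oprojE _ LU) dotv_mulmx -(mulmxA _ U) LU.1 mulmx1 -dotv_mulmx.
Qed.

Lemma cpsq_pencil (R : realType) (d : nat) (L : {vspace 'rV[R]_d})
    (x y : 'rV[R]_d) (t : R) :
  cpsq L (x + t *: y) = cdot L x x + t * (2 * cdot L x y) + t ^+ 2 * cdot L y y.
Proof.
have [U LU] := frame_exists (erefl (\dim L)).
have P u : oproj L u = u *m U^T *m U by exact: oprojE.
have sym : cdot L y x = cdot L x y.
  rewrite /cdot !dotvBl (dotvC y x) !P; congr (_ - _).
  by rewrite dotv_mulmx dotvC -dotv_mulmx.
rewrite cpsqE {1}/cdot.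
have -> : x + t *: y - oproj L (x + t *: y) =
    (x - oproj L x) + t *: (y - oproj L y).
  by rewrite !P !mulmxDl -!scalemxAl scalerBr opprD addrACA.
rewrite dotvDl !dotvDr !dotvZl !dotvZr -/(cdot L x x) -/(cdot L x y).
by rewrite -/(cdot L y x) -/(cdot L y y) sym; ring.
Qed.

Lemma cpsqZ (R : realType) (d : nat) (L : {vspace 'rV[R]_d})
    (x : 'rV[R]_d) (t : R) : cpsq L (t *: x) = t ^+ 2 * cpsq L x.
Proof.
have o0 : oproj L 0 = 0 by apply: oproj_orth => w _; rewrite dot0v.
have := cpsq_pencil L 0 x t.
by rewrite add0r cpsqE /cdot o0 subr0 !dot0v !mulr0 !add0r => ->; rewrite cpsqE.
Qed.

Lemma cdot_trace (R : realType) (d n : nat) (L : {vspace 'rV[R]_d}) :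
  (n <= d)%N -> \dim L = n ->
  \sum_(i < d) cdot L (delta_mx 0 i) (delta_mx 0 i) = (d - n)%:R.
Proof.
move=> hn dL; have [U LU] := frame_exists dL.
have dd i : dotv (delta_mx 0 i) (delta_mx 0 i : 'rV[R]_d) = 1.
  rewrite dotvE trmx_delta mul_delta_mx mxE !eqxx//.
under eq_bigr do rewrite -cpsqE /cpsq dd /psq -(enorm_frame _ LU) enorm_sqr.
rewrite big_split/= sumr_const card_ord natrB//; congr (_ + _).
rewrite sumrN; congr (- _).
transitivity (\tr (U *m U^T)); last by rewrite LU.1 mxtrace1.
rewrite mxtrace_mulC /mxtrace; apply: eq_bigr => i _.
by rewrite -rowE [RHS]mxE; apply: eq_bigr => j _; rewrite !mxE.
Qed.

Lemma cdot_sum_sqr (R : realType) (d : nat) (L : {vspace 'rV[R]_d})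
    (x : 'rV[R]_d) :
  \sum_(i < d) cdot L x (delta_mx 0 i) ^+ 2 = cdot L x x.
Proof.
have [U LU] := frame_exists (erefl (\dim L)).
transitivity (dotv (x - oproj L x) (x - oproj L x)).
  apply: eq_bigr => i _; rewrite -expr2; congr (_ ^+ 2).
  by rewrite /cdot dotvE trmx_delta -colE mxE.
by rewrite -cpsqE /cpsq (psq_decomp L x) addrAC subrr add0r.
Qed.

Lemma bdmeas_psq (R : realType) (d n : nat) (hn : (n <= d)%N) (x : 'rV[R]_d) :
  bdmeas (fun L : grass_borel R hn => psq (val (L : grassmannian R hn)) x).
Proof.
split; first exact: measurable_psq.
by exists (dotv x x) => L; rewrite ger0_norm ?psq_ge0// psq_le.
Qed.

Lemma bdmeas_cpsq (R : realType) (d n : nat) (hn : (n <= d)%N) (x : 'rV[R]_d) :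
  bdmeas (fun L : grass_borel R hn => cpsq (val (L : grassmannian R hn)) x).
Proof.
apply: bdmeasD; first exact: bdmeas_cst.
have -> : (fun L : grass_borel R hn => - psq (val (L : grassmannian R hn)) x) =
    (fun L => (-1) * psq (val (L : grassmannian R hn)) x).
  by apply/funext => L; rewrite mulN1r.
by apply: bdmeasM; [exact: bdmeas_cst|exact: bdmeas_psq].
Qed.

Lemma bdmeas_cdot (R : realType) (d n : nat) (hn : (n <= d)%N)
    (x y : 'rV[R]_d) :
  bdmeas (fun L : grass_borel R hn => cdot (val (L : grassmannian R hn)) x y).
Proof.
have -> : (fun L : grass_borel R hn => cdot (val (L : grassmannian R hn)) x y) =
    (fun L => 2^-1 * (cpsq (val (L : grassmannian R hn)) (x + 1 *: y) +
      ((-1) * cpsq (val (L : grassmannian R hn)) x +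
       (-1) * cpsq (val (L : grassmannian R hn)) y))).
  by apply/funext => L; rewrite cpsq_pencil !cpsqE; field.
apply: bdmeasM; first exact: bdmeas_cst.
apply: bdmeasD; first exact: bdmeas_cpsq.
by apply: bdmeasD; (apply: bdmeasM; [exact: bdmeas_cst|exact: bdmeas_cpsq]).
Qed.

(** The moments of the squared distance of a unit vector to a random
    subspace. *)
Definition haar_moment (R : realType) (d n : nat) (hn : (n <= d)%N)
    (gamma : probability (grass_borel R hn) R) (e : 'rV[R]_d) (k : nat) : R :=
  \int[gamma]_L (cpsq (val (L : grassmannian R hn)) e ^+ k).

(** Both sides depend only on the length of [z], by invariance, and are
    homogeneous of the same degree. *)
Lemma haar_moment_scale (R : realType) (d n : nat) (hn : (n <= d)%N)
    (gamma : probability (grass_borel R hn) R) (e z : 'rV[R]_d) (k : nat) :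
  is_haar gamma -> dotv e e = 1 ->
  \int[gamma]_L (cpsq (val (L : grassmannian R hn)) z ^+ k) =
  dotv z z ^+ k * haar_moment gamma e k.
Proof.
move=> inv e1; pose h (r : R) := `|(dotv z z - r) ^+ k|.
have mh : measurable_fun setT h.
  apply: measurableT_comp => //; apply: measurable_funX.
  by apply: measurable_funB => //; exact: measurable_cst.
have zz : dotv z z = dotv (enorm z *: e) (enorm z *: e).
  by rewrite dotvZl dotvZr e1 mulr1 -expr2 enorm_sqr.
have := haar_psq inv mh (fun r => normr_ge0 _) zz.
have hE y : dotv y y = dotv z z -> forall L : grassmannian R hn,
    h (psq (val L) y) = cpsq (val L) y ^+ k.
  move=> yz L; rewrite /h -yz -/(cpsq _ y) ger0_norm// exprn_ge0//.
  exact: cpsq_ge0.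
move=> H; have {H} := congr1 fine H.
rewrite -/(Rintegral _ _ _) -/(Rintegral _ _ _).
under eq_Rintegral do rewrite hE//.
under [in RHS]eq_Rintegral do rewrite hE// cpsqZ exprMn enorm_sqr.
move=> ->; rewrite Rintegral_bdmeasZ//.
by apply: bdmeasX; exact: bdmeas_cpsq.
Qed.

(** * Moments of the distance to a random subspace *)

Lemma coef_trinomial (R : comNzRingType) (a b c : R) k i :
  ((a%:P + b *: 'X + c *: 'X^2) ^+ k.+1)`_i =
  a * ((a%:P + b *: 'X + c *: 'X^2) ^+ k)`_i +
  b * (if i is j.+1 then ((a%:P + b *: 'X + c *: 'X^2) ^+ k)`_j else 0) +
  c * (if i is j.+2 then ((a%:P + b *: 'X + c *: 'X^2) ^+ k)`_j else 0).
Proof.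
rewrite exprS mulrDl mulrDl !coefD -!scalerAl !coefZ coefCM coefXM coefXnM.
by case: i => [|[|i]] //=; rewrite subn2.
Qed.

Lemma coef0_trinomial (R : comNzRingType) (a b c : R) k :
  ((a%:P + b *: 'X + c *: 'X^2) ^+ k)`_0 = a ^+ k.
Proof.
elim: k => [|k IH]; first by rewrite expr0 coef1.
by rewrite coef_trinomial IH exprS !mulr0 !addr0.
Qed.

Lemma coef1_trinomial (R : comNzRingType) (a b c : R) k :
  ((a%:P + b *: 'X + c *: 'X^2) ^+ k)`_1 = k%:R * a ^+ k.-1 * b.
Proof.
elim: k => [|k IH]; first by rewrite expr0 coef1 !mul0r.
rewrite coef_trinomial IH coef0_trinomial /=.
by case: k {IH} => [|k] /=; rewrite ?expr0 ?exprS -?natr1; ring.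
Qed.

Lemma coef2_trinomial (R : comNzRingType) (a b c : R) k :
  ((a%:P + b *: 'X + c *: 'X^2) ^+ k)`_2 *+ 2 =
  (k%:R * a ^+ k.-1 * c) *+ 2 + k%:R * (k.-1)%:R * a ^+ k.-2 * b ^+ 2.
Proof.
elim: k => [|k IH]; first by rewrite expr0 coef1 !mul0r mul0rn addr0.
rewrite coef_trinomial coef1_trinomial coef0_trinomial 2!mulrnDl -(mulrnAr a) IH /=.
case: k {IH} => [|[|k]] /=; rewrite ?expr0 ?expr1.
- by rewrite !mul0r mul0rn !mulr0 !add0r !mul0r; ring.
- by rewrite mulr0 !mul0r !mulr2n; ring.
rewrite !exprS -[k.+3%:R]natr1 -[k.+2%:R]natr1 -[k.+1%:R]natr1 !mulr2n.
by move: (k%:R) (a ^+ k) => K P; ring.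
Qed.

Lemma size_trinomial (R : comNzRingType) (a b c : R) k i :
  (2 * k < i)%N -> ((a%:P + b *: 'X + c *: 'X^2) ^+ k)`_i = 0.
Proof.
elim: k i => [|k IH] i ki; first by rewrite expr0 coef1; case: i ki.
rewrite coef_trinomial; case: i ki => [|[|i]] // ki; rewrite !IH ?mulr0 ?addr0//;
  lia.
Qed.

Lemma bdmeas_coef_trinomial (R : realType) dT (T : measurableType dT)
    (a b c : T -> R) k i : bdmeas a -> bdmeas b -> bdmeas c ->
  bdmeas (fun x => (((a x)%:P + b x *: 'X + c x *: 'X^2) ^+ k)`_i).
Proof.
move=> ba bb bc; elim: k i => [|k IH] i.
  by under eq_fun do rewrite expr0; exact: bdmeas_cst.
under eq_fun do rewrite coef_trinomial.
by apply: bdmeasD; [apply: bdmeasD|]; apply: bdmeasM => //;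
  case: i => [|[|i]]; solve [exact: IH|exact: bdmeas_cst].
Qed.

(** Compare the coefficients of [t ^ 2] on both sides of
    [E cpsq (e + t f) ^ k = (1 + t ^ 2) ^ k * E cpsq e ^ k]. *)
Lemma haar_moment_orth (R : realType) (d n : nat) (hn : (n <= d)%N)
    (gamma : probability (grass_borel R hn) R) (e f : 'rV[R]_d) (k : nat) :
  is_haar gamma -> dotv e e = 1 -> dotv f f = 1 -> dotv e f = 0 ->
  \int[gamma]_L
    (k%:R * cdot (val (L : grassmannian R hn)) e e ^+ k.-1 *
       cdot (val (L : grassmannian R hn)) f f +
     2 * (k%:R * k.-1%:R) * cdot (val (L : grassmannian R hn)) e e ^+ k.-2 *
       cdot (val (L : grassmannian R hn)) e f ^+ 2) =
  k%:R * haar_moment gamma e k.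
Proof.
move=> inv e1 f1 ef.
pose a (L : grass_borel R hn) := cdot (val (L : grassmannian R hn)) e e.
pose b (L : grass_borel R hn) := 2 * cdot (val (L : grassmannian R hn)) e f.
pose c (L : grass_borel R hn) := cdot (val (L : grassmannian R hn)) f f.
have ba : bdmeas a by exact: bdmeas_cdot.
have bb : bdmeas b by apply: bdmeasM; [exact: bdmeas_cst|exact: bdmeas_cdot].
have bc : bdmeas c by exact: bdmeas_cdot.
pose p L := ((a L)%:P + b L *: 'X + c L *: 'X^2) ^+ k.
have bp i : bdmeas (fun L => (p L)`_i) by exact: bdmeas_coef_trinomial.
pose q := \poly_(i < (2 * k).+1) (\int[gamma]_L (p L)`_i).
have pE L t : (p L).[t] = cpsq (val (L : grassmannian R hn)) (e + t *: f) ^+ k.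
  rewrite cpsq_pencil /p horner_exp !hornerD !hornerZ hornerC hornerX hornerXn.
  by congr (_ ^+ _); rewrite /a /b /c; ring.
have qE t : q.[t] = (haar_moment gamma e k *: (1 + 'X^2) ^+ k).[t].
  rewrite hornerZ horner_exp hornerD hornerXn hornerC mulrC.
  have <- : dotv (e + t *: f) (e + t *: f) = 1 + t ^+ 2.
    by rewrite dotvDl !dotvDr !dotvZl !dotvZr (dotvC f e) e1 f1 ef; ring.
  rewrite -haar_moment_scale// horner_poly.
  under [RHS]eq_Rintegral => L _.
    rewrite -pE (horner_coef_wide t (n := (2 * k).+1)); last first.
      by apply/leq_sizeP => i ki; exact: size_trinomial.
    over.
  rewrite Rintegral_bdmeas_sum; last first.
    by move=> i; apply: bdmeasM => //; exact: bdmeas_cst.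
  apply: eq_bigr => i _; rewrite mulrC.
  under [RHS]eq_Rintegral do rewrite mulrC.
  by rewrite Rintegral_bdmeasZ.
(* Polynomials that agree at every natural number are equal. *)
have qq : q = haar_moment gamma e k *: (1 + 'X^2) ^+ k.
  apply/eqP; rewrite -subr_eq0; apply/eqP.
  set r := (q - _).
  apply: (@roots_geq_poly_eq0 _ _ [seq i%:R | i <- iota 0 (size r).+1]).
  - apply/allP => _ /mapP[i _ ->]; rewrite /root /r hornerD hornerN qE subrr//.
  - rewrite map_inj_uniq ?iota_uniq// => i j /eqP; rewrite eqr_nat => /eqP//.
  - by rewrite size_map size_iota.
have := congr1 (fun u : {poly R} => u`_2 *+ 2) qq.
have -> : (1 + 'X^2 : {poly R}) = 1%:P + 0 *: 'X + 1 *: 'X^2.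
  by rewrite scale0r addr0 scale1r.
rewrite /= coefZ -mulrnAr coef2_trinomial expr1n expr0n/= !mulr0 addr0 !mulr1.
have -> : q`_2 = \int[gamma]_L (p L)`_2.
  rewrite coef_poly; case: ifP => // /negbT; rewrite -leqNgt => k2.
  rewrite -[LHS](mul0r (\int[gamma]_L 1)).
  rewrite -Rintegral_bdmeasZ; last exact: bdmeas_cst.
  by apply: eq_Rintegral => L _; rewrite mul0r /p size_trinomial// -ltnS.
move=> H.
have {}H : \int[gamma]_L (p L)`_2 = k%:R * haar_moment gamma e k.
  by apply: (@mulIf _ 2) => //; rewrite !mulr2n in H; rewrite mulrDr mulr1 H; ring.
rewrite -H; apply: eq_Rintegral => L _.
apply: (@mulIf _ 2) => //; rewrite [RHS]mulr_natr /p coef2_trinomial !mulr2n.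
by rewrite /a /b /c; ring.
Qed.

(** Sum [haar_moment_orth] over the vectors of an orthonormal basis other than
    [e]; the trace of [cdot] and Parseval make the integrand a polynomial in
    [cdot e e]. These are the moments of a Beta law. *)
Lemma haar_moment_rec (R : realType) (d n : nat) (hn : (n <= d)%N)
    (gamma : probability (grass_borel R hn) R) (i0 : 'I_d) (k : nat) :
  is_haar gamma ->
  haar_moment gamma (delta_mx 0 i0) k.+1 * (d%:R + 2 * k%:R) =
  haar_moment gamma (delta_mx 0 i0) k * ((d - n)%:R + 2 * k%:R).
Proof.
move=> inv; set e := delta_mx 0 i0.
have dd i j : dotv (delta_mx 0 i) (delta_mx 0 j : 'rV[R]_d) = (i == j)%:R.
  by rewrite dotvE trmx_delta mul_delta_mx_cond mulrb; case: eqVneq => _;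
    rewrite !mxE ?eqxx.
pose A (L : grass_borel R hn) := cdot (val (L : grassmannian R hn)) e e.
have bA j : bdmeas (fun L => A L ^+ j) by apply: bdmeasX; exact: bdmeas_cdot.
have mA j : \int[gamma]_L (A L ^+ j) = haar_moment gamma e j.
  by apply: eq_Rintegral => L _; rewrite /A -cpsqE.
pose g (i : 'I_d) (L : grass_borel R hn) :=
  k.+1%:R * A L ^+ k *
    cdot (val (L : grassmannian R hn)) (delta_mx 0 i) (delta_mx 0 i) +
  2 * (k.+1%:R * k%:R) * A L ^+ k.-1 *
    cdot (val (L : grassmannian R hn)) e (delta_mx 0 i) ^+ 2.
have bg i : bdmeas (g i).
  apply: bdmeasD; (apply: bdmeasM; last first;
    [try apply: bdmeasX; exact: bdmeas_cdot|
     apply: bdmeasM; [exact: bdmeas_cst|exact: bA]]).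
have Hg i : i != i0 -> \int[gamma]_L g i L = k.+1%:R * haar_moment gamma e k.+1.
  by move=> ii0; apply: haar_moment_orth; rewrite // dd ?eqxx// eq_sym (negbTE ii0).
have S1 : \int[gamma]_L (\sum_(i <- [seq i <- index_enum 'I_d | i != i0]) g i L) =
    (d.-1)%:R * (k.+1%:R * haar_moment gamma e k.+1).
  rewrite Rintegral_bdmeas_sum// big_filter (eq_bigr _ Hg).
  by rewrite sumr_const cardC1 card_ord [RHS]mulr_natl.
have S2 L : \sum_(i <- [seq i <- index_enum 'I_d | i != i0]) g i L =
    k.+1%:R * ((d - n)%:R + 2 * k%:R) * A L ^+ k +
    (- (k.+1%:R * (1 + 2 * k%:R))) * A L ^+ k.+1.
  have : \sum_(i < d) g i L = k.+1%:R * A L ^+ k * (d - n)%:R +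
      2 * (k.+1%:R * k%:R) * A L ^+ k.-1 * A L.
    rewrite /g big_split/= -!mulr_sumr (cdot_trace hn); last exact/eqP/(valP L).
    by rewrite cdot_sum_sqr.
  rewrite (bigD1 i0)//= {1}/g -/e -/(A L) big_filter => /(canRL (addKr _)) ->.
  have pw : k%:R * A L ^+ k.-1 * A L = k%:R * A L ^+ k.
    by case: (k) => [|j] /=; rewrite ?mul0r// exprSr mulrA.
  have -> : 2 * (k.+1%:R * k%:R) * A L ^+ k.-1 * A L =
            2 * k.+1%:R * (k%:R * A L ^+ k.-1 * A L) by ring.
  have -> : 2 * (k.+1%:R * k%:R) * A L ^+ k.-1 * A L ^+ 2 =
            2 * k.+1%:R * (k%:R * A L ^+ k.-1 * A L) * A L by ring.
  by rewrite pw exprS; ring.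
have S3 : \int[gamma]_L (\sum_(i <- [seq i <- index_enum 'I_d | i != i0]) g i L) =
    k.+1%:R * ((d - n)%:R + 2 * k%:R) * haar_moment gamma e k +
    (- (k.+1%:R * (1 + 2 * k%:R))) * haar_moment gamma e k.+1.
  under eq_Rintegral do rewrite S2.
  rewrite RintegralD//; last 2 first.
  - by apply: bdmeas_integrable; apply: bdmeasM => //; exact: bdmeas_cst.
  - by apply: bdmeas_integrable; apply: bdmeasM => //; exact: bdmeas_cst.
  by rewrite !Rintegral_bdmeasZ// !mA.
have d1 : (d.-1)%:R = d%:R - 1 :> R.
  by rewrite -subn1 natrB// (leq_ltn_trans _ (ltn_ord i0)).
move: S1; rewrite S3 d1 => H; apply: (@mulfI _ k.+1%:R) => //.
by move: H; set x := haar_moment _ _ k.+1; set y := haar_moment _ _ k => H; lra.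
Qed.

Lemma haar_moment0 (R : realType) (d n : nat) (hn : (n <= d)%N)
    (gamma : probability (grass_borel R hn) R) (e : 'rV[R]_d) :
  haar_moment gamma e 0 = 1.
Proof.
rewrite /haar_moment; under eq_Rintegral do rewrite expr0.
by rewrite Rintegral_cst// mul1r; have /(congr1 fine) := probability_setT gamma.
Qed.

(** * The binomial series with half-integral exponent *)

(** The coefficients of [(1 - x) ^ (- m / 2)]. *)
Fixpoint half_binom (R : realType) (m k : nat) : R :=
  if k is j.+1 then half_binom R m j * (m%:R / 2 + j%:R) / j.+1%:R else 1.

Lemma half_binom_ge0 (R : realType) m k : 0 <= half_binom R m k.
Proof.
by elim: k => //= k IH; rewrite divr_ge0// mulr_ge0// addr_ge0// divr_ge0.
Qed.

(** Consecutive terms have ratio at most [1 + m / (k + 1)], hence at most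
    [((k + 2) / (k + 1)) ^ m] by Bernoulli's inequality. *)
Lemma half_binom_le (R : realType) m k : half_binom R m k <= k.+1%:R ^+ m.
Proof.
elim: k => [|k IH] /=; first by rewrite expr1n.
rewrite ler_pdivrMr//.
have H : m%:R / 2 + k%:R <= k.+1%:R * (1 + m%:R / k.+1%:R) :> R.
  rewrite mulrDr mulr1 mulrCA divff// mulr1 -[k.+1%:R]natr1.
  have m0 : 0 <= m%:R :> R by []. lra.
apply: le_trans (ler_pM (half_binom_ge0 _ _ _) _ IH H) _.
  by rewrite addr_ge0// divr_ge0.
rewrite mulrCA [leRHS]mulrC; apply: ler_wpM2l => //.
have -> : k.+2%:R = k.+1%:R * (1 + k.+1%:R^-1) :> R.
  by rewrite mulrDr mulr1 divff// natr1.
rewrite exprMn; apply: ler_wpM2l; first exact: exprn_ge0.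
elim: m {IH H} => [|m IHm]; first by rewrite mul0r addr0 expr0.
rewrite exprS; apply: le_trans (_ : (1 + k.+1%:R^-1) * (1 + m%:R / k.+1%:R) <= _).
  rewrite -[m.+1%:R]natr1; set u : R := k.+1%:R^-1; have u0 : 0 <= u by rewrite invr_ge0.
  have m0 : 0 <= m%:R * u ^+ 2 by rewrite mulr_ge0// sqr_ge0.
  by nra.
by apply: ler_wpM2l => //; rewrite addr_ge0// invr_ge0.
Qed.

Lemma exprn_le_expR (R : realType) (m : nat) (y : R) :
  0 <= y -> y ^+ m <= m%:R ^+ m * expR y.
Proof.
case: m => [|m] y0; first by rewrite !expr0 mul1r -expR0 ler_expR.
have -> : expR y = expR (y / m.+1%:R) ^+ m.+1.
  by rewrite -expRM_natl mulrC divfK.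
rewrite -exprMn ler_pXn2r// ?nnegrE ?mulr_ge0 ?expR_ge0//.
rewrite -ler_pdivrMl// mulrC.
by apply: le_trans (expR_ge1Dx _); rewrite lerDr.
Qed.

(** Sequences of polynomial growth are closed under formal derivation of the
    power series, which has radius of convergence at least 1. *)
Definition poly_growth (R : realType) (c : nat -> R) : Prop :=
  exists C M, forall k, `|c k| <= C * k.+1%:R ^+ M.

Lemma poly_growth_diffs (R : realType) (c : nat -> R) :
  poly_growth c -> poly_growth (pseries_diffs c).
Proof.
move=> [C [M cM]]; exists (C * 2 ^+ M), M.+1 => k.
have C0 : 0 <= C.
  by have := cM 0; rewrite expr1n mulr1; exact: le_trans.
rewrite /pseries_diffs normrM normr_nat mulrC.
have -> : C * 2 ^+ M * k.+1%:R ^+ M.+1 = C * (2 * k.+1%:R) ^+ M * k.+1%:R.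
  by rewrite exprMn exprS; ring.
apply: ler_wpM2r => //; apply: le_trans (cM _) _; apply: ler_wpM2l => //.
by rewrite lerXn2r// ?nnegrE// -natrM ler_nat; lia.
Qed.

Lemma poly_growth_cvg (R : realType) (c : nat -> R) (x : R) :
  poly_growth c -> `|x| < 1 -> cvgn (pseries c x).
Proof.
move=> [C [M cM]] x1.
have [z xz z1] : exists2 z, `|x| < z & z < 1 :> R.
  by exists ((`|x| + 1) / 2); lra.
have z0 : 0 < z by apply: le_lt_trans xz.
suff : cvgn (pseries c z).
  by move/is_cvg_pseries_inside; apply; rewrite (ger0_norm (ltW z0)).
pose t := - ln z / 2.
have t0 : 0 < t by rewrite /t divr_gt0// oppr_gt0 ln_lt0// z0.
have tz : expR t * z < 1.
  rewrite -[X in _ * X]lnK ?posrE// -expRD -[ltRHS]expR0 ltr_expR /t.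
  by have := @ln_lt0 _ z; rewrite z0 z1 => /(_ isT); lra.
apply: normed_cvg.
pose D := C * ((M%:R / t) ^+ M * expR t).
have C0 : 0 <= C.
  by have := cM 0; rewrite expr1n mulr1; exact: le_trans.
have D0 : 0 <= D.
  by rewrite mulr_ge0// mulr_ge0 ?expR_ge0// exprn_ge0// divr_ge0// ltW.
have tz0 : 0 <= expR t * z by rewrite mulr_ge0 ?expR_ge0// ltW.
apply: (@series_le_cvg _ _ (fun k => D * (expR t * z) ^+ k)).
- by move=> k /=.
- by move=> k; rewrite mulr_ge0// exprn_ge0.
- move=> k /=; rewrite normrM normrX (ger0_norm (ltW z0)) exprMn mulrA.
  apply: ler_wpM2r; first by rewrite exprn_ge0// ltW.
  apply: le_trans (cM k) _; rewrite /D -mulrA; apply: ler_wpM2l => //.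
  have := @exprn_le_expR R M (t * k.+1%:R); rewrite mulr_ge0 ?(ltW t0)//.
  move=> /(_ isT); rewrite exprMn -ler_pdivlMl ?exprn_gt0// => /le_trans; apply.
  have -> : expR (t * k.+1%:R) = expR t * expR t ^+ k.
    by rewrite -[k.+1%:R]natr1 mulrDr mulr1 expRD expRM_natr mulrC.
  rewrite [(_ / t) ^+ _]exprMn exprVn.
  by rewrite le_eqVlt; apply/orP; left; apply/eqP; ring.
by apply: is_cvg_geometric_series; rewrite ger0_norm.
Qed.

(** The sum [f] solves [(1 - t) f' = (m / 2) f], so that
    [f ^ 2 * (1 - t) ^ m] is constant. *)
Lemma half_binom_series (R : realType) (m : nat) (x : R) : 0 <= x < 1 ->
  pseries (half_binom R m) x @ \oo --> (Num.sqrt (1 - x))^-1 ^+ m.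
Proof.
move=> /andP[x0 x1]; set b := half_binom R m.
have gb : poly_growth b.
  by exists 1, m => k; rewrite mul1r ger0_norm ?half_binom_ge0// half_binom_le.
have gdb := poly_growth_diffs gb; have gddb := poly_growth_diffs gdb.
pose f t := limn (pseries b t); pose f' t := limn (pseries (pseries_diffs b) t).
have df t : `|t| < 1 -> is_derive t (1 : R) f (f' t).
  move=> t1; pose z := (`|t| + 1) / 2.
  have z1 : `|z| < 1 by rewrite ger0_norm /z; have := normr_ge0 t; lra.
  have tz : `|t| < `|z| by rewrite (ger0_norm (_ : 0 <= z)) /z; have := normr_ge0 t; lra.
  by apply: (pseries_snd_diffs _ _ _ tz); exact: poly_growth_cvg.
have ode t : `|t| < 1 -> (1 - t) * f' t = m%:R / 2 * f t.
  move=> t1; rewrite mulrBl mul1r; apply/eqP; rewrite subr_eq; apply/eqP.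
  have cb := poly_growth_cvg gb t1; have cdb := poly_growth_cvg gdb t1.
  apply/(cvg_lim (@Rhausdorff R)).
  have -> : pseries (pseries_diffs b) t = (fun N => m%:R / 2 * pseries b t N +
      t * [series i%:R * b i * t ^+ i.-1]_i N).
    apply/funext => N; rewrite /pseries /series /= !mulr_sumr -big_split/=.
    apply: eq_bigr => i _; rewrite /pseries_diffs.
    have -> : i.+1%:R * b i.+1 = b i * (m%:R / 2 + i%:R).
      by rewrite /b /= mulrC divfK.
    by case: i => [|i]; rewrite ?mul0r ?mulr0 ?exprS /=; ring.
  by apply: cvgD; apply: cvgMr => //; exact: pseries_diffs_equiv.
pose G t := f t ^+ 2 * (1 - t) ^+ m.
have dG t : `|t| < 1 -> is_derive t (1 : R) G 0.
  move=> t1; have dft := df t t1.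
  have -> : G = (f ^+ 2) * ((cst 1 - id) ^+ m).
    by apply/funext => u; rewrite /G /= !fctE.
  apply: is_derive_eq; rewrite /= !fctE.
  have t1' : 1 - t != 0 by rewrite subr_eq0 eq_sym; apply: contraTneq t1 => ->;
    rewrite normr1 ltxx.
  apply: (mulfI t1'); rewrite mulr0 mulrDr.
  have E1 : (1 - t) * (m%:R * (1 - t) ^+ m.-1) = m%:R * (1 - t) ^+ m.
    by rewrite mulrCA -exprS; case: (m) => [|j] //; rewrite !mul0r.
  rewrite /GRing.scale/= expr1 mulrCA [_ * ((_ * _) * (0 - 1))]mulrA E1.
  have -> : (1 - t) * ((1 - t) ^+ m * (2 * f t * f' t)) =
            (1 - t) ^+ m * (2 * f t * ((1 - t) * f' t)) by ring.
  by rewrite ode//; field.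
have f0 : f 0 = 1.
  apply: lim_near_cst => //; near=> N.
  have -> : N = N.-1.+1 by rewrite prednK//; near: N; exact: nbhs_infty_gt.
  rewrite /pseries /series /= big_nat_recl//= expr0 mulr1.
  by rewrite big1 ?addr0// => i _; rewrite expr0n mulr0.
have Gx : G x = 1.
  have G0 : G 0 = 1 by rewrite /G f0 subr0 !expr1n mulr1.
  move: x0; rewrite le_eqVlt => /predU1P[<-//|xp].
  have dG' t : t \in `]0, x[%R -> is_derive t (1 : R) G ((fun=> 0) t).
    rewrite in_itv/= => /andP[t0 tx]; apply: dG.
    by rewrite gtr0_norm// (lt_trans tx).
  have cG : {within `[0, x], continuous G}.
    apply: derivable_within_continuous => t; rewrite in_itv/= => /andP[t0 tx].
    have : `|t| < 1 by rewrite ger0_norm// (le_lt_trans tx).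
    by move/dG => [].
  have [c _] := MVT xp dG' cG.
  by rewrite mul0r => /eqP; rewrite subr_eq0 => /eqP ->.
have fx0 : 0 <= f x.
  apply: limr_ge; first by apply: poly_growth_cvg => //; rewrite ger0_norm.
  apply: nearW => N; rewrite /pseries /series /=; apply: sumr_ge0 => i _.
  by rewrite mulr_ge0 ?half_binom_ge0// exprn_ge0.
have x1p : 0 < 1 - x by rewrite subr_gt0.
suff <- : f x = (Num.sqrt (1 - x))^-1 ^+ m.
  by apply: poly_growth_cvg => //; rewrite ger0_norm.
apply/eqP; rewrite -(eqrXn2 (n := 2))// ?exprn_ge0 ?invr_ge0 ?sqrtr_ge0//.
apply/eqP; rewrite -exprM mulnC exprM exprVn sqr_sqrtr ?(ltW x1p)// exprVn.
by apply: (@divIf _ ((1 - x) ^- m)); rewrite ?invr_eq0 ?expf_neq0 ?gt_eqF//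
  invrK -/(G x) Gx mulVf// expf_neq0// gt_eqF.
Unshelve. all: by end_near. Qed.

(** * The kernel and its mean *)

Lemma nneseries_EFin (R : realType) (u : nat -> R) (l : R) :
  series u @ \oo --> l -> (\sum_(0 <= k <oo) (u k)%:E)%E = l%:E.
Proof.
move=> ul; apply: cvg_lim => //.
have -> : (fun N => (\sum_(0 <= k < N) (u k)%:E)%E) = EFin \o series u.
  by apply/funext => N; rewrite /= sumEFin.
by apply: cvg_EFin; [exact: nearW|exact: ul].
Qed.

Lemma EFin_Rintegral (R : realType) dT (T : measurableType dT)
    (P : probability T R) (f : T -> R) :
  bdmeas f -> (\int[P]_x (f x)%:E)%E = (\int[P]_x f x)%:E.
Proof.
by move=> bf; rewrite fineK//; apply: integrable_fin_num => //;
  exact: bdmeas_integrable.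
Qed.

(** A radial kernel on [R ^ n], as a function of the squared distance [w],
    with width [Num.sqrt t] and mass independent of [t]. With the ambient
    dimension [d] as exponent its mean over the Grassmannian is explicit
    ([haar_kern]) and it is positive definite ([posdef_kern]). *)
Definition kern (R : realType) (d n : nat) (t w : R) : R :=
  Num.sqrt t ^+ (d - n) * (Num.sqrt (t + w))^-1 ^+ d.

Lemma kern_ge0 (R : realType) (d n : nat) (t w : R) : 0 <= kern d n t w.
Proof. by rewrite mulr_ge0// exprn_ge0// ?invr_ge0 sqrtr_ge0. Qed.

Lemma bdmeas_kern (R : realType) (d n : nat) (hn : (n <= d)%N) (t : R)
    (z : 'rV[R]_d) : 0 < t ->
  bdmeas (fun L : grass_borel R hn =>
    kern d n t (psq (val (L : grassmannian R hn)) z)).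
Proof.
move=> t0; apply: bdmeasM; first exact: bdmeas_cst.
apply: bdmeasX; split.
  pose h (w : R) := (Num.sqrt (t + `|w|))^-1.
  have hp (w : R) : 0 < t + `|w| by rewrite ltr_wpDr.
  have c1 : continuous (fun w : R => t + `|w|).
    by move=> w; apply: cvgD; [exact: cvg_cst|apply: cvg_norm; exact: cvg_id].
  have c2 : continuous (@Num.sqrt R \o (fun w : R => t + `|w|)).
    by move=> w; apply: continuous_comp; [exact: c1|exact: sqrt_continuous].
  have ch : continuous h.
    move=> w; apply: (@continuousV _ _ (@Num.sqrt R \o (fun w : R => t + `|w|))).
      by rewrite /= gt_eqF// sqrtr_gt0.
    exact: c2.
  have -> : (fun L : grass_borel R hn =>
       (Num.sqrt (t + psq (val (L : grassmannian R hn)) z))^-1) =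
      h \o (fun L : grass_borel R hn => psq (val (L : grassmannian R hn)) z).
    by apply/funext => L; rewrite /h /= ger0_norm ?psq_ge0.
  apply: measurableT_comp; last exact: measurable_psq.
  exact: continuous_measurable_fun.
exists (Num.sqrt t)^-1 => L; rewrite ger0_norm ?invr_ge0 ?sqrtr_ge0//.
have p0 := psq_ge0 (val (L : grassmannian R hn)) z.
rewrite lef_pV2 ?posrE ?sqrtr_gt0//; last by rewrite ltr_wpDr.
by rewrite ler_sqrt ?lerDl// addr_ge0// ltW.
Qed.

(** The average of [kern] over the subspaces is explicit. With
    [y = cpsq L z / (t + |z|^2)], it is the average of [(1 - y) ^ (- d / 2)],
    expanded in powers of [y]; the moments of [cpsq] turn the exponent [d / 2]
    into [(d - n) / 2]. *)
Lemma haar_kern (R : realType) (d n : nat) (hn : (n <= d)%N)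
    (gamma : probability (grass_borel R hn) R) (t : R) (z : 'rV[R]_d) :
  is_haar gamma -> 0 < t ->
  \int[gamma]_L kern d n t (psq (val (L : grassmannian R hn)) z) =
  (Num.sqrt (t + dotv z z))^-1 ^+ n.
Proof.
move=> inv t0; have Z0 := dotv_ge0 z; set Z := dotv z z in Z0 *.
have tZ : 0 < t + Z by rewrite ltr_wpDr.
have [zz|zz] := eqVneq Z 0.
  under eq_Rintegral => L _.
    have -> : psq (val (L : grassmannian R hn)) z = 0.
      by apply/eqP; rewrite eq_le psq_ge0 (le_trans (psq_le _ _))// -/Z zz.
    over.
  rewrite Rintegral_cst//; have /(congr1 fine) /= -> := probability_setT gamma.
  rewrite mulr1 /kern zz !addr0 -{2}(subnK hn) exprD mulrA exprVn divff ?mul1r//.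
  by rewrite expf_neq0// gt_eqF// sqrtr_gt0.
have d0 : (0 < d)%N.
  rewrite lt0n; apply: contraNneq zz => d0.
  by rewrite /Z /dotv big1// => i _; have := ltn_ord i; rewrite {2}d0.
pose i0 := Ordinal d0; pose e : 'rV[R]_d := delta_mx 0 i0.
have e1 : dotv e e = 1 by rewrite dotvE trmx_delta mul_delta_mx mxE !eqxx.
pose x := Z / (t + Z).
have x01 : 0 <= x < 1.
  by rewrite divr_ge0 ?(ltW tZ)//= ltr_pdivrMr// mul1r ltrDr.
pose y (L : grassmannian R hn) := cpsq (val L) z / (t + Z).
have y01 L : 0 <= y L < 1.
  rewrite divr_ge0 ?cpsq_ge0 ?(ltW tZ)//= ltr_pdivrMr// mul1r.
  by apply: le_lt_trans (cpsq_le _ _) _; rewrite ltrDr.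
have hb k : half_binom R d k * haar_moment gamma e k = half_binom R (d - n) k.
  elim: k => [|k IH]; first by rewrite /= haar_moment0 mulr1.
  rewrite /= -IH; have := haar_moment_rec i0 k inv; rewrite -/e => H.
  have {}H : (d%:R / 2 + k%:R) * haar_moment gamma e k.+1 =
             haar_moment gamma e k * ((d - n)%:R / 2 + k%:R) by lra.
  transitivity (half_binom R d k *
      ((d%:R / 2 + k%:R) * haar_moment gamma e k.+1) / k.+1%:R); first by field.
  by rewrite H; field.
have byk k c : bdmeas (fun L : grass_borel R hn => c * y L ^+ k).
  apply: bdmeasM; first exact: bdmeas_cst.
  apply: bdmeasX; apply: bdmeasM; last exact: bdmeas_cst.
  exact: bdmeas_cpsq.
have intyk k : \int[gamma]_L (half_binom R d k * y L ^+ k) =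
    half_binom R (d - n) k * x ^+ k.
  under eq_Rintegral do rewrite /y exprMn mulrA mulrAC.
  rewrite Rintegral_bdmeasZ; last by apply: bdmeasX; exact: bdmeas_cpsq.
  by rewrite (haar_moment_scale _ _ inv e1) -hb /x exprMn -/Z; ring.
have intS : (\int[gamma]_L ((Num.sqrt (1 - y L))^-1 ^+ d)%:E)%E =
    ((Num.sqrt (1 - x))^-1 ^+ (d - n))%:E.
  rewrite -(nneseries_EFin (half_binom_series (m := (d - n)%N) x01)).
  transitivity (\sum_(0 <= k <oo)
      \int[gamma]_L (half_binom R d k * y L ^+ k)%:E)%E; last first.
    by apply: eq_eseriesr => k _; rewrite EFin_Rintegral// intyk.
  rewrite -integral_nneseries//.
  - by apply: eq_integral => L _; rewrite (nneseries_EFin (half_binom_series (m := d) (y01 L))).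
  - by move=> k; apply/measurable_EFinP; have [] := byk k (half_binom R d k).
  - move=> k L _; rewrite lee_fin mulr_ge0 ?half_binom_ge0// exprn_ge0//.
    by have /andP[] := y01 L.
pose c := Num.sqrt t ^+ (d - n) * (Num.sqrt (t + Z))^-1 ^+ d.
have kE L : kern d n t (psq (val (L : grassmannian R hn)) z) =
    c * (Num.sqrt (1 - y L))^-1 ^+ d.
  rewrite /kern /c -mulrA -exprMn -invfM -sqrtrM ?(ltW tZ)//.
  by congr (_ * (Num.sqrt _)^-1 ^+ _); rewrite /y /cpsq -/Z; field; rewrite gt_eqF.
under eq_Rintegral do rewrite kE.
have bS : bdmeas (fun L : grass_borel R hn => (Num.sqrt (1 - y L))^-1 ^+ d).
  have -> : (fun L : grass_borel R hn => (Num.sqrt (1 - y L))^-1 ^+ d) =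
      (fun L => c^-1 * kern d n t (psq (val (L : grassmannian R hn)) z)).
    apply/funext => L; rewrite kE mulKf// /c mulf_neq0// expf_neq0 ?invr_eq0//;
      by rewrite gt_eqF// sqrtr_gt0.
  by apply: bdmeasM; [exact: bdmeas_cst|exact: bdmeas_kern].
rewrite Rintegral_bdmeasZ// /Rintegral intS /= /c.
have -> : 1 - x = t / (t + Z) by rewrite /x; field; rewrite gt_eqF.
rewrite sqrtrM ?(ltW t0)// sqrtrV ?(ltW tZ)// invfM invrK exprMn.
rewrite -{2}(subnK hn) exprD !exprVn.
have : Num.sqrt t ^+ (d - n) != 0 by rewrite expf_neq0// gt_eqF// sqrtr_gt0.
have : Num.sqrt (t + Z) ^+ (d - n) != 0 by rewrite expf_neq0// gt_eqF// sqrtr_gt0.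
have : Num.sqrt (t + Z) ^+ n != 0 by rewrite expf_neq0// gt_eqF// sqrtr_gt0.
by move=> h1 h2 h3; field; rewrite h1 h2 h3.
Qed.

(** * Positive definite kernels *)

Definition posdef (R : realType) (T : Type) (k : T -> T -> R) : Prop :=
  forall s : seq (R * T),
    0 <= \sum_(a <- s) \sum_(b <- s) a.1 * b.1 * k a.2 b.2.

Lemma posdef_cst1 (R : realType) (T : Type) : posdef (fun _ _ : T => 1 : R).
Proof.
move=> s; have -> : \sum_(a <- s) \sum_(b <- s) a.1 * b.1 * 1 =
    (\sum_(a <- s) a.1) ^+ 2.
  rewrite expr2 mulr_suml; apply: eq_bigr => a _; rewrite mulr_sumr.
  by apply: eq_bigr => b _; rewrite mulr1.
exact: sqr_ge0.
Qed.

Lemma posdef_comp (R : realType) (T T' : Type) (k : T -> T -> R)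
    (f : T' -> T) (c : T' -> R) :
  posdef k -> posdef (fun a b => c a * c b * k (f a) (f b)).
Proof.
move=> pk s; have := pk [seq (a.1 * c a.2, f a.2) | a <- s].
rewrite big_map /=; under eq_bigr do rewrite big_map /=.
move=> /le_trans; apply; rewrite le_eqVlt; apply/orP; left; apply/eqP.
by apply: eq_bigr => a _; apply: eq_bigr => b _; ring.
Qed.

Lemma Rintegral_big_sum (R : realType) dT (T : measurableType dT)
    (mu : {measure set T -> \bar R}) (I : Type) (r : seq I) (f : I -> T -> R) :
  (forall i, mu.-integrable setT (EFin \o f i)) ->
  \int[mu]_x (\sum_(i <- r) f i x) = \sum_(i <- r) \int[mu]_x f i x /\
  mu.-integrable setT (EFin \o (fun x => \sum_(i <- r) f i x)).
Proof.
move=> fi; elim: r => [|i r [IH1 IH2]].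
  split; last by under eq_fun do rewrite big_nil; exact: integrable0.
  under eq_Rintegral do rewrite big_nil.
  by rewrite big_nil /Rintegral integral0.
split; last first.
  have := integrableD measurableT (fi i) IH2.
  by apply: eq_integrable => // x _ /=; rewrite big_cons.
under eq_Rintegral do rewrite big_cons.
by rewrite big_cons -IH1 RintegralD.
Qed.

Lemma posdef_mix (R : realType) (T : Type) dU (U : measurableType dU)
    (mu : {measure set U -> \bar R}) (k : U -> T -> T -> R) :
  (forall u, posdef (k u)) ->
  (forall a b, mu.-integrable setT (EFin \o (fun u => k u a b))) ->
  posdef (fun a b => \int[mu]_u k u a b).
Proof.
move=> pk ki s.
have ki' c a b : mu.-integrable setT (EFin \o (fun u => c * k u a b)).
  by have := integrableZl measurableT c (ki a b).
have E a : \sum_(b <- s) a.1 * b.1 * \int[mu]_u k u a.2 b.2 =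
    \int[mu]_u (\sum_(b <- s) a.1 * b.1 * k u a.2 b.2).
  rewrite (Rintegral_big_sum _ (fun b => ki' (a.1 * b.1) a.2 b.2)).1.
  by apply: eq_bigr => b _; rewrite RintegralZl.
under eq_bigr do rewrite E.
rewrite -(Rintegral_big_sum _ _).1; last first.
  by move=> a; exact: (Rintegral_big_sum _ (fun b => ki' (a.1 * b.1) a.2 b.2)).2.
by apply: Rintegral_ge0 => u _; exact: pk.
Qed.

(** Schur's product theorem, for a factor given as a Gram matrix. *)
Lemma posdef_mul_gram (R : realType) (T : Type) dU (U : measurableType dU)
    (mu : {measure set U -> \bar R}) (k : T -> T -> R) (f : T -> U -> R) :
  posdef k ->
  (forall a b, mu.-integrable setT (EFin \o (fun u => f a u * f b u))) ->
  posdef (fun a b => k a b * \int[mu]_u (f a u * f b u)).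
Proof.
move=> pk fi.
have E a b : k a b * \int[mu]_u (f a u * f b u) =
    \int[mu]_u (f a u * f b u * k a b).
  by rewrite -RintegralZl//; apply: eq_Rintegral => u _; rewrite mulrC.
have -> : (fun a b => k a b * \int[mu]_u (f a u * f b u)) =
    (fun a b => \int[mu]_u (f a u * f b u * k a b)).
  by apply/funext => a; apply/funext => b; exact: E.
apply: posdef_mix => [u|a b]; first exact: (posdef_comp id (fun a => f a u) pk).
have := integrableZl measurableT (k a b) (fi a b).
by apply: eq_integrable => // u _ /=; rewrite -EFinM mulrC.
Qed.

(** Almost orthogonality: [Y] spans few directions, [X] correlates with each
    of its elements, and [B] bounds the row sums of its Gram matrix. *)
Lemma posdef_count (R : realType) (T : Type) (I : eqType) (k : T -> T -> R)
    (X : seq (R * T)) (Y : seq I) (q : I -> T) (eta B : R) :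
  posdef k -> (forall a b, k a b = k b a) -> 0 <= eta -> 0 < B ->
  (forall y, y \in Y -> eta <= \sum_(b <- X) b.1 * k (q y) b.2) ->
  (forall y, y \in Y -> \sum_(y' <- Y) k (q y) (q y') <= B) ->
  (size Y)%:R * eta ^+ 2 <=
    B * \sum_(a <- X) \sum_(b <- X) a.1 * b.1 * k a.2 b.2.
Proof.
move=> pk sk eta0 B0 Yeta YB; set Q := \sum_(a <- X) _.
(* The form is nonnegative at [X - al * Y]; this [al] optimises the bound. *)
pose al := eta / B; have al0 : 0 <= al by rewrite divr_ge0// ltW.
have := pk (X ++ [seq (- al, q y) | y <- Y]).
rewrite big_cat /=.
under eq_bigr do rewrite big_cat /= big_map /=.
rewrite big_split /= -/Q big_map /=.
under [X in _ + X]eq_bigr do rewrite big_cat /= big_map /=.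
rewrite big_split /=.
pose H y := \sum_(b <- X) b.1 * k (q y) b.2.
have -> : \sum_(a <- X) \sum_(y <- Y) a.1 * - al * k a.2 (q y) =
    - al * \sum_(y <- Y) H y.
  rewrite exchange_big mulr_sumr; apply: eq_bigr => y _; rewrite mulr_sumr.
  by apply: eq_bigr => a _; rewrite sk; ring.
have -> : \sum_(y <- Y) \sum_(b <- X) - al * b.1 * k (q y) b.2 =
    - al * \sum_(y <- Y) H y.
  rewrite mulr_sumr; apply: eq_bigr => y _; rewrite mulr_sumr.
  by apply: eq_bigr => a _; ring.
have -> : \sum_(y <- Y) \sum_(y' <- Y) - al * - al * k (q y) (q y') =
    al ^+ 2 * \sum_(y <- Y) \sum_(y' <- Y) k (q y) (q y').
  rewrite mulr_sumr; apply: eq_bigr => y _; rewrite mulr_sumr.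
  by apply: eq_bigr => a _; ring.
set N := (size Y)%:R; set S1 := \sum_(y <- Y) H y; set S2 := \sum_(y <- Y) _.
have S1N : N * eta <= S1.
  rewrite /N /S1 -sum1_size natr_sum mulr_suml big_seq [leRHS]big_seq.
  by apply: ler_sum => y yY; rewrite mul1r; exact: Yeta.
have S2N : S2 <= N * B.
  rewrite /N /S2 -sum1_size natr_sum mulr_suml big_seq [leRHS]big_seq.
  by apply: ler_sum => y yY; rewrite mul1r; exact: YB.
move=> H0.
have h1 : al * (N * eta) <= al * S1 by exact: ler_wpM2l.
have h2 : al ^+ 2 * S2 <= al ^+ 2 * (N * B) by apply: ler_wpM2l; rewrite ?sqr_ge0.
have e1 : al * (N * eta) * B = N * eta ^+ 2 by rewrite /al; field; rewrite gt_eqF.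
have e2 : al ^+ 2 * (N * B) * B = N * eta ^+ 2 by rewrite /al; field; rewrite gt_eqF.
have : 0 <= (Q - 2 * (al * (N * eta)) + al ^+ 2 * (N * B)) * B.
  by rewrite mulr_ge0 ?(ltW B0)//; lra.
by rewrite mulrDl mulrBl -(mulrA 2) e1 e2; lra.
Qed.

(** * Gaussian integrals *)

Definition abs_gauss (R : realType) (m : nat) (c x : R) : R :=
  `|x| ^+ m * expR (- (c * x ^+ 2)).

Lemma abs_gauss_ge0 (R : realType) (m : nat) (c x : R) : 0 <= abs_gauss m c x.
Proof. by rewrite mulr_ge0 ?exprn_ge0 ?expR_ge0. Qed.

Lemma continuous_abs_gauss (R : realType) (m : nat) (c : R) :
  continuous (abs_gauss m c).
Proof.
move=> x; apply: cvgM.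
  apply: (@continuous_comp _ _ _ (fun x : R => `|x|) (fun y => y ^+ m)).
    exact: norm_continuous.
  exact: exprn_continuous.
apply: (@continuous_comp _ _ _ (fun x : R => - (c * x ^+ 2)) expR).
  apply: cvgN; apply: cvgM; first exact: cvg_cst.
  exact: exprn_continuous.
exact: continuous_expR.
Qed.

Lemma measurable_abs_gauss (R : realType) (m : nat) (c : R) :
  measurable_fun setT (abs_gauss m c).
Proof. by apply: continuous_measurable_fun; exact: continuous_abs_gauss. Qed.

Lemma abs_gauss_scale (R : realType) (m : nat) (c : R) : 0 < c ->
  (\int[lebesgue_measure]_x (abs_gauss m 1 x)%:E =
   (Num.sqrt c ^+ m.+1)%:E *
     \int[lebesgue_measure]_x (abs_gauss m c x)%:E)%E.
Proof.
move=> c0; pose s := Num.sqrt c; have s0 : 0 < s by rewrite sqrtr_gt0.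
pose F (x : R) := x * s.
have FE : F^`()%classic = cst s.
  apply/funext => x; rewrite /F derive1E deriveM// derive_cst scaler0 add0r.
  by rewrite derive_id scaler1.
rewrite (@increasing_ge0_integration_by_substitutionT R F)//.
- rewrite -ge0_integralZl//.
  + apply: eq_integral => x _; rewrite FE -EFinM /abs_gauss /F !fctE /=.
    congr EFin; rewrite normrM (gtr0_norm s0) mul1r exprMn [(x * s) ^+ 2]exprMn.
    rewrite sqr_sqrtr ?(ltW c0)// [x ^+ 2 * c]mulrC -/s [s ^+ m.+1]exprSr; ring.
  + by apply/measurable_EFinP; exact: measurable_abs_gauss.
  + by move=> x _; rewrite lee_fin abs_gauss_ge0.
- by move=> x y xy; rewrite /F ltr_pM2r.
- by rewrite FE => ?; exact: cvg_cst.
- by rewrite FE; exact: is_cvg_cst.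
- by rewrite FE; exact: is_cvg_cst.
- by apply/gt0_cvgMlNy => //; exact: cvg_id.
- by apply/gt0_cvgMly => //; exact: cvg_id.
- exact: continuous_abs_gauss.
- by move=> x; exact: abs_gauss_ge0.
Qed.

Lemma abs_gauss_integrable (R : realType) (m : nat) (c : R) : 0 < c ->
  lebesgue_measure.-integrable setT (EFin \o abs_gauss m c).
Proof.
have fin0 (b : R) : 0 < b ->
    lebesgue_measure.-integrable setT (EFin \o abs_gauss 0 b).
  move=> b0; apply/integrableP; split.
    by apply/measurable_EFinP; exact: measurable_abs_gauss.
  under eq_integral do rewrite /= ger0_norm ?abs_gauss_ge0//.
  have := abs_gauss_scale 0 b0.
  have -> : (\int[lebesgue_measure]_x (abs_gauss 0 1 x)%:E =
      (Num.sqrt (pi : R))%:E)%E.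
    rewrite -integralT_gauss; apply: eq_integral => x _.
    by rewrite /abs_gauss expr0 !mul1r.
  case: (integral _ _ _) => [r||] //; first by rewrite ltry.
  by rewrite gt0_muley// lte_fin expr1 sqrtr_gt0.
move=> c0.
(* [|x| ^ m <= 1 + x ^ (2 m)], and half of the exponent absorbs the power. *)
pose M := 1 + (4 / c) ^+ m * m%:R ^+ m.
have : lebesgue_measure.-integrable setT
    (fun x => M%:E * (EFin \o abs_gauss 0 (c / 2)) x)%E.
  by apply: integrableZl => //; apply: fin0; rewrite divr_gt0.
apply: le_integrable => //.
  by apply/measurable_EFinP; exact: measurable_abs_gauss.
move=> x _; rewrite /= lee_fin !ger0_norm ?abs_gauss_ge0//; last first.
  by rewrite mulr_ge0 ?abs_gauss_ge0// addr_ge0// mulr_ge0 ?exprn_ge0 ?divr_ge0 ?(ltW c0).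
rewrite /abs_gauss expr0 mul1r.
have -> : - (c * x ^+ 2) = - (c / 2 * x ^+ 2) - c / 2 * x ^+ 2 by field.
rewrite expRD mulrCA [leRHS]mulrC; apply: ler_wpM2l; first exact: expR_ge0.
rewrite expRN ler_pdivrMr ?expR_gt0//.
set y := c / 2 * x ^+ 2.
have y0 : 0 <= y by rewrite mulr_ge0 ?sqr_ge0 ?divr_ge0// ltW.
have ey : 1 <= expR y by rewrite -expR0 ler_expR.
have x2m : `|x| ^+ m <= 1 + (x ^+ 2) ^+ m.
  have [x1|x1] := leP `|x| 1.
    apply: le_trans (_ : 1 <= _); first exact: exprn_ile1.
    by rewrite lerDl exprn_ge0 ?sqr_ge0.
  apply: ler_wpDl => //; rewrite -(real_normK (num_real x)).
  by rewrite lerXn2r ?nnegrE ?sqr_ge0// expr2 ler_peMr// ltW.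
apply: (le_trans x2m); rewrite mulrDl mul1r; apply: lerD => //.
have -> : x ^+ 2 = 2 / c * y by rewrite /y; field; rewrite gt_eqF.
rewrite exprMn -mulrA; apply: ler_pM; rewrite ?exprn_ge0 ?divr_ge0 ?(ltW c0)//.
  rewrite lerXn2r ?nnegrE ?divr_ge0 ?(ltW c0)// ler_wpM2r ?invr_ge0 ?(ltW c0)//.
  by rewrite ler_nat.
exact: exprn_le_expR.
Qed.

Definition gauss_moment (R : realType) (m : nat) : R :=
  \int[lebesgue_measure]_x abs_gauss m 1 x.

Lemma gauss_moment_gt0 (R : realType) (m : nat) : 0 < gauss_moment R m.
Proof.
have int1 := @abs_gauss_integrable R m 1 ltr01.
rewrite -lte_fin /gauss_moment fineK; last exact: integrable_fin_num.
pose I := `[1%R, 2%R]%classic : set R.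
apply: (@lt_le_trans _ _ (\int[lebesgue_measure]_(x in I) (expR (- 4))%:E)%E).
  rewrite integral_cst//=; last exact: measurable_itv.
  have mI : lebesgue_measure I = 1%E.
    by rewrite /I lebesgue_measure_itv/= lte_fin ltr1n -EFinD; congr EFin; lra.
  by rewrite [X in (_ * X)%E]mI mule1 lte_fin expR_gt0.
apply: (@le_trans _ _ (\int[lebesgue_measure]_(x in I) (abs_gauss m 1 x)%:E)%E).
  apply: ge0_le_integral => //.
  - exact: measurable_itv.
  - apply/measurable_EFinP; apply: (measurable_funS _ (subsetT I)) => //.
    exact: measurable_abs_gauss.
  move=> x; rewrite /I /= in_itv/= => /andP[x1 x2]; rewrite lee_fin /abs_gauss.
  have x0 : 0 <= x by lra.
  rewrite ger0_norm// -[leLHS]mul1r; apply: ler_pM; rewrite ?expR_ge0//.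
    by rewrite exprn_ege1.
  by rewrite ler_expR mul1r lerN2; nra.
apply: ge0_subset_integral => //.
- exact: measurable_itv.
- by apply/measurable_EFinP; exact: measurable_abs_gauss.
- by move=> x _; rewrite lee_fin abs_gauss_ge0.
Qed.

Lemma Rintegral_abs_gauss (R : realType) (m : nat) (c : R) : 0 < c ->
  \int[lebesgue_measure]_x abs_gauss m c x =
  gauss_moment R m * (Num.sqrt c)^-1 ^+ m.+1.
Proof.
move=> c0; rewrite /gauss_moment /Rintegral (abs_gauss_scale m c0).
rewrite fineM//; last by apply: integrable_fin_num => //; exact: abs_gauss_integrable.
rewrite /= exprVn mulrC mulKf// expf_neq0// gt_eqF// sqrtr_gt0//.
Qed.

(** * Mixtures of Gaussian kernels *)

(** The convolution of two Gaussians, with squared widths [t] and [u], up to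
    normalisation. *)
Definition gauss1 (R : realType) (t u x y : R) : R :=
  (Num.sqrt (t + u))^-1 * expR (- ((x - y) ^+ 2 / (t + u))).

Lemma gauss_convolution (R : realType) (t u x y : R) : 0 < t -> 0 < u ->
  let f t x v := (Num.sqrt (Num.sqrt pi) * Num.sqrt t)^-1 *
                 expR (- ((v - x) ^+ 2 / t)) in
  lebesgue_measure.-integrable setT (EFin \o (fun v => f t x v * f u y v)) /\
  \int[lebesgue_measure]_v (f t x v * f u y v) = gauss1 t u x y.
Proof.
move=> t0 u0 f; have tu : 0 < t + u by exact: addr_gt0.
have p0 : 0 < pi :> R by exact: pi_gt0.
pose tau := t * u / (t + u).
have tau0 : 0 < tau by rewrite divr_gt0// mulr_gt0.
pose s := Num.sqrt (tau / 2).
have s0 : s != 0 by rewrite gt_eqF// sqrtr_gt0 divr_gt0.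
have s2 : s ^+ 2 *+ 2 = tau.
  have -> : s ^+ 2 = tau / 2 by rewrite sqr_sqrtr// divr_ge0// ltW.
  by rewrite mulr2n; field.
pose m := (x * u + y * t) / (t + u).
have E v : f t x v * f u y v = gauss1 t u x y * normal_pdf m s v.
  rewrite normal_pdfE// /normal_fun s2 /normal_peak.
  have -> : s ^+ 2 * pi *+ 2 = tau * pi by rewrite -mulrnAl s2.
  rewrite /f /gauss1 mulrACA [RHS]mulrACA -!expRD -!invfM.
  congr (_^-1 * expR _); last first.
    by rewrite /m /tau; field; rewrite !gt_eqF.
  rewrite mulrACA -expr2 sqr_sqrtr ?sqrtr_ge0// -!sqrtrM ?(ltW _)//.
  by congr Num.sqrt; rewrite /tau; field; rewrite gt_eqF.
split.
  have := integrableZl measurableT (gauss1 t u x y) (integrable_normal_pdf m s).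
  by apply: eq_integrable => // v _; rewrite /= E.
under eq_Rintegral do rewrite E.
rewrite RintegralZl//; last exact: integrable_normal_pdf.
by rewrite /Rintegral integral_normal_pdf mulr1.
Qed.

(** In each coordinate [gauss_convolution] exhibits the kernel as the Gram
    matrix of a family of Gaussians. *)
Lemma posdef_gauss (R : realType) (n : nat) (r : seq 'I_n) :
  posdef (fun a b : {posnum R} * 'rV[R]_n =>
    \prod_(i <- r) gauss1 a.1%:num b.1%:num (a.2 0 i) (b.2 0 i)).
Proof.
elim: r => [|i r IH].
  by move=> s; under eq_bigr do under eq_bigr do rewrite big_nil;
    exact: posdef_cst1.
pose f (a : {posnum R} * 'rV[R]_n) (v : R) :=
  (Num.sqrt (Num.sqrt pi) * Num.sqrt a.1%:num)^-1 *
  expR (- ((v - a.2 0 i) ^+ 2 / a.1%:num)).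
have p0 (t : {posnum R}) : 0 < t%:num by [].
have fi (a b : {posnum R} * 'rV[R]_n) := gauss_convolution (a.2 0 i) (b.2 0 i)
  (p0 a.1) (p0 b.1).
have := @posdef_mul_gram R _ _ (measurableTypeR R) lebesgue_measure _ f IH
  (fun a b => (fi a b).1).
move=> H s; have := H s => /le_trans; apply.
rewrite le_eqVlt; apply/orP; left; apply/eqP.
apply: eq_bigr => a _; apply: eq_bigr => b _.
by congr (_ * _); rewrite (fi a.2 b.2).2 big_cons mulrC.
Qed.

(** The power [(1 + w / t) ^ (- d / 2)] is an average over [v] of the
    exponentials [exp (- (1 + w / t) v ^ 2)], with weight [|v| ^ (d - 1)]:
    these are Gaussian kernels composed with the dilation by [v]. *)
Lemma posdef_kern (R : realType) (d n : nat) : (n < d)%N ->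
  posdef (fun a b : {posnum R} * 'rV[R]_n =>
    kern d n (a.1%:num + b.1%:num) (enorm (a.2 - b.2) ^+ 2)).
Proof.
move=> nd; pose T := ({posnum R} * 'rV[R]_n)%type.
pose K (a b : T) := \prod_(i < n) gauss1 a.1%:num b.1%:num (a.2 0 i) (b.2 0 i).
have KE (a b : T) : K a b = (Num.sqrt (a.1%:num + b.1%:num))^-1 ^+ n *
    expR (- (enorm (a.2 - b.2) ^+ 2 / (a.1%:num + b.1%:num))).
  rewrite /K big_split/= prodr_const card_ord -expR_sum; congr (_ * expR _).
  by rewrite sumrN -mulr_suml enorm_sqr; congr (- (_ / _)); apply: eq_bigr => i _;
    rewrite !mxE expr2.
pose g (v : R) (a b : T) := abs_gauss d.-1 1 v *
  K (a.1, v *: a.2) (b.1, v *: b.2).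
have gE v (a b : T) : g v a b = (Num.sqrt (a.1%:num + b.1%:num))^-1 ^+ n *
    abs_gauss d.-1 (1 + enorm (a.2 - b.2) ^+ 2 / (a.1%:num + b.1%:num)) v.
  rewrite /g KE /= -scalerBr enormZ exprMn real_normK ?num_real// /abs_gauss.
  rewrite mulrCA -mulrA -expRD; congr (_ * (_ * expR _)).
  by field; rewrite gt_eqF// addr_gt0.
have gint (a b : T) :
    lebesgue_measure.-integrable setT (EFin \o (fun v => g v a b)).
  have tw : 0 < 1 + enorm (a.2 - b.2) ^+ 2 / (a.1%:num + b.1%:num).
    by rewrite ltr_wpDr// divr_ge0 ?sqr_ge0// ltW// addr_gt0.
  have := integrableZl measurableT ((Num.sqrt (a.1%:num + b.1%:num))^-1 ^+ n)
    (abs_gauss_integrable d.-1 tw).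
  by apply: eq_integrable => // v _; rewrite /= gE.
have pg v : posdef (g v).
  have := @posdef_comp R T T K (fun a => (a.1, v *: a.2))
    (fun=> Num.sqrt (abs_gauss d.-1 1 v)) (@posdef_gauss R n _).
  move=> H s; have := H s => /le_trans; apply.
  rewrite le_eqVlt; apply/orP; left; apply/eqP.
  apply: eq_bigr => a _; apply: eq_bigr => b _.
  by rewrite -expr2 sqr_sqrtr// abs_gauss_ge0.
have I0 := gauss_moment_gt0 R d.-1.
have := @posdef_comp R T T _ id
  (fun=> Num.sqrt (gauss_moment R d.-1)^-1)
  (@posdef_mix R T _ (measurableTypeR R) lebesgue_measure g pg gint).
move=> H s; have := H s => /le_trans; apply.
rewrite le_eqVlt; apply/orP; left; apply/eqP.
apply: eq_bigr => a _; apply: eq_bigr => b _; congr (_ * _).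
rewrite -expr2 sqr_sqrtr ?invr_ge0 ?(ltW I0)// /=.
under eq_Rintegral do rewrite gE.
set t := _ + _; have t0 : 0 < t by rewrite addr_gt0.
set w := enorm _ ^+ 2; have w0 : 0 <= w by rewrite sqr_ge0.
have tw : 0 < 1 + w / t by rewrite ltr_wpDr// divr_ge0// ltW.
rewrite RintegralZl//; last exact: abs_gauss_integrable.
rewrite Rintegral_abs_gauss// mulrCA mulKf ?gt_eqF//.
rewrite prednK; last exact: leq_ltn_trans nd.
have -> : 1 + w / t = (t + w) / t by field; rewrite gt_eqF.
rewrite sqrtrM ?addr_ge0 ?(ltW t0)// sqrtrV ?(ltW t0)// invfM invrK exprMn.
rewrite /kern mulrCA mulrC; congr (_ * _).
have -> : Num.sqrt t ^+ d = Num.sqrt t ^+ n * Num.sqrt t ^+ (d - n).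
  by rewrite -exprD subnKC// ltnW.
by rewrite mulrA -exprMn mulVf ?expr1n ?mul1r// gt_eqF// sqrtr_gt0.
Qed.

(** * Iterated differences *)

(** The coefficients of the [p]-th difference operator. *)
Definition dcoef (R : realType) (p i : nat) : R := (-1) ^+ i *+ 'C(p, i).

Lemma dcoef_sum (R : realType) (p : nat) (x : R) :
  \sum_(i < p.+1) dcoef R p i * x ^+ i = (1 - x) ^+ p.
Proof.
rewrite exprDn; apply: eq_bigr => i _.
by rewrite /dcoef expr1n mul1r mulrnAl -exprMn mulN1r.
Qed.

(** A power [x ^ (- n / 2)] is an average of exponentials [exp (- x v ^ 2)],
    whose iterated difference is [exp (- x v ^ 2) * (1 - exp (- b v ^ 2)) ^ 2p],
    at most [exp (- x v ^ 2) * (b v ^ 2) ^ 2p]. *)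
Lemma iterated_difference_le (R : realType) (n p : nat) : (0 < n)%N ->
  exists2 C : R, 0 <= C & forall x b : R, 0 < x -> 0 < b ->
    \sum_(i < p.+1) \sum_(j < p.+1) dcoef R p i * dcoef R p j *
      (Num.sqrt (x + (i + j)%:R * b))^-1 ^+ n <=
    C * b ^+ (2 * p) * (Num.sqrt x)^-1 ^+ (n + 4 * p).
Proof.
move=> n0; set m := n.-1; have mn : n = m.+1 by rewrite prednK.
exists (gauss_moment R (m + 4 * p) / gauss_moment R m).
  by rewrite divr_ge0// ltW// gauss_moment_gt0.
move=> x b x0 b0.
have I0 := gauss_moment_gt0 R m.
have xp (k : nat) : 0 < x + k%:R * b by rewrite ltr_wpDr// mulr_ge0// ltW.
rewrite -(ler_pM2l I0).
pose f (ij : 'I_p.+1 * 'I_p.+1) v := (dcoef R p ij.1 * dcoef R p ij.2) *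
  abs_gauss m (x + (ij.1 + ij.2)%:R * b) v.
have fi ij : lebesgue_measure.-integrable setT (EFin \o f ij).
  have := integrableZl measurableT (dcoef R p ij.1 * dcoef R p ij.2)
    (abs_gauss_integrable m (xp (ij.1 + ij.2)%N)).
  by apply: eq_integrable.
have [E1 E2] := Rintegral_big_sum (index_enum _) fi.
have -> : gauss_moment R m * (\sum_(i < p.+1) \sum_(j < p.+1)
    dcoef R p i * dcoef R p j * (Num.sqrt (x + (i + j)%:R * b))^-1 ^+ n) =
    \sum_ij \int[lebesgue_measure]_v f ij v.
  rewrite pair_big/= mulr_sumr; apply: eq_bigr => ij _.
  rewrite RintegralZl//; last exact: abs_gauss_integrable.
  by rewrite Rintegral_abs_gauss// mn; ring.
rewrite -E1.
have -> : gauss_moment R m * (gauss_moment R (m + 4 * p) / gauss_moment R m *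
    b ^+ (2 * p) * (Num.sqrt x)^-1 ^+ (n + 4 * p)) =
    \int[lebesgue_measure]_v (b ^+ (2 * p) * abs_gauss (m + 4 * p) x v).
  rewrite RintegralZl//; last exact: abs_gauss_integrable.
  by rewrite Rintegral_abs_gauss// mn addSn; field; rewrite gt_eqF.
apply: le_Rintegral => //.
  have := integrableZl measurableT (b ^+ (2 * p))
    (abs_gauss_integrable (m + 4 * p) x0).
  by apply: eq_integrable.
move=> v _; rewrite /abs_gauss.
have -> : \sum_ij f ij v =
    `|v| ^+ m * expR (- (x * v ^+ 2)) * (1 - expR (- (b * v ^+ 2))) ^+ (2 * p).
  rewrite mulnC exprM -dcoef_sum [X in _ * X]expr2 mulr_suml mulr_sumr.
  under [RHS]eq_bigr do rewrite mulr_sumr mulr_sumr.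
  rewrite pair_big/=; apply: eq_bigr => ij _; rewrite /f /abs_gauss.
  have -> : - ((x + (ij.1 + ij.2)%:R * b) * v ^+ 2) =
      - (x * v ^+ 2) + (ij.1%:R * - (b * v ^+ 2) + ij.2%:R * - (b * v ^+ 2)).
    by rewrite natrD; ring.
  by rewrite !expRD !expRM_natl; ring.
have v0 : 0 <= b * v ^+ 2 by rewrite mulr_ge0 ?sqr_ge0// ltW.
have h : (1 - expR (- (b * v ^+ 2))) ^+ (2 * p) <= (b * v ^+ 2) ^+ (2 * p).
  rewrite lerXn2r ?nnegrE//.
    by rewrite subr_ge0 -[leRHS]expR0 ler_expR oppr_le0.
  by have := expR_ge1Dx (- (b * v ^+ 2)); lra.
apply: le_trans (ler_wpM2l _ h) _.
  by rewrite mulr_ge0 ?expR_ge0// exprn_ge0.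
rewrite le_eqVlt; apply/orP; left; apply/eqP.
have -> : (b * v ^+ 2) ^+ (2 * p) = b ^+ (2 * p) * `|v| ^+ (4 * p).
  rewrite exprMn -(real_normK (num_real v)) -exprM; congr (_ * _ ^+ _); lia.
by rewrite exprD; ring.
Qed.

(** * Hausdorff measures *)

Lemma diam_le (R : realType) (d : nat) (A : set 'rV[R]_d) (M : \bar R) :
  (forall x y, A x -> A y -> ((enorm (x - y))%:E <= M)%E) -> (diam A <= M)%E.
Proof. by move=> AM; apply: ge_ereal_sup => _ [x Ax] [y Ay] <-; exact: AM. Qed.

Lemma le_diam (R : realType) (d : nat) (A : set 'rV[R]_d) (x y : 'rV[R]_d) :
  A x -> A y -> ((enorm (x - y))%:E <= diam A)%E.
Proof. by move=> Ax Ay; apply: ereal_sup_ubound; exists x => //; exists y. Qed.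

Lemma diam_set0 (R : realType) (d : nat) : diam (set0 : set 'rV[R]_d) = -oo%E.
Proof. by apply/eqP; rewrite -leeNy_eq; apply: diam_le. Qed.

Lemma diam_pow_ge0 (R : realType) (d : nat) (s : R) (A : set 'rV[R]_d) :
  (0 <= diam_pow s A)%E.
Proof. by rewrite /diam_pow; case: asboolP => // _; exact: poweR_ge0. Qed.

Lemma diam_pow0 (R : realType) (d : nat) (s : R) :
  diam_pow s (set0 : set 'rV[R]_d) = 0%E.
Proof. by rewrite /diam_pow; case: asboolP. Qed.

Lemma diam_pow_le (R : realType) (d : nat) (s r : R) (A : set 'rV[R]_d) :
  0 <= s -> (diam A <= r%:E)%E -> (diam_pow s A <= (r `^ s)%:E)%E.
Proof.
move=> s0 Ar; rewrite /diam_pow; case: asboolP => [_|].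
  by rewrite lee_fin powR_ge0.
move=> /eqP/set0P[x Ax]; rewrite -poweR_EFin.
have d0 : (0 <= diam A)%E.
  by apply: le_trans (le_diam Ax Ax); rewrite lee_fin enorm_ge0.
apply: gt0_ler_poweR => //; rewrite in_itv/= ?andbT//; first by rewrite d0 leey.
by rewrite (le_trans d0)//= leey.
Qed.

Lemma hausdorff_premeasure_ge0 (R : realType) (d : nat) (s delta : R)
  (A : set 'rV[R]_d) : (0 <= hausdorff_premeasure s delta A)%E.
Proof.
apply: le_ereal_inf_tmp => _ [E _ <-]; apply: nneseries_ge0 => k _ _.
exact: diam_pow_ge0.
Qed.

Lemma hausdorff_premeasure_le (R : realType) (d : nat) (s delta : R)
    (A B : set 'rV[R]_d) : A `<=` B ->
  (hausdorff_premeasure s delta A <= hausdorff_premeasure s delta B)%E.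
Proof.
move=> AB; apply: ereal_inf_le_tmp => _ [E [BE Ed] <-]; exists E => //.
by split => //; exact: subset_trans BE.
Qed.

Lemma hausdorff_premeasure_anti (R : realType) (d : nat) (s a b : R)
    (A : set 'rV[R]_d) : a <= b ->
  (hausdorff_premeasure s b A <= hausdorff_premeasure s a A)%E.
Proof.
move=> ab; apply: ereal_inf_le_tmp => _ [E [AE Ed] <-]; exists E => //.
by split => // k; apply: le_trans (Ed k) _; rewrite lee_fin.
Qed.

Lemma hausdorff_measure_le (R : realType) (d : nat) (s : R)
    (A B : set 'rV[R]_d) : A `<=` B ->
  (hausdorff_measure s A <= hausdorff_measure s B)%E.
Proof.
move=> AB; apply: ge_ereal_sup => _ [t t0 <-].
apply: le_trans (hausdorff_premeasure_le s t AB) _.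
by apply: ereal_sup_ubound; exists t.
Qed.

Lemma premeasure_le_measure (R : realType) (d : nat) (s t : R)
    (A : set 'rV[R]_d) : 0 < t ->
  (hausdorff_premeasure s t A <= hausdorff_measure s A)%E.
Proof. by move=> t0; apply: ereal_sup_ubound; exists t. Qed.

Lemma hausdorff_measure_ge0 (R : realType) (d : nat) (s : R)
  (A : set 'rV[R]_d) : (0 <= hausdorff_measure s A)%E.
Proof.
exact: le_trans (hausdorff_premeasure_ge0 s 1 A) (premeasure_le_measure s A ltr01).
Qed.

(** Near-optimal covers of the [A k], with errors [e / 2 ^ (k + 1)], are
    enumerated together. *)
Lemma hausdorff_premeasure_bigcup (R : realType) (d : nat) (s delta : R)
    (A : nat -> set 'rV[R]_d) :
  (hausdorff_premeasure s delta (\bigcup_k A k) <=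
   \sum_(0 <= k <oo) hausdorff_premeasure s delta (A k))%E.
Proof.
have [[i ioo]|Aoo] :=
    pselect (exists i, hausdorff_premeasure s delta (A i) = +oo%E).
  rewrite (eseries_pinfty _ _ ioo) ?leey// => k _.
  by rewrite -ltNye (lt_le_trans _ (hausdorff_premeasure_ge0 _ _ _)).
apply/lee_addgt0Pr => e e0.
apply: le_trans (epsilon_trick xpredT _ (ltW e0)); last first.
  by move=> k; exact: hausdorff_premeasure_ge0.
have ex k : exists E : nat -> set 'rV[R]_d,
    [/\ A k `<=` \bigcup_j E j, forall j, (diam (E j) <= delta%:E)%E &
     (\sum_(0 <= j <oo) diam_pow s (E j) <=
      hausdorff_premeasure s delta (A k) + (e / (2 ^ k.+1)%:R)%:E)%E].
  have e2 : 0 < e / (2 ^ k.+1)%:R by rewrite divr_gt0// ltr0n expn_gt0.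
  have fA : hausdorff_premeasure s delta (A k) \is a fin_num.
    rewrite ge0_fin_numE ?hausdorff_premeasure_ge0// ltey; apply/eqP => Ak.
    by apply: Aoo; exists k.
  have [_ [E [AE Ed] <-] /ltW] := lb_ereal_inf_adherent e2 fA.
  by exists E.
have {ex}/choice[E EP] := ex.
have /card_esym/ppcard_eqP[f] := card_nat2.
pose G k := E (f k).1 (f k).2.
apply: (@le_trans _ _ (\sum_(0 <= k <oo) diam_pow s (G k))%E).
  apply: ereal_inf_lbound; exists G => //; split; last first.
    by move=> k; have [_ Ed _] := EP (f k).1; exact: Ed.
  move=> x [k _ Ak]; have [AE _ _] := EP k; have [j _ Ej] := AE _ Ak.
  by exists (f^-1%FUN (k, j)) => //; rewrite /G invK ?inE.
have -> : (\sum_(0 <= k <oo) diam_pow s (G k) =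
    \sum_(0 <= k <oo) \sum_(0 <= j <oo) diam_pow s (E k j))%E.
  rewrite nneseries_esumT; last by move=> k; exact: diam_pow_ge0.
  have bf : set_bij [set: nat] [set: nat * nat] f by exact: bij.
  rewrite -(@reindex_esum R _ _ _ _ _ (fun ij => diam_pow s (E ij.1 ij.2)) bf).
  have := @esum_esum R nat nat setT (fun=> setT) (fun i j => diam_pow s (E i j)).
  move=> /(_ (fun _ _ _ _ => diam_pow_ge0 _ _)).
  have -> : setT `*`` (fun=> setT) = [set: nat * nat].
    by apply/seteqP; split.
  move=> <-; rewrite nneseries_esumT; last first.
    by move=> k; apply: nneseries_ge0 => *; exact: diam_pow_ge0.
  by apply: eq_esum => k _; rewrite nneseries_esumT// => j; exact: diam_pow_ge0.
apply: lee_nneseries => k *; first by apply: nneseries_ge0 => *; exact: diam_pow_ge0.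
by have [] := EP k.
Qed.

Lemma hausdorff_premeasure0 (R : realType) (d : nat) (s delta : R) :
  hausdorff_premeasure s delta (set0 : set 'rV[R]_d) = 0%E.
Proof.
apply/eqP; rewrite eq_le hausdorff_premeasure_ge0 andbT.
apply: ereal_inf_lbound; exists (fun=> set0).
  by split => // k; rewrite diam_set0 leNye.
by apply: eseries0 => k _ _; rewrite diam_pow0.
Qed.

Lemma hausdorff_premeasureU (R : realType) (d : nat) (s delta : R)
    (A B : set 'rV[R]_d) :
  (hausdorff_premeasure s delta (A `|` B) <=
   hausdorff_premeasure s delta A + hausdorff_premeasure s delta B)%E.
Proof.
pose C k := if k is k'.+1 then if k' is 0 then B else set0 else A.
have -> : A `|` B = \bigcup_k C k.
  apply/seteqP; split => x.
    by case=> ?; [exists 0%N|exists 1%N].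
  by case=> -[|[|k]] _ //= ?; [left|right].
apply: le_trans (hausdorff_premeasure_bigcup _ _ _) _.
rewrite (@nneseries_split _ _ 0 2); last by move=> *; exact: hausdorff_premeasure_ge0.
rewrite eseries0 => [|[|[|k]] //= _ _]; last by rewrite hausdorff_premeasure0.
by rewrite adde0 add0n big_nat_recr//= big_nat1.
Qed.

Lemma hausdorff_premeasure_big (R : realType) (d : nat) (s delta : R)
    (I : eqType) (X : seq I) (A : I -> set 'rV[R]_d) :
  (hausdorff_premeasure s delta [set x | exists2 i, i \in X & A i x] <=
   \sum_(i <- X) hausdorff_premeasure s delta (A i))%E.
Proof.
elim: X => [|i X IH].
  rewrite big_nil (_ : [set x | _] = set0) ?hausdorff_premeasure0//.
  by apply/seteqP; split => x //= -[].
rewrite big_cons; apply: le_trans (leeD2l _ IH).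
apply: le_trans (hausdorff_premeasureU _ _ _ _).
apply: hausdorff_premeasure_le => x [j]; rewrite in_cons => /orP[/eqP ->|jX] Ajx.
  by left.
by right; exists j.
Qed.

Lemma hausdorff_measure_big (R : realType) (d : nat) (s : R)
    (I : eqType) (X : seq I) (A : I -> set 'rV[R]_d) :
  (hausdorff_measure s [set x | exists2 i, i \in X & A i x] <=
   \sum_(i <- X) hausdorff_measure s (A i))%E.
Proof.
apply: ge_ereal_sup => _ [t t0 <-].
apply: le_trans (hausdorff_premeasure_big _ _ _ _) _.
by apply: lee_sum => i _; exact: premeasure_le_measure.
Qed.

(** A set of diameter less than the distance from [A] to [B] meets at most one
    of them. *)
Lemma hausdorff_premeasure_separated (R : realType) (d : nat) (s delta eta : R)
    (A B : set 'rV[R]_d) : delta < eta ->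
  (forall x y, A x -> B y -> eta <= enorm (x - y)) ->
  (hausdorff_premeasure s delta A + hausdorff_premeasure s delta B <=
   hausdorff_premeasure s delta (A `|` B))%E.
Proof.
move=> de AB; apply: le_ereal_inf_tmp => _ [E [ABE Ed] <-].
pose sub (C : set 'rV[R]_d) k := if `[< E k `&` C !=set0 >] then E k else set0.
have subP C k : E k `&` C `<=` sub C k.
  by move=> x [Ex Cx]; rewrite /sub; case: asboolP => // -[]; exists x.
have Hsub C : C `<=` A `|` B -> (hausdorff_premeasure s delta C <=
    \sum_(0 <= k <oo) diam_pow s (sub C k))%E.
  move=> CAB; apply: ereal_inf_lbound; exists (sub C) => //; split.
    move=> x Cx; have [k _ Ex] := ABE _ (CAB _ Cx); exists k => //.
    by apply: subP.
  by move=> k; rewrite /sub; case: ifP => _; rewrite ?diam_set0 ?leNye.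
apply: le_trans (leeD (Hsub A (fun x => @or_introl _ _)) (Hsub B (fun x => @or_intror _ _))) _.
rewrite -nneseriesD; last 2 first.
- by move=> *; exact: diam_pow_ge0.
- by move=> *; exact: diam_pow_ge0.
apply: lee_nneseries => [k _ _|k _]; first by rewrite adde_ge0 ?diam_pow_ge0.
rewrite /sub; case: asboolP => [[x [Ex Ax]]|_]; last first.
  by rewrite diam_pow0 add0e; case: ifP => // _; rewrite diam_pow0 diam_pow_ge0.
case: asboolP => [[y [Ey By]]|_]; last by rewrite diam_pow0 adde0.
have := le_trans (le_diam Ex Ey) (Ed k); rewrite lee_fin => /le_lt_trans/(_ de).
by rewrite ltNge AB.
Qed.

Lemma hausdorff_measure_separated (R : realType) (d : nat) (s eta : R)
    (A B : set 'rV[R]_d) : 0 < eta ->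
  (forall x y, A x -> B y -> eta <= enorm (x - y)) ->
  (hausdorff_measure s A + hausdorff_measure s B <=
   hausdorff_measure s (A `|` B))%E.
Proof.
move=> eta0 AB; set M := hausdorff_measure s (A `|` B).
have [->|Moo] := eqVneq M +oo%E; first by rewrite leey.
have fM : M \is a fin_num.
  by rewrite ge0_fin_numE ?hausdorff_measure_ge0// ltey.
have H a b : 0 < a -> 0 < b ->
    (hausdorff_premeasure s a A + hausdorff_premeasure s b B <= M)%E.
  move=> a0 b0; pose t := Num.min (Num.min a b) (eta / 2).
  have t0 : 0 < t by rewrite !lt_min a0 b0 divr_gt0.
  apply: le_trans (premeasure_le_measure s (A `|` B) t0).
  apply: le_trans (hausdorff_premeasure_separated s (eta := eta) _ AB).
    by apply: leeD; apply: hausdorff_premeasure_anti; rewrite /t !ge_min lexx ?orbT.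
  by rewrite /t !gt_min; apply/orP; right; lra.
have fin (C : set 'rV[R]_d) : C `<=` A `|` B ->
    hausdorff_measure s C \is a fin_num.
  move=> CAB; rewrite ge0_fin_numE ?hausdorff_measure_ge0//.
  by apply: le_lt_trans (hausdorff_measure_le s CAB) _; rewrite ltey.
have finA := fin A (fun x => @or_introl _ _).
have finB := fin B (fun x => @or_intror _ _).
rewrite -leeBrDr//; apply: ge_ereal_sup => _ [a a0 <-].
have fa : hausdorff_premeasure s a A \is a fin_num.
  rewrite ge0_fin_numE ?hausdorff_premeasure_ge0//.
  by apply: le_lt_trans (premeasure_le_measure s A a0) _; rewrite ltey_eq finA.
rewrite leeBrDr// addeC -leeBrDr//; apply: ge_ereal_sup => _ [b b0 <-].
by rewrite leeBrDr// addeC; exact: H.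
Qed.

Lemma hausdorff_measure_separated_big (R : realType) (d : nat) (s eta : R)
    (I : eqType) (X : seq I) (A : I -> set 'rV[R]_d) : 0 < eta -> uniq X ->
  (forall i j x y, i \in X -> j \in X -> i != j -> A i x -> A j y ->
    eta <= enorm (x - y)) ->
  (\sum_(i <- X) hausdorff_measure s (A i) <=
   hausdorff_measure s [set x | exists2 i, i \in X & A i x])%E.
Proof.
move=> eta0; elim: X => [|i X IH] /=.
  by rewrite big_nil hausdorff_measure_ge0.
move=> /andP[iX uX] sep; rewrite big_cons.
apply: le_trans (leeD2l _ (IH uX _)) _.
  by move=> j k x y jX kX; apply: sep; rewrite in_cons ?jX ?kX orbT.
apply: le_trans (hausdorff_measure_separated s eta0 _) _.
  move=> x y Ax [j jX Ay]; apply: (sep i j) => //; rewrite ?mem_head//.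
    by rewrite in_cons jX orbT.
  by apply: contraNneq iX => ->.
apply: hausdorff_measure_le => x [Ax|[j jX Ax]]; first by exists i; rewrite ?mem_head.
by exists j => //; rewrite in_cons jX orbT.
Qed.

(** * Separated sets and nets *)

Lemma maximal_separated (R : realType) (T : eqType) (D : T -> T -> R)
    (A : set T) (r : R) (N : nat) :
  (forall X : seq T, (forall x, x \in X -> A x) ->
     pairwise (fun x y => r < D x y) X -> (size X <= N)%N) ->
  exists X : seq T, [/\ forall x, x \in X -> A x,
    pairwise (fun x y => r < D x y) X &
    forall x, A x -> exists2 z, z \in X & D x z <= r].
Proof.
move=> AN.
pose P k := `[< exists X : seq T, [/\ size X = k, forall x, x \in X -> A x &
  pairwise (fun x y => r < D x y) X] >].
have P0 : exists k, P k by exists 0%N; apply/asboolP; exists [::].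
have PN k : P k -> (k <= N)%N by move=> /asboolP[X [<- XA sX]]; exact: AN.
case: (ex_maxnP P0 PN) => k /asboolP[X [Xk XA sX]] kmax.
exists X; split => // x Ax; apply: contrapT => xX.
have /kmax : P k.+1.
  apply/asboolP; exists (x :: X); split; rewrite /= ?Xk//.
    by move=> y; rewrite in_cons => /orP[/eqP ->|/XA].
  rewrite sX andbT; apply/allP => z zX; rewrite ltNge; apply/negP => xz.
  by apply: xX; exists z.
by rewrite ltnn.
Qed.

Lemma pairwise_separated_uniq (R : realType) (T : eqType) (D : T -> T -> R)
    (r : R) (X : seq T) : 0 <= r -> (forall x, D x x = 0) ->
  pairwise (fun x y => r < D x y) X -> uniq X.
Proof.
move=> r0 D0; elim: X => //= x X IH /andP[/allP xX /IH ->]; rewrite andbT.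
by apply/negP => /xX; rewrite D0 ltNge r0.
Qed.

Lemma pairwise_separatedP (R : realType) (T : eqType) (D : T -> T -> R)
    (r : R) (X : seq T) x y : (forall x y, D x y = D y x) ->
  pairwise (fun x y => r < D x y) X -> x \in X -> y \in X -> x != y ->
  r < D x y.
Proof.
move=> DC; elim: X => //= z X IH /andP[/allP zX sX].
rewrite !in_cons => /orP[/eqP ->|xX] /orP[/eqP ->|yX]; rewrite ?eqxx// => xy.
- exact: zX.
- by rewrite DC; exact: zX.
- exact: IH.
Qed.

(** Assign to each point the cell of a grid of mesh [r / n] that contains it. *)
Lemma packing_bound (R : realType) (n : nat) (X : seq 'rV[R]_n) (c : 'rV[R]_n)
    (r rho : R) : (0 < n)%N -> 0 < r <= rho ->
  pairwise (fun x y => r < enorm (x - y)) X ->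
  (forall x, x \in X -> enorm (x - c) <= rho) ->
  (size X)%:R <= ((2 * n).+1%:R * (rho / r)) ^+ n.
Proof.
move=> n0 /andP[r0 rr] sX Xc.
have nr : 0 < n%:R / r by rewrite divr_gt0// ltr0n.
have rho0 : 0 < rho by exact: lt_le_trans rr.
pose M := Num.truncn (2 * rho * (n%:R / r)).
pose u (x : 'rV[R]_n) i := ((x - c) 0 i + rho) * (n%:R / r).
have u_itv x i : x \in X -> 0 <= u x i <= 2 * rho * (n%:R / r).
  move=> /Xc xc; have := le_trans (coord_le_enorm (x - c) i) xc.
  rewrite ler_norml => /andP[h1 h2]; apply/andP; split.
    by rewrite mulr_ge0 ?(ltW nr)//; lra.
  by rewrite ler_wpM2r ?(ltW nr)//; lra.
pose cell x : {ffun 'I_n -> 'I_M.+1} := [ffun i => inord (Num.truncn (u x i))].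
have cellE x i : x \in X -> val (cell x i) = Num.truncn (u x i).
  move=> xX; rewrite ffunE /= inordK// ltnS /M.
  by apply: le_truncn; have /andP[] := u_itv x i xX.
have uX : uniq X.
  by apply: (pairwise_separated_uniq (ltW r0) _ sX) => x; rewrite subrr enorm0.
have ucell : uniq (map cell X).
  rewrite map_inj_in_uniq// => x y xX yX xy; apply/eqP/negPn/negP => neq.
  have := pairwise_separatedP (@enormB R n) sX xX yX neq; rewrite ltNge => /negP.
  apply; apply: le_trans (enorm_le_sum _) _.
  apply: le_trans (_ : \sum_(i < n) r / n%:R <= _); last first.
    by rewrite sumr_const card_ord -[leLHS]mulr_natr divfK// pnatr_eq0 -lt0n.
  apply: ler_sum => i _.
  have /andP[ux _] := u_itv x i xX; have /andP[uy _] := u_itv y i yX.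
  have /andP[x1 x2] := truncn_itv ux; have /andP[y1 y2] := truncn_itv uy.
  have E : Num.truncn (u x i) = Num.truncn (u y i) by rewrite -!cellE// xy.
  rewrite E -natr1 in x1 x2; rewrite -natr1 in y2.
  have : `|u x i - u y i| <= 1 by rewrite ler_norml; lra.
  have -> : u x i - u y i = (x - y) 0 i * (n%:R / r).
    by rewrite /u !mxE; ring.
  by rewrite normrM (gtr0_norm nr) -ler_pdivlMr// invf_div mul1r.
have : (size X <= M.+1 ^ n)%N.
  rewrite -(size_map cell).
  apply: leq_trans (_ : #|{ffun 'I_n -> 'I_M.+1}| <= _)%N; last first.
    by rewrite card_ffun !card_ord.
  by rewrite cardE; apply: uniq_leq_size => // x; rewrite mem_enum.
rewrite -(ler_nat R) natrX => /le_trans; apply.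
have key : M.+1%:R <= (2 * n).+1%:R * (rho / r).
  have /andP[h _] : M%:R <= 2 * rho * (n%:R / r) < M.+1%:R.
    by apply: truncn_itv; rewrite !mulr_ge0 ?invr_ge0 ?(ltW r0) ?(ltW rho0).
  have h2 : 1 <= rho / r by rewrite ler_pdivlMr// mul1r.
  rewrite -[M.+1%:R]natr1 -[(2 * n).+1%:R]natr1 natrM mulrDl mul1r.
  apply: lerD => //; apply: le_trans h _.
  by rewrite le_eqVlt; apply/orP; left; apply/eqP; field; rewrite gt_eqF.
by apply: lerXn2r; rewrite ?nnegrE// (le_trans _ key).
Qed.

(** Split into the dyadic shells [D <= 2 ^ k * r]. *)
Lemma shell_sum (R : realType) (I : Type) (X : seq I) (D : I -> R)
    (r B al : R) (be : nat) : 0 < r -> 0 <= B -> 0 <= al -> al + 1 <= be%:R ->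
  (forall i, 0 <= D i) ->
  (forall rho, r <= rho -> (count (fun i => D i <= rho) X)%:R <= B * (rho / r) `^ al) ->
  \sum_(i <- X) (Num.sqrt (r ^+ 2 + D i ^+ 2))^-1 ^+ be <=
  2 ^+ be.+1 * B * r^-1 ^+ be.
Proof.
move=> r0 B0 al0 albe D0 cnt.
have [K DK] : exists K, forall i, List.In i X -> D i <= 2 ^+ K * r.
  elim: X {cnt} => [|i X [K IH]]; first by exists 0%N.
  pose K' := maxn K (Num.truncn (D i / r)).+1; exists K' => j [<-|/IH/le_trans].
    rewrite -ler_pdivrMr//.
    have /andP[_ /ltW h] := truncn_itv (divr_ge0 (D0 i) (ltW r0)).
    apply: le_trans h _; rewrite -natrX ler_nat.
    by apply: leq_trans (ltnW (ltn_expl _ (ltnSn 1))) _; rewrite leq_exp2l// leq_maxr.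
  by apply; rewrite ler_pM2r// ler_weXn2l// ?ler1n// leq_maxl.
have term i : List.In i X -> (Num.sqrt (r ^+ 2 + D i ^+ 2))^-1 ^+ be <=
    2 ^+ be * r^-1 ^+ be *
      \sum_(k < K.+1) (2^-1 ^+ k) ^+ be * (D i <= 2 ^+ k * r)%R%:R.
  move=> iX.
  have ex : exists k, D i <= 2 ^+ k * r by exists K; exact: DK.
  case: (ex_minnP ex) => k Dk kmin.
  have kK : (k < K.+1)%N by rewrite ltnS; apply: kmin; exact: DK.
  have sq : 0 < r ^+ 2 + D i ^+ 2 by rewrite ltr_wpDr ?sqr_ge0// exprn_gt0.
  apply: le_trans (_ : 2 ^+ be * r^-1 ^+ be * (2^-1 ^+ k) ^+ be <= _); last first.
    rewrite ler_pM2l ?mulr_gt0 ?exprn_gt0 ?invr_gt0//.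
    by rewrite (bigD1 (Ordinal kK))//= Dk mulr1 lerDl sumr_ge0.
  suff core : (Num.sqrt (r ^+ 2 + D i ^+ 2))^-1 <= 2 / r * 2^-1 ^+ k.
    have -> : 2 ^+ be * r^-1 ^+ be * (2^-1 ^+ k) ^+ be =
        (2 / r * 2^-1 ^+ k) ^+ be by rewrite !exprMn.
    apply: lerXn2r => //; rewrite nnegrE ?invr_ge0 ?sqrtr_ge0//.
    by rewrite (le_trans _ core)// invr_ge0 sqrtr_ge0.
  have -> : 2 / r * 2^-1 ^+ k = (2^-1 * 2 ^+ k * r)^-1.
    by rewrite !invfM invrK exprVn; ring.
  have p2 : 0 < 2^-1 * 2 ^+ k * r by rewrite !mulr_gt0 ?exprn_gt0 ?invr_gt0.
  rewrite lef_pV2 ?posrE ?sqrtr_gt0// -(ler_sqr (ltW p2)) ?nnegrE ?sqrtr_ge0//.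
  rewrite sqr_sqrtr ?(ltW sq)//.
  case: k Dk kmin kK p2 => [|k] Dk kmin kK p2.
    apply: le_trans (_ : r ^+ 2 <= _); last by rewrite lerDl sqr_ge0.
    by rewrite expr0 mulr1 exprMn ler_piMl ?sqr_ge0// exprn_ile1 ?invr_ge0// invf_le1// ler1n.
  apply: le_trans (_ : D i ^+ 2 <= _); last by rewrite lerDr sqr_ge0.
  rewrite lerXn2r ?nnegrE ?(ltW p2)// exprS mulKf//.
  by rewrite leNgt; apply/negP => /ltW/kmin; rewrite ltnn.
apply: (@le_trans _ _ (\sum_(i <- X) 2 ^+ be * r^-1 ^+ be *
      \sum_(k < K.+1) (2^-1 ^+ k) ^+ be * (D i <= 2 ^+ k * r)%R%:R)).
  elim: (X) term => [|i Y IH] tY; first by rewrite !big_nil.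
  by rewrite !big_cons lerD ?tY ?IH//; [left|move=> j jY; apply: tY; right].
rewrite -mulr_sumr exchange_big/= exprS [2 * _]mulrC -!mulrA ler_pM2l ?exprn_gt0//.
rewrite mulrA [leRHS]mulrC ler_pM2l ?exprn_gt0 ?invr_gt0//.
apply: (@le_trans _ _ (\sum_(k < K.+1) B * 2^-1 ^+ k)).
  apply: ler_sum => k _; rewrite -mulr_sumr.
  have -> : \sum_(i <- X) (D i <= 2 ^+ k * r)%R%:R =
      (count (fun i => D i <= 2 ^+ k * r) X)%:R :> R.
    by rewrite -sum1_count natr_sum [RHS]big_mkcond; apply: eq_bigr => i _; case: ifP.
  have rk : r <= 2 ^+ k * r by rewrite ler_peMl ?(ltW r0)// exprn_ege1// ler1n.
  apply: le_trans (ler_wpM2l _ (cnt _ rk)) _; first by rewrite exprn_ge0// exprn_ge0.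
  rewrite mulfK ?gt_eqF// mulrCA ler_wpM2l//.
  have be0 : (0 < be)%N.
    by rewrite lt0n; apply: contraTneq albe => ->; rewrite -ltNge; lra.
  have pk : (2 ^+ k) `^ al <= (2 ^+ k) ^+ be.-1 :> R.
    rewrite -[leRHS]powR_mulrn ?exprn_ge0//; apply: ler_powR.
      by rewrite exprn_ege1// ler1n.
    by rewrite -subn1 natrB//; lra.
  apply: le_trans (ler_wpM2l _ pk) _; first by rewrite exprn_ge0// exprn_ge0.
  rewrite -{1}(prednK be0) exprS -mulrA -exprMn -exprMn mulVf//.
  by rewrite !expr1n mulr1.
rewrite -mulr_sumr.
have S : \sum_(k < K.+1) 2^-1 ^+ k <= 2 :> R.
  have -> : \sum_(k < K.+1) 2^-1 ^+ k = 2 - 2^-1 ^+ K :> R.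
    elim: K {DK term} => [|K IH]; first by rewrite big_ord1 !expr0; lra.
    by rewrite big_ord_recr /= IH exprS; field.
  by rewrite lerBlDr lerDl exprn_ge0.
by apply: le_trans (ler_wpM2l B0 S) _; rewrite mulrC.
Qed.

(** * Counting in Ahlfors regular sets *)

Lemma sume_const_seq (R : realType) (I : Type) (X : seq I) (c : R) :
  (\sum_(i <- X) c%:E = ((size X)%:R * c)%:E)%E.
Proof.
elim: X => [|i X IH]; first by rewrite big_nil mul0r.
by rewrite big_cons IH /= -EFinD -natr1 mulrDl mul1r addrC.
Qed.

(** The balls of radius [r / 3] around the points of [X] are at distance at
    least [r / 3] from each other, so that their measures add up, and all lie
    in one ball of radius [3 * rho]. *)
Lemma ahlfors_count_le (R : realType) (d : nat) (s : R) (F : set 'rV[R]_d) :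
  0 <= s -> ahlfors_regular s F ->
  exists2 K : R, 1 <= K & forall (X : seq 'rV[R]_d) (x : 'rV[R]_d) (r rho : R),
    0 < r <= rho -> (forall z, z \in X -> F z /\ enorm (z - x) <= rho) ->
    pairwise (fun y z => r < enorm (y - z)) X ->
    (size X)%:R <= K * (rho / r) `^ s.
Proof.
move=> s0 [C C1 regF]; have C0 : 0 < C by exact: lt_le_trans C1.
have nine : 1 <= 9 `^ s :> R.
  by rewrite -[leLHS](powRr0 9) ler_powR// ler1n.
have K1 : 1 <= C ^+ 2 * 9 `^ s.
  by rewrite -[leLHS]mulr1 ler_pM// exprn_ege1.
exists (C ^+ 2 * 9 `^ s) => // X x r rho /andP[r0 rr] XF sX.
have rho0 : 0 < rho by exact: lt_le_trans rr.
have one : 1 <= (rho / r) `^ s.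
  by rewrite -[leLHS](powRr0 (rho / r)) ler_powR// ler_pdivlMr// mul1r.
have [sX1|sX1] := leqP (size X) 1.
  apply: (@le_trans _ _ 1); first by rewrite lern1.
  by rewrite -[leLHS]mulr1 ler_pM.
have uX : uniq X.
  by apply: (pairwise_separated_uniq (ltW r0) _ sX) => y; rewrite subrr enorm0.
have [z0 [z1 [z0X z1X z01]]] :
    exists z0 z1, [/\ z0 \in X, z1 \in X & z0 != z1].
  case: X sX1 uX {XF sX} => [|a [|b X]]//= _ /andP[]; rewrite !in_cons negb_or.
  by move=> /andP[ab _] _; exists a, b; rewrite !in_cons !eqxx ?orbT.
have rdiam : (r%:E <= diam F)%E.
  apply: le_trans (le_diam (XF _ z0X).1 (XF _ z1X).1); rewrite lee_fin ltW//.
  exact: (pairwise_separatedP (@enormB R d) sX).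
have r3 : 0 < r / 3 by rewrite divr_gt0.
have low z : z \in X -> ((C^-1 * (r / 3) `^ s)%:E <=
    hausdorff_measure s (F `&` eball z (r / 3)))%E.
  have r3d : ((r / 3)%:E <= diam F)%E.
    by apply: le_trans rdiam; rewrite lee_fin; lra.
  by move=> zX; have /andP[] := regF z (r / 3) (XF z zX).1 r3 r3d.
have up : (hausdorff_measure s (F `&` eball z0 (3 * rho)) <=
    (C * (3 * rho) `^ s)%:E)%E.
  have [le3|gt3] := leP (3 * rho)%:E (diam F).
    have p3 : 0 < 3 * rho by rewrite mulr_gt0.
    by have /andP[_] := regF z0 (3 * rho) (XF _ z0X).1 p3 le3.
  have dfin : (fine (diam F))%:E = diam F.
    by rewrite fineK// fin_real// (lt_le_trans _ rdiam) ?ltNyr// (lt_trans gt3)// ltry.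
  have rd : r <= fine (diam F) by rewrite -lee_fin dfin.
  have dd : (fine (diam F)) < 3 * rho by rewrite -lte_fin dfin.
  have ddf : ((fine (diam F))%:E <= diam F)%E by rewrite dfin.
  have /andP[_ H] := regF z0 _ (XF _ z0X).1 (lt_le_trans r0 rd) ddf.
  apply: (@le_trans _ _ (C * fine (diam F) `^ s)%:E).
    apply: le_trans H; apply: hausdorff_measure_le => y [Fy _]; split => //.
    by rewrite /eball /= -lee_fin dfin; apply: le_diam => //; exact: (XF _ z0X).1.
  rewrite lee_fin; apply: ler_wpM2l; first exact: ltW.
  apply: ge0_ler_powR; rewrite ?nnegrE ?(ltW dd)//; last first.
    by rewrite mulr_ge0// ltW.
  by rewrite (le_trans (ltW r0) rd).
have H : ((size X)%:R * (C^-1 * (r / 3) `^ s) <= C * (3 * rho) `^ s).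
  rewrite -lee_fin -sume_const_seq; apply: le_trans up.
  apply: (@le_trans _ _ (\sum_(z <- X) hausdorff_measure s (F `&` eball z (r / 3)))%E).
    by rewrite big_seq [leRHS]big_seq; apply: lee_sum => z zX; exact: low.
  apply: le_trans (hausdorff_measure_separated_big s r3 uX _) _.
    move=> y z u v yX zX yz [_ uy] [_ vz].
    have h := pairwise_separatedP (@enormB R d) sX yX zX yz.
    have h1 := enorm_dist y u z; have h2 := enorm_dist u v z.
    by rewrite /eball /= (enormB u) in uy; rewrite /eball /= in vz; lra.
  apply: hausdorff_measure_le => u [z zX [Fu uz]]; split => //.
  rewrite /eball /= in uz *.
  have h1 := enorm_dist u z z0; have h2 := enorm_dist z x z0.
  have := (XF z zX).2; have := (XF z0 z0X).2; rewrite (enormB z0); lra.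
have e1 : (rho / r) `^ s * (r / 3) `^ s = (rho / 3) `^ s.
  rewrite -powRM ?divr_ge0 ?(ltW r0) ?(ltW rho0)//.
  by congr (_ `^ s); field; rewrite gt_eqF.
have e2 : 9 `^ s * (rho / 3) `^ s = (3 * rho) `^ s.
  rewrite -powRM ?divr_ge0 ?(ltW rho0)//.
  by congr (_ `^ s); field.
have p3 : 0 < (r / 3) `^ s by rewrite powR_gt0.
suff : (size X)%:R * (r / 3) `^ s <=
    C ^+ 2 * 9 `^ s * (rho / r) `^ s * (r / 3) `^ s by rewrite ler_pM2r.
rewrite -!mulrA e1 e2.
have := ler_wpM2l (ltW C0) H; by rewrite mulrCA mulVKf ?gt_eqF// mulrA -expr2.
Qed.

(** The balls of radius [rho] around the points counted cover the ball of
    radius [r / 2], which has measure of the order of [r ^ s]. *)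
Lemma ahlfors_count_ge (R : realType) (d : nat) (s : R) (F : set 'rV[R]_d) :
  0 <= s -> ahlfors_regular s F ->
  exists2 K : R, 1 <= K & forall (X : seq 'rV[R]_d) (x : 'rV[R]_d) (r rho : R),
    0 < rho <= r -> (r%:E <= diam F)%E -> F x -> (forall z, z \in X -> F z) ->
    (forall y, F y -> exists2 z, z \in X & enorm (y - z) <= rho) ->
    (r / rho) `^ s <= K * (count (fun z => enorm (z - x) <= r) X)%:R.
Proof.
move=> s0 [C C1 regF]; have C0 : 0 < C by exact: lt_le_trans C1.
have two : 1 <= 2 `^ s :> R by rewrite -[leLHS](powRr0 2) ler_powR// ler1n.
have K1 : 1 <= C ^+ 2 * 2 `^ s.
  by rewrite -[leLHS]mulr1 ler_pM// exprn_ege1.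
exists (C ^+ 2 * 2 `^ s) => // X x r rho /andP[rho0 rr] rd Fx XF cov.
have r0 : 0 < r by exact: lt_le_trans rr.
set N := count _ X.
have [small|large] := leP rho (r / 2); last first.
  have N1 : 1 <= N%:R :> R.
    rewrite ler1n /N -has_count; apply/hasP; have [z zX xz] := cov x Fx.
    by exists z => //; rewrite enormB (le_trans xz).
  apply: (@le_trans _ _ (2 `^ s)).
    apply: ge0_ler_powR; rewrite ?nnegrE ?divr_ge0 ?(ltW r0) ?(ltW rho0)//.
    by rewrite ler_pdivrMr//; lra.
  rewrite -[leLHS]mulr1; apply: ler_pM => //; rewrite ?powR_ge0//.
  by rewrite ler_peMl ?powR_ge0// exprn_ege1.
have r2 : 0 < r / 2 by rewrite divr_gt0.
have r2d : ((r / 2)%:E <= diam F)%E.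
  by apply: le_trans rd; rewrite lee_fin; lra.
have rhod : (rho%:E <= diam F)%E by apply: le_trans rd; rewrite lee_fin.
have /andP[low _] := regF x (r / 2) Fx r2 r2d.
pose X' := [seq z <- X | enorm (z - x) <= r].
have H : C^-1 * (r / 2) `^ s <= N%:R * (C * rho `^ s).
  rewrite -lee_fin; apply: le_trans low _.
  have -> : N = size X' by rewrite size_filter.
  rewrite -sume_const_seq.
  apply: (@le_trans _ _ (\sum_(z <- X') hausdorff_measure s (F `&` eball z rho))%E).
    apply: le_trans (hausdorff_measure_big _ _ _).
    apply: hausdorff_measure_le => y [Fy yx]; rewrite /eball /= in yx.
    have [z zX yz] := cov y Fy; exists z => //.
    rewrite mem_filter zX andbT; have := enorm_dist z y x; rewrite (enormB z y); lra.
  rewrite big_seq [leRHS]big_seq; apply: lee_sum => z.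
  rewrite mem_filter => /andP[_ zX].
  by have /andP[] := regF z rho (XF z zX) rho0 rhod.
have e1 : (r / rho) `^ s * rho `^ s = r `^ s.
  by rewrite -powRM ?divr_ge0 ?(ltW r0) ?(ltW rho0)// divfK// gt_eqF.
have e2 : 2 `^ s * (r / 2) `^ s = r `^ s.
  by rewrite -powRM ?divr_ge0 ?(ltW r0)// mulrC divfK.
have p : 0 < rho `^ s by rewrite powR_gt0.
rewrite -(ler_pM2r p) e1 -e2.
have -> : C ^+ 2 * 2 `^ s * N%:R * rho `^ s =
  2 `^ s * (C * (N%:R * (C * rho `^ s))) by ring.
apply: ler_wpM2l; first exact: powR_ge0.
by rewrite -ler_pdivrMl.
Qed.

(** * The smoothed projection and its energy *)

Lemma psq_sym (R : realType) (d : nat) (L : {vspace 'rV[R]_d})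
  (x y : 'rV[R]_d) : psq L (x - y) = psq L (y - x).
Proof. by rewrite /psq !oprojB enormB. Qed.

Lemma psq_frame (R : realType) (n d : nat) (L : {vspace 'rV[R]_d})
    (U : 'M[R]_(n, d)) (x y : 'rV[R]_d) : frame L U ->
  psq L (x - y) = enorm (x *m U^T - y *m U^T) ^+ 2.
Proof. by move=> LU; rewrite -mulmxBl (enorm_frame _ LU). Qed.

Lemma sqrtr_expS_gt0 (R : realType) (t : R) k : 0 < t -> 0 < Num.sqrt t ^+ k.
Proof. by move=> t0; rewrite exprn_gt0// sqrtr_gt0. Qed.

Lemma kern_scaled (R : realType) (d n : nat) (t w : R) : (n <= d)%N ->
  Num.sqrt t ^+ n * kern d n t w =
  (Num.sqrt t / Num.sqrt (t + w)) ^+ d.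
Proof. by move=> nd; rewrite /kern mulrA -exprD subnKC// -exprMn. Qed.

(** Without its normalisation the kernel increases with its width. *)
Lemma kern_monotone (R : realType) (d n : nat) (t t' w : R) : (n <= d)%N ->
  0 < t <= t' -> 0 <= w ->
  Num.sqrt t ^+ n * kern d n t w <= Num.sqrt t' ^+ n * kern d n t' w.
Proof.
move=> nd /andP[t0 tt'] w0; rewrite !kern_scaled//.
have t'0 : 0 < t' by exact: lt_le_trans tt'.
have tw : 0 < t + w by rewrite ltr_wpDr.
have t'w : 0 < t' + w by rewrite ltr_wpDr.
apply: lerXn2r; rewrite ?nnegrE ?divr_ge0 ?sqrtr_ge0//.
rewrite ler_pdivrMr ?sqrtr_gt0// mulrAC ler_pdivlMr ?sqrtr_gt0//.
rewrite -!sqrtrM ?(ltW t0) ?(ltW t'0)// ler_sqrt ?mulr_ge0 ?(ltW t'0) ?(ltW tw)//.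
by rewrite !mulrDr [t' * t]mulrC lerD2l ler_wpM2r.
Qed.

Lemma kern_le (R : realType) (d n : nat) (t w : R) : (n <= d)%N ->
  0 < t -> 0 <= w -> kern d n t w <= (Num.sqrt t)^-1 ^+ n.
Proof.
move=> nd t0 w0; rewrite exprVn -(ler_pM2l (sqrtr_expS_gt0 n t0)).
rewrite divff ?gt_eqF ?sqrtr_expS_gt0// kern_scaled//.
have tw : 0 < t + w by rewrite ltr_wpDr.
rewrite exprn_ile1 ?divr_ge0 ?sqrtr_ge0// ler_pdivrMr ?sqrtr_gt0// mul1r.
by rewrite ler_sqrt ?(ltW tw)// lerDl.
Qed.

Lemma kern_ge (R : realType) (d n : nat) (t w : R) : (n <= d)%N ->
  0 < t -> 0 <= w <= 8 * t ->
  3^-1 ^+ d * (Num.sqrt t)^-1 ^+ n <= kern d n t w.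
Proof.
move=> nd t0 /andP[w0 wt]; rewrite -(ler_pM2l (sqrtr_expS_gt0 n t0)).
rewrite mulrCA [(Num.sqrt t)^-1 ^+ n]exprVn mulfV ?gt_eqF ?sqrtr_expS_gt0//.
rewrite mulr1 kern_scaled//.
have tw : 0 < t + w by rewrite ltr_wpDr.
apply: lerXn2r; rewrite ?nnegrE ?divr_ge0 ?sqrtr_ge0 ?invr_ge0//.
rewrite ler_pdivlMr ?sqrtr_gt0// mulrC ler_pdivrMr//.
rewrite -[X in _ * X](@gtr0_norm _ 3)// -sqrtr_sqr -sqrtrM ?(ltW t0)//.
by rewrite ler_sqrt ?mulr_ge0 ?(ltW t0) ?sqr_ge0//; lra.
Qed.

(** The projection to [L] of the measure of mass [m] at each point of [X],
    smoothed at the scale [Num.sqrt t]. *)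
Definition smoothed (R : realType) (d n : nat) (X : seq 'rV[R]_d) (m : R)
    (L : {vspace 'rV[R]_d}) (t : R) (x : 'rV[R]_d) : R :=
  \sum_(z <- X) m * kern d n t (psq L (z - x)).

Arguments smoothed {R d} n X m L t x.

(** The squared norm, in the Hilbert space of the kernel, of the [p]-th
    difference in [t] of the smoothed projection, with step [r ^ 2 * lam]. It
    measures the oscillation at the scale [r]: differences of high order damp
    the contribution of distant pairs of points. *)
Definition energy (R : realType) (d n p : nat) (X : seq 'rV[R]_d) (m lam r : R)
    (L : {vspace 'rV[R]_d}) : R :=
  \sum_(a <- X) \sum_(b <- X) m ^+ 2 *
    \sum_(i < p.+1) \sum_(j < p.+1) dcoef R p i * dcoef R p j *
      kern d n (r ^+ 2 + (i + j)%:R * (r ^+ 2 * lam)) (psq L (a - b)).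

Arguments energy {R d} n p X m lam r L.

(** The projections of [Y] are separated in dimension [n], so that a shell of
    radius [u * r] contains of the order of [u ^ n] of them, whereas the kernel
    decays like [u ^ (- d)]. *)
Lemma kern_row_sum (R : realType) (d n : nat) (L : {vspace 'rV[R]_d})
    (Y : seq 'rV[R]_d) (y : 'rV[R]_d) (r : R) :
  (0 < n < d)%N -> \dim L = n -> 0 < r ->
  pairwise (fun x y => r < enorm (oproj L (x - y))) Y ->
  \sum_(y' <- Y) kern d n (r ^+ 2) (psq L (y - y')) <=
  2 ^+ d.+1 * (2 * n).+1%:R ^+ n * r^-1 ^+ n.
Proof.
move=> /andP[n0 nd] dL r0 sY; have [U LU] := frame_exists dL.
have sr : Num.sqrt (r ^+ 2) = r by rewrite sqrtr_sqr gtr0_norm.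
rewrite /kern sr -mulr_sumr.
have := @shell_sum R _ Y (fun y' => enorm (oproj L (y - y'))) r
  ((2 * n).+1%:R ^+ n) n%:R d r0 (exprn_ge0 _ (ler0n _ _)) (ler0n _ _).
rewrite natr1 ler_nat => /(_ nd (fun=> enorm_ge0 _)) H.
apply: le_trans (ler_wpM2l _ (H _)) _; first by rewrite exprn_ge0// ltW.
  move=> rho rr; rewrite powR_mulrn ?divr_ge0 ?(ltW r0) ?(le_trans (ltW r0) rr)//.
  rewrite -exprMn -size_filter -(size_map (fun x => x *m U^T)).
  apply: (@packing_bound _ _ _ (y *m U^T) r rho n0); first by rewrite r0.
    rewrite pairwise_map; apply: sub_pairwise (pairwise_filter _ sY) => u v.
    by rewrite -(enorm_frame _ LU) mulmxBl.
  move=> x /mapP[u]; rewrite mem_filter => /andP[yu _] ->.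
  by rewrite -mulmxBl (enorm_frame _ LU) oprojB enormB -oprojB.
rewrite mulrCA -!mulrA; apply: ler_wpM2l; first exact: exprn_ge0.
apply: ler_wpM2l; first exact: exprn_ge0.
rewrite -{2}(subnKC (ltnW nd)) exprD mulrCA -exprMn divff ?gt_eqF//.
by rewrite expr1n mulr1.
Qed.

(** Few places see a large difference: distinct places are almost orthogonal
    in the Hilbert space of the kernel. *)
Lemma large_difference_count (R : realType) (d n p : nat)
    (L : {vspace 'rV[R]_d}) (X Y : seq 'rV[R]_d) (m lam r eta : R) :
  (0 < n < d)%N -> \dim L = n -> 0 < r -> 0 <= lam -> 0 <= eta ->
  pairwise (fun x y => r < enorm (oproj L (x - y))) Y ->
  (forall y, y \in Y -> eta <= \sum_(i < p.+1)
    dcoef R p i * smoothed n X m L (r ^+ 2 + i%:R * (r ^+ 2 * lam)) y) ->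
  (size Y)%:R * eta ^+ 2 <=
  2 ^+ d.+1 * (2 * n).+1%:R ^+ n * r^-1 ^+ n * energy n p X m lam r L.
Proof.
move=> /andP[n0 nd] dL r0 lam0 eta0 sY Yeta; have [U LU] := frame_exists dL.
pose T := ({posnum R} * 'rV[R]_n)%type.
have r20 : 0 < r ^+ 2 / 2 by rewrite divr_gt0// exprn_gt0.
have ti (i : 'I_p.+1) : 0 < r ^+ 2 / 2 + i%:R * (r ^+ 2 * lam).
  have q0 : 0 <= r ^+ 2 by exact: sqr_ge0.
  by rewrite ltr_wpDr// mulr_ge0// mulr_ge0.
pose q (y : 'rV[R]_d) : T := (PosNum r20, y *m U^T).
pose pt (z : 'rV[R]_d) (i : 'I_p.+1) : R * T :=
  (dcoef R p i * m, (PosNum (ti i), z *m U^T)).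
pose k (a b : T) := kern d n (a.1%:num + b.1%:num) (enorm (a.2 - b.2) ^+ 2).
have ksym a b : k a b = k b a by rewrite /k addrC enormB.
have kqq y y' : k (q y) (q y') = kern d n (r ^+ 2) (psq L (y - y')).
  by rewrite /k /q /= (psq_frame _ _ LU); congr (kern _ _ _ _); field.
have kqp y z i : k (q y) (pt z i).2 =
    kern d n (r ^+ 2 + i%:R * (r ^+ 2 * lam)) (psq L (z - y)).
  by rewrite /k /q /= psq_sym (psq_frame _ _ LU); congr (kern _ _ _ _); field.
have kpp z i z' j : k (pt z i).2 (pt z' j).2 =
    kern d n (r ^+ 2 + (i + j)%:R * (r ^+ 2 * lam)) (psq L (z - z')).
  by rewrite /k /q /= (psq_frame _ _ LU) natrD; congr (kern _ _ _ _); field.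
pose XX := [seq pt z i | z <- X, i <- index_enum 'I_p.+1].
have B0 : 0 < 2 ^+ d.+1 * (2 * n).+1%:R ^+ n * r^-1 ^+ n.
  by rewrite !mulr_gt0 ?exprn_gt0 ?invr_gt0.
have := @posdef_count R T _ k XX Y q eta _ (posdef_kern (R := R) nd) ksym eta0 B0.
have -> : \sum_(a <- XX) \sum_(b <- XX) a.1 * b.1 * k a.2 b.2 =
    energy n p X m lam r L.
  rewrite big_allpairs_dep; apply: eq_bigr => a _.
  under eq_bigr do rewrite big_allpairs_dep.
  rewrite exchange_big; apply: eq_bigr => b _; rewrite mulr_sumr.
  apply: eq_bigr => i _; rewrite mulr_sumr; apply: eq_bigr => j _.
  by rewrite kpp /=; ring.
apply.
- move=> y yY; apply: le_trans (Yeta y yY) _; rewrite big_allpairs_dep exchange_big.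
  rewrite le_eqVlt; apply/orP; left; apply/eqP; apply: eq_bigr => i _.
  rewrite /smoothed mulr_sumr; apply: eq_bigr => z _.
  by rewrite kqp /=; ring.
- move=> y yY; under eq_bigr do rewrite kqq.
  by apply: kern_row_sum => //; rewrite n0.
Qed.

(** * The mean of the energy *)

Lemma bdmeas_energy (R : realType) (d n : nat) (hn : (n <= d)%N) (p : nat)
    (X : seq 'rV[R]_d) (m lam r : R) : 0 < r -> 0 <= lam ->
  bdmeas (fun L : grass_borel R hn =>
    energy n p X m lam r (val (L : grassmannian R hn))).
Proof.
move=> r0 lam0; apply: bdmeas_sum => a; apply: bdmeas_sum => b.
apply: bdmeasM; first exact: bdmeas_cst.
apply: bdmeas_sum => i; apply: bdmeas_sum => j.
apply: bdmeasM; first exact: bdmeas_cst.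
apply: bdmeas_kern; have q0 : 0 < r ^+ 2 by rewrite exprn_gt0.
by rewrite ltr_wpDr// mulr_ge0// mulr_ge0// ltW.
Qed.

(** By [haar_kern] the average of the energy is a sum, over pairs of points,
    of iterated differences of [(r ^ 2 + |a - b| ^ 2) ^ (- n / 2)]; these decay
    faster than [|a - b| ^ (- s)], so that nearby pairs dominate. *)
Lemma energy_mean (R : realType) (n p : nat) (s : R) :
  (0 < n)%N -> 0 <= s -> s + 1 <= (n + 4 * p)%:R ->
  exists2 C : R, 0 <= C &
  forall (d : nat) (hn : (n <= d)%N) (gamma : probability (grass_borel R hn) R)
    (X : seq 'rV[R]_d) (m lam r K : R),
    is_haar gamma -> 0 < r -> 0 < lam -> 0 < m -> 0 <= K ->
    (size X)%:R * m <= K ->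
    (forall x rho, x \in X -> r <= rho ->
      (count (fun z => enorm (x - z) <= rho) X)%:R * m <= K * rho `^ s) ->
    \int[gamma]_L energy n p X m lam r (val (L : grassmannian R hn)) <=
    C * lam ^+ (2 * p) * K ^+ 2 * r `^ s * r^-1 ^+ n.
Proof.
move=> n0 s0 sn; have [C C0 HC] := iterated_difference_le R p n0.
exists (C * 2 ^+ (n + 4 * p).+1); first by rewrite mulr_ge0// exprn_ge0.
move=> d hn gamma X m lam r K inv r0 lam0 m0 K0 sX cnt.
have r20 : 0 < r ^+ 2 by rewrite exprn_gt0.
have b0 : 0 < r ^+ 2 * lam by rewrite mulr_gt0.
have t0 (i j : nat) : 0 < r ^+ 2 + (i + j)%:R * (r ^+ 2 * lam).
  by rewrite ltr_wpDr// mulr_ge0// ltW.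
have E : \int[gamma]_L energy n p X m lam r (val (L : grassmannian R hn)) =
    \sum_(a <- X) \sum_(b <- X) m ^+ 2 *
      \sum_(i < p.+1) \sum_(j < p.+1) dcoef R p i * dcoef R p j *
        (Num.sqrt (r ^+ 2 + enorm (a - b) ^+ 2 + (i + j)%:R * (r ^+ 2 * lam)))^-1 ^+ n.
  have bk a b (i j : 'I_p.+1) : bdmeas (fun L : grass_borel R hn =>
      dcoef R p i * dcoef R p j *
      kern d n (r ^+ 2 + (i + j)%:R * (r ^+ 2 * lam))
        (psq (val (L : grassmannian R hn)) (a - b))).
    by apply: bdmeasM; [exact: bdmeas_cst|exact: bdmeas_kern].
  rewrite Rintegral_bdmeas_sum; last first.
    move=> a; apply: bdmeas_sum => b; apply: bdmeasM; first exact: bdmeas_cst.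
    by apply: bdmeas_sum => i; exact: bdmeas_sum.
  apply: eq_bigr => a _; rewrite Rintegral_bdmeas_sum; last first.
    move=> b; apply: bdmeasM; first exact: bdmeas_cst.
    by apply: bdmeas_sum => i; exact: bdmeas_sum.
  apply: eq_bigr => b _; rewrite Rintegral_bdmeasZ; last first.
    by apply: bdmeas_sum => i; exact: bdmeas_sum.
  congr (_ * _); rewrite Rintegral_bdmeas_sum; last by move=> i; exact: bdmeas_sum.
  apply: eq_bigr => i _; rewrite Rintegral_bdmeas_sum//.
  apply: eq_bigr => j _; rewrite Rintegral_bdmeasZ; last exact: bdmeas_kern.
  by rewrite haar_kern// -enorm_sqr addrAC.
rewrite E.
have pair_le (a b : 'rV[R]_d) : \sum_(i < p.+1) \sum_(j < p.+1) dcoef R p i * dcoef R p j *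
      (Num.sqrt (r ^+ 2 + enorm (a - b) ^+ 2 + (i + j)%:R * (r ^+ 2 * lam)))^-1 ^+ n
    <= C * (r ^+ 2 * lam) ^+ (2 * p) *
       (Num.sqrt (r ^+ 2 + enorm (a - b) ^+ 2))^-1 ^+ (n + 4 * p).
  by apply: HC => //; rewrite ltr_wpDr// sqr_ge0.
set be := (n + 4 * p)%N in sn pair_le *.
have shell a : a \in X ->
    \sum_(b <- X) m * (Num.sqrt (r ^+ 2 + enorm (a - b) ^+ 2))^-1 ^+ be <=
    2 ^+ be.+1 * K * r `^ s * r^-1 ^+ be.
  move=> aX; rewrite -mulr_sumr.
  have := @shell_sum R _ X (fun b => enorm (a - b)) r (K * r `^ s / m) s be r0.
  rewrite divr_ge0 ?mulr_ge0 ?powR_ge0 ?(ltW m0)// => /(_ isT s0 sn).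
  move=> /(_ (fun=> enorm_ge0 _)) H.
  apply: le_trans (ler_wpM2l (ltW m0) (H _)) _; last first.
    by rewrite le_eqVlt; apply/orP; left; apply/eqP; field; rewrite gt_eqF.
  move=> rho rr; have rho0 := le_trans (ltW r0) rr.
  have e : r `^ s * (rho / r) `^ s = rho `^ s.
    rewrite -powRM ?divr_ge0 ?(ltW r0)//; congr (_ `^ s).
    by rewrite mulrC divfK// gt_eqF.
  have -> : K * r `^ s / m * (rho / r) `^ s = K * (r `^ s * (rho / r) `^ s) / m.
    by field; rewrite gt_eqF.
  by rewrite e ler_pdivlMr// cnt.
apply: (@le_trans _ _ (\sum_(a <- X) m * (C * (r ^+ 2 * lam) ^+ (2 * p) *
    (2 ^+ be.+1 * K * r `^ s * r^-1 ^+ be)))).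
  rewrite big_seq [leRHS]big_seq; apply: ler_sum => a aX.
  apply: (@le_trans _ _ (m * (C * (r ^+ 2 * lam) ^+ (2 * p) *
     (\sum_(b <- X) m * (Num.sqrt (r ^+ 2 + enorm (a - b) ^+ 2))^-1 ^+ be)))).
    rewrite [leRHS]mulrA mulr_sumr; apply: ler_sum => b _.
    have h := ler_wpM2l (sqr_ge0 m) (pair_le a b); apply: (le_trans h).
    by rewrite le_eqVlt; apply/orP; left; apply/eqP; ring.
  apply: ler_wpM2l; first exact: ltW.
  apply: ler_wpM2l; last exact: shell.
  by rewrite mulr_ge0// exprn_ge0// ltW.
rewrite -mulr_suml.
have -> : \sum_(a <- X) m = (size X)%:R * m.
  by rewrite big_const_seq count_predT iter_addr addr0 mulr_natl.
have nonneg : 0 <= C * (r ^+ 2 * lam) ^+ (2 * p) *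
    (2 ^+ be.+1 * K * r `^ s * r^-1 ^+ be).
  by rewrite !mulr_ge0 ?exprn_ge0 ?powR_ge0 ?invr_ge0// ltW.
apply: le_trans (ler_wpM2r nonneg sX) _.
rewrite le_eqVlt; apply/orP; left; apply/eqP.
have -> : r^-1 ^+ be = r^-1 ^+ n * r^-1 ^+ (4 * p) by rewrite /be exprD.
have -> : (r ^+ 2 * lam) ^+ (2 * p) = r ^+ (4 * p) * lam ^+ (2 * p).
  by rewrite exprMn -exprM mulnA.
have e : r ^+ (4 * p) * r^-1 ^+ (4 * p) = 1.
  by rewrite -exprMn divff ?expr1n// gt_eqF.
transitivity (C * 2 ^+ be.+1 * lam ^+ (2 * p) * K ^+ 2 * r `^ s * r^-1 ^+ n *
  (r ^+ (4 * p) * r^-1 ^+ (4 * p))); first by ring.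
by rewrite e mulr1.
Qed.

(** * Concentration at one scale *)

Lemma smoothed_ge0 (R : realType) (d n : nat) (X : seq 'rV[R]_d) (m : R)
    (L : {vspace 'rV[R]_d}) (t : R) (x : 'rV[R]_d) :
  0 <= m -> 0 <= smoothed n X m L t x.
Proof. by move=> m0; apply: sumr_ge0 => z _; rewrite mulr_ge0// kern_ge0. Qed.

Lemma smoothed_monotone (R : realType) (d n : nat) (X : seq 'rV[R]_d) (m : R)
    (L : {vspace 'rV[R]_d}) (t t' : R) (x : 'rV[R]_d) : (n <= d)%N ->
  0 <= m -> 0 < t <= t' ->
  Num.sqrt t ^+ n * smoothed n X m L t x <=
  Num.sqrt t' ^+ n * smoothed n X m L t' x.
Proof.
move=> nd m0 tt'; rewrite /smoothed !mulr_sumr; apply: ler_sum => z _.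
rewrite mulrCA [leRHS]mulrCA; apply: ler_wpM2l => //.
by apply: kern_monotone => //; exact: psq_ge0.
Qed.

Lemma smoothed_le (R : realType) (d n : nat) (X : seq 'rV[R]_d) (m : R)
    (L : {vspace 'rV[R]_d}) (t : R) (x : 'rV[R]_d) : (n <= d)%N ->
  0 <= m -> 0 < t ->
  smoothed n X m L t x <= (size X)%:R * m * (Num.sqrt t)^-1 ^+ n.
Proof.
move=> nd m0 t0.
have -> : (size X)%:R * m * (Num.sqrt t)^-1 ^+ n =
    \sum_(z <- X) m * (Num.sqrt t)^-1 ^+ n.
  by rewrite big_const_seq count_predT iter_addr addr0 -mulrA mulr_natl.
apply: ler_sum => z _; apply: ler_wpM2l => //.
by apply: kern_le => //; exact: psq_ge0.
Qed.

Lemma smoothed_ge (R : realType) (d n : nat) (X : seq 'rV[R]_d) (m : R)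
    (L : {vspace 'rV[R]_d}) (r : R) (x : 'rV[R]_d) : (n <= d)%N ->
  0 <= m -> 0 < r ->
  (count (fun z => enorm (oproj L (z - x)) <= 2 * r) X)%:R * m *
    (3^-1 ^+ d * r^-1 ^+ n) <= smoothed n X m L (r ^+ 2) x.
Proof.
move=> nd m0 r0; rewrite -sum1_count natr_sum !mulr_suml big_mkcond /=.
apply: ler_sum => z _; case: ifP => zx; last by rewrite mulr_ge0// kern_ge0.
rewrite mul1r; apply: ler_wpM2l => //.
have r20 : 0 < r ^+ 2 by rewrite exprn_gt0.
have pz : 0 <= psq L (z - x) <= 8 * r ^+ 2.
  rewrite psq_ge0 /=; apply: (@le_trans _ _ ((2 * r) ^+ 2)).
    by apply: lerXn2r; rewrite ?nnegrE ?enorm_ge0// mulr_ge0// ltW.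
  by rewrite exprMn ler_wpM2r ?sqr_ge0// -natrX ler_nat.
by have := kern_ge nd r20 pz; rewrite sqrtr_sqr (gtr0_norm r0).
Qed.

Lemma dcoef0 (R : realType) p : dcoef R p 0 = 1.
Proof. by rewrite /dcoef expr0 bin0. Qed.

Lemma dcoef_le (R : realType) p i : `|dcoef R p i| <= 2 ^+ p.
Proof.
rewrite /dcoef normrMn normrX normrN1 expr1n -natrX ler_nat.
have [ip|ip] := leqP i p; last by rewrite bin_small.
have -> : (2 ^ p = \sum_(j < p.+1) 'C(p, j))%N.
  rewrite -[2%N]/(1 + 1)%N expnDn; apply: eq_bigr => j _.
  by rewrite !exp1n !muln1.
by rewrite (bigD1 (Ordinal (ip : (i < p.+1)%N)))//= leq_addr.
Qed.

(** A place where the smoothed projection is [theta] at the scale [r], but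
    much smaller at the coarser scale [lam * r], sees a large difference: all
    other terms of the difference are at scales between [r] and [lam * r],
    where [smoothed_monotone] compares them with the value at [lam * r]. *)
Lemma difference_ge (R : realType) (d n p : nat) (X : seq 'rV[R]_d)
    (m r lam theta : R) (L : {vspace 'rV[R]_d}) (x : 'rV[R]_d) :
  (n <= d)%N -> (0 < p)%N -> 0 <= m -> 0 < r -> 1 < lam -> 0 <= theta ->
  theta <= smoothed n X m L (r ^+ 2) x ->
  2 * p%:R * 2 ^+ p * p%:R ^+ n * smoothed n X m L ((lam * r) ^+ 2) x <= theta ->
  theta / 2 <= \sum_(i < p.+1) dcoef R p i *
    smoothed n X m L (r ^+ 2 + i%:R * (r ^+ 2 * ((lam ^+ 2 - 1) / p%:R))) x.
Proof.
move=> nd p0 m0 r0 lam1 theta0 H1 H2.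
have pR : 0 < p%:R :> R by rewrite ltr0n.
have r20 : 0 < r ^+ 2 by rewrite exprn_gt0.
set La := (lam ^+ 2 - 1) / p%:R.
have La0 : 0 < La by rewrite divr_gt0// subr_gt0 expr_gt1 ?(lt_trans ltr01 lam1)// ltW ?(lt_trans ltr01 lam1).
have lamE : lam ^+ 2 = 1 + p%:R * La by rewrite /La; field; rewrite gt_eqF.
set g := smoothed n X m L ((lam * r) ^+ 2) x.
have g0 : 0 <= g by exact: smoothed_ge0.
have lamr : 0 < lam * r by rewrite mulr_gt0// (lt_trans ltr01).
have term (i : 'I_p) : smoothed n X m L
    (r ^+ 2 + (lift ord0 i)%:R * (r ^+ 2 * La)) x <= p%:R ^+ n * g.
  set t := r ^+ 2 + _.
  have i1 : 1 <= (lift ord0 i)%:R :> R by rewrite ler1n.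
  have ip : (lift ord0 i)%:R <= p%:R :> R by rewrite ler_nat lift0 ltn_ord.
  have q0 : 0 <= r ^+ 2 * La by rewrite mulr_ge0// ltW.
  have t0 : 0 < t by rewrite ltr_wpDr// mulr_ge0.
  have h1 := ler_wpM2r q0 ip; have h2 := ler_wpM2r q0 i1.
  have tl : t <= (lam * r) ^+ 2 by rewrite exprMn lamE /t; lra.
  have lt : (lam * r) ^+ 2 <= p%:R ^+ 2 * t.
    have p1 : 1 <= p%:R :> R by rewrite ler1n.
    have h : (lam * r) ^+ 2 <= p%:R * t.
      have h3 := ler_wpM2l (ltW pR) h2; have h4 := ler_wpM2r (ltW r20) p1.
      by rewrite exprMn lamE /t; lra.
    apply: le_trans h _; rewrite ler_pM2r// expr2 ler_peMl// ltW.
  have := smoothed_monotone X L x nd m0 (t := t) (t' := (lam * r) ^+ 2).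
  rewrite t0 tl => /(_ isT) h.
  rewrite -(ler_pM2l (sqrtr_expS_gt0 n t0)); apply: le_trans h _.
  rewrite -/g mulrA -exprMn; apply: ler_wpM2r => //.
  apply: lerXn2r; rewrite ?nnegrE ?sqrtr_ge0 ?mulr_ge0 ?sqrtr_ge0//.
  have -> : Num.sqrt t * p%:R = Num.sqrt (p%:R ^+ 2 * t).
    by rewrite sqrtrM ?sqr_ge0// sqrtr_sqr gtr0_norm// mulrC.
  by rewrite ler_sqrt// mulr_ge0 ?sqr_ge0// ltW.
rewrite big_ord_recl dcoef0 mul1r mul0r addr0.
have B : `|\sum_(i < p) dcoef R p (lift ord0 i) * smoothed n X m L
    (r ^+ 2 + (lift ord0 i)%:R * (r ^+ 2 * La)) x| <= theta / 2.
  apply: le_trans (ler_norm_sum _ _ _) _.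
  apply: (@le_trans _ _ (\sum_(i < p) 2 ^+ p * (p%:R ^+ n * g))).
    apply: ler_sum => i _; rewrite normrM; apply: ler_pM => //.
      exact: dcoef_le.
    rewrite ger0_norm ?smoothed_ge0//; exact: term.
  rewrite sumr_const card_ord -[leLHS]mulr_natl; move: H2; rewrite -/g; lra.
by move: B; rewrite ler_norml => /andP[B1 B2]; lra.
Qed.

Lemma count_separated_le1 (R : realType) (T : eqType) (D : T -> T -> R) (r : R)
    (X : seq T) (a : pred T) :
  pairwise (fun x y => r < D x y) X ->
  (forall x y, a x -> a y -> D x y <= r) -> (count a X <= 1)%N.
Proof.
move=> sX ar; rewrite -size_filter.
have := pairwise_filter a sX.
have : all a (seq.filter a X) by exact: filter_all.
case: (seq.filter a X) => [|x [|y Y]] //= /and3P[ax ay _] /andP[/andP[xy _] _].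
by have := ar _ _ ax ay; rewrite leNgt xy.
Qed.

Lemma size_le_count_cover (T T' : eqType) (X : seq T) (Y : seq T')
    (e : T -> T' -> bool) :
  (forall x, x \in X -> exists2 y, y \in Y & e x y) ->
  (size X <= \sum_(y <- Y) count (e^~ y) X)%N.
Proof.
move=> XY; rewrite -sum1_size.
under [leqRHS]eq_bigr do rewrite -sum1_count big_mkcond /=.
rewrite exchange_big /= big_seq [leqRHS]big_seq.
apply: leq_sum => x /XY[y yY exy].
by rewrite (big_rem y)//= exy leq_addr.
Qed.

(** The set [S] of places of concentration at the scale [r]. There are few
    fibres of the projection that meet [S], by [large_difference_count]; and
    none of them contains many points of [S], for then the smoothed projection
    would already be large at the coarser scale [lam * r]. *)
Lemma scale_cover (R : realType) (d n p : nat) (s K rho r lam theta : R)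
    (F S : set 'rV[R]_d) (X : seq 'rV[R]_d) (L : {vspace 'rV[R]_d}) (N : nat) :
  (0 < n < d)%N -> \dim L = n -> (0 < p)%N -> 0 < rho <= r -> 1 < lam ->
  0 < theta -> 1 <= K -> S `<=` F ->
  (forall x, F x ->
     (r / rho) `^ s <= K * (count (fun z => (enorm (z - x) <= r)%R) X)%:R) ->
  (forall Y : seq 'rV[R]_d, (forall y, y \in Y -> F y) ->
     pairwise (fun x y => 3 * r < enorm (x - y)) Y -> (size Y <= N)%N) ->
  (forall x, S x -> theta <= smoothed n X (rho `^ s) L (r ^+ 2) x) ->
  (forall x, S x -> 2 * p%:R * 2 ^+ p * p%:R ^+ n *
     smoothed n X (rho `^ s) L ((lam * r) ^+ 2) x <= theta) ->
  exists2 X' : seq 'rV[R]_d,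
    forall x, S x -> exists2 z, z \in X' & enorm (x - z) <= 3 * r &
    (size X')%:R * r `^ s * theta <=
      4 * K * 3 ^+ d * lam ^+ n * (2 ^+ d.+1 * (2 * n).+1%:R ^+ n) *
      energy n p X (rho `^ s) ((lam ^+ 2 - 1) / p%:R) r L.
Proof.
move=> /andP[n0 nd] dL p0 /andP[rho0 rr] lam1 th0 K1 SF low fin Sth Sco.
have r0 : 0 < r by exact: lt_le_trans rr.
set m := rho `^ s in Sth Sco *; have m0 : 0 < m by rewrite powR_gt0.
have K0 : 0 < K by exact: lt_le_trans K1.
have [X' [X'S sX' covX']] := @maximal_separated R _ (fun x y => enorm (x - y))
  S (3 * r) N (fun Y YS => fin Y (fun y yY => SF _ (YS y yY))).
exists X' => //.
pose D (x y : 'rV[R]_d) := enorm (oproj L (x - y)).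
have DC x y : D x y = D y x by rewrite /D !oprojB enormB.
have D0 x : D x x = 0 by rewrite /D oprojB subrr enorm0.
have [Y [YX' sY covY]] : exists Y : seq 'rV[R]_d,
    [/\ forall x, x \in Y -> x \in X', pairwise (fun x y => r < D x y) Y &
      forall x, x \in X' -> exists2 z, z \in Y & D x z <= r].
  apply: (@maximal_separated R _ D [set x | x \in X'] r (size X')).
  move=> Z ZX' sZ; apply: uniq_leq_size => //.
  exact: pairwise_separated_uniq (ltW r0) D0 sZ.
have p1 : 1 <= 2 * p%:R * 2 ^+ p * p%:R ^+ n :> R.
  have h : 1 <= p%:R :> R by rewrite ler1n.
  rewrite -[leLHS]mulr1; apply: ler_pM => //; last exact: exprn_ege1.
  rewrite -[leLHS]mulr1; apply: ler_pM => //; last by rewrite exprn_ege1// ler1n.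
  by lra.
have fle y : y \in Y -> smoothed n X m L (r ^+ 2) y <= lam ^+ n * theta.
  move=> /YX'/X'S Sy; have lam0 : 0 < lam by exact: lt_trans lam1.
  have lr : 0 < lam * r by exact: mulr_gt0.
  have := @smoothed_monotone R d n X m L (r ^+ 2) ((lam * r) ^+ 2) y (ltnW nd) (ltW m0).
  rewrite exprn_gt0// lerXn2r ?nnegrE ?(ltW r0) ?(ltW lr)//; last first.
    by rewrite ler_peMl ?(ltW r0)// ltW.
  move=> /(_ isT); rewrite !sqrtr_sqr !gtr0_norm//.
  have -> : (lam * r) ^+ n = r ^+ n * lam ^+ n by rewrite exprMn mulrC.
  rewrite -mulrA ler_pM2l ?exprn_gt0// => /le_trans; apply.
  apply: ler_wpM2l; first by rewrite exprn_ge0// ltW.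
  apply: le_trans (Sco y Sy); rewrite ler_peMl//.
  exact/smoothed_ge0/ltW.
(* Points of [X'] in one fibre have disjoint neighbourhoods, each with about
   [(r / rho) ^ s] points of [X], near the same fibre. *)
have mult y : y \in Y -> (count (fun x => D x y <= r) X')%:R * r `^ s <=
    K * 3 ^+ d * lam ^+ n * r ^+ n * theta.
  move=> yY; set c := count _ X'.
  have h1 : c%:R * (r / rho) `^ s <=
      K * (count (fun z => enorm (oproj L (z - y)) <= 2 * r) X)%:R.
    rewrite /c -size_filter; set X'' := seq.filter _ X'.
    have sX'' : pairwise (fun x y => 3 * r < enorm (x - y)) X''.
      exact: pairwise_filter.
    apply: (@le_trans _ _ (\sum_(x <- X'') K *
        (count (fun z => (enorm (z - x) <= r)%R) X)%:R)).
      have -> : (size X'')%:R * (r / rho) `^ s = \sum_(x <- X'') (r / rho) `^ s.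
        by rewrite big_const_seq count_predT iter_addr addr0 mulr_natl.
      rewrite big_seq [leRHS]big_seq; apply: ler_sum => x.
      by rewrite mem_filter => /andP[_ /X'S/SF]; exact: low.
    rewrite -mulr_sumr ler_pM2l// -natr_sum ler_nat.
    under eq_bigr do rewrite -sum1_count big_mkcond /=.
    rewrite exchange_big /= -[leqRHS]sum1_count [leqRHS]big_mkcond /=.
    apply: leq_sum => z _.
    rewrite -big_mkcond sum1_count; case: ifPn => zy.
      apply: (count_separated_le1 sX'') => u v uz vz.
      have := enorm_dist u z v; rewrite (enormB u z); have := r0; lra.
    rewrite leqn0; apply/eqP; apply: contraNeq zy; rewrite -lt0n -has_count.
    move=> /hasP[x]; rewrite mem_filter => /andP[xy _] zx.
    have -> : z - y = (z - x) - (y - x) by rewrite opprB addrA subrK.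
    rewrite oprojB; apply: le_trans (enormD _ _) _; rewrite enormN.
    have := enorm_oproj_le L (z - x); move: xy; rewrite DC /D; lra.
  have h2 := smoothed_ge X L y (ltnW nd) (ltW m0) r0.
  have h3 := le_trans h2 (fle y yY).
  move: h1 h3; set cX := (count _ X)%:R => h1 h3.
  have e1 : (r / rho) `^ s * m = r `^ s.
    rewrite /m -powRM ?divr_ge0 ?(ltW r0) ?(ltW rho0)//.
    by rewrite divfK// gt_eqF.
  have {}h1 : c%:R * r `^ s <= K * (cX * m).
    by rewrite -e1 mulrA [leRHS]mulrA ler_pM2r.
  apply: le_trans h1 _.
  have h4 : cX * m <= 3 ^+ d * r ^+ n * (lam ^+ n * theta).
    have q : 0 < 3^-1 ^+ d * r^-1 ^+ n.
      by rewrite mulr_gt0 ?exprn_gt0 ?invr_gt0.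
    rewrite -(ler_pM2r q); apply: le_trans h3 _.
    rewrite le_eqVlt; apply/orP; left; apply/eqP.
    transitivity (lam ^+ n * theta * ((3 ^+ d * 3^-1 ^+ d) * (r ^+ n * r^-1 ^+ n))).
      by rewrite -!exprMn !divff ?expr1n ?mulr1 ?gt_eqF.
    by ring.
  apply: le_trans (ler_wpM2l (ltW K0) h4) _.
  by rewrite le_eqVlt; apply/orP; left; apply/eqP; ring.
have sizeX' : (size X')%:R * r `^ s <=
    (size Y)%:R * (K * 3 ^+ d * lam ^+ n * r ^+ n * theta).
  have h : (size X' <= \sum_(y <- Y) count (fun x => (D x y <= r)%R) X')%N.
    exact: (@size_le_count_cover _ _ X' Y (fun x y => (D x y <= r)%R)).
  apply: (@le_trans _ _ (\sum_(y <- Y) (count (fun x => (D x y <= r)%R) X')%:R * r `^ s)).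
    by rewrite -mulr_suml ler_pM2r ?powR_gt0// -natr_sum ler_nat.
  apply: (@le_trans _ _ (\sum_(y <- Y) K * 3 ^+ d * lam ^+ n * r ^+ n * theta)).
    by rewrite big_seq [leRHS]big_seq; apply: ler_sum => y; exact: mult.
  by rewrite big_const_seq count_predT iter_addr addr0 [leRHS]mulr_natl.
set E := energy _ _ _ _ _ _ _; set B := 2 ^+ d.+1 * _.
have cY : (size Y)%:R * (theta / 2) ^+ 2 <= B * r^-1 ^+ n * E.
  apply: large_difference_count => //; first by rewrite n0.
  - by rewrite divr_ge0 ?ler0n// subr_ge0 ltW// expr_gt1 ?(ltW lam1)// ltW// (lt_trans ltr01).
  - by rewrite divr_ge0// ltW.
  move=> y /YX'/X'S Sy.
  exact: (difference_ge (ltnW nd) p0 (ltW m0) r0 lam1 (ltW th0)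
    (Sth _ Sy) (Sco _ Sy)).
have P0 : 0 <= K * 3 ^+ d * lam ^+ n.
  by rewrite !mulr_ge0 ?exprn_ge0 ?(ltW K0)// ltW// (lt_trans ltr01).
apply: le_trans (ler_wpM2r (ltW th0) sizeX') _.
have rn : r ^+ n * r^-1 ^+ n = 1 by rewrite -exprMn divff ?expr1n// gt_eqF.
have -> : (size Y)%:R * (K * 3 ^+ d * lam ^+ n * r ^+ n * theta) * theta =
  4 * (K * 3 ^+ d * lam ^+ n) * r ^+ n * ((size Y)%:R * (theta / 2) ^+ 2) by field.
have Q0 : 0 <= 4 * (K * 3 ^+ d * lam ^+ n) * r ^+ n.
  by rewrite mulr_ge0 ?exprn_ge0 ?(ltW r0)// mulr_ge0.
apply: le_trans (ler_wpM2l Q0 cY) _.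
rewrite le_eqVlt; apply/orP; left; apply/eqP.
transitivity (4 * K * 3 ^+ d * lam ^+ n * B * E * (r ^+ n * r^-1 ^+ n)).
  by ring.
by rewrite rn mulr1.
Qed.

(** * Concentration at all scales *)

Lemma energy_ge0 (R : realType) (d n p : nat) (L : {vspace 'rV[R]_d})
    (X : seq 'rV[R]_d) (m lam r : R) : (0 < n < d)%N -> \dim L = n ->
  0 < r -> 0 <= lam -> 0 <= energy n p X m lam r L.
Proof.
move=> nd dL r0 lam0.
have := @large_difference_count R d n p L X [::] m lam r 0 nd dL r0 lam0 (lexx 0) isT.
rewrite mul0r => /(_ (fun _ H => match notF H with end)).
by rewrite pmulr_rge0// !mulr_gt0 ?exprn_gt0 ?invr_gt0.
Qed.

Lemma hausdorff_premeasure_eball (R : realType) (d n : nat) (delta r : R)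
    (x : 'rV[R]_d) : 0 <= r -> 2 * r <= delta ->
  (hausdorff_premeasure n%:R delta (eball x r) <= ((2 * r) ^+ n)%:E)%E.
Proof.
move=> r0 rd.
have db : (diam (eball x r) <= (2 * r)%:E)%E.
  apply: diam_le => u v ux vx; rewrite lee_fin.
  have := enorm_dist u x v; rewrite /eball /= in ux vx.
  by rewrite (enormB x v) => h; lra.
pose E (k : nat) : set 'rV[R]_d := if k is 0%N then eball x r else set0.
have H : (hausdorff_premeasure n%:R delta (eball x r) <=
    \sum_(0 <= k <oo) diam_pow n%:R (E k))%E.
  apply: ereal_inf_lbound; exists E => //; split.
    by move=> u ux; exists 0%N.
  case=> [|k] /=; first by rewrite (le_trans db)// lee_fin.
  by rewrite diam_set0 leNye.
apply: (le_trans H).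
rewrite (@nneseries_split _ _ 0 1); last by move=> *; exact: diam_pow_ge0.
rewrite eseries0 => [|[|k] //= _ _]; last by rewrite diam_pow0.
rewrite adde0 add0n big_nat1 /=.
have := diam_pow_le (ler0n R n) db; rewrite powR_mulrn//.
by rewrite mulr_ge0.
Qed.

Lemma exprn_unbounded (R : realType) (th c : R) : 2 <= th ->
  exists J0 : nat, forall J, (J0 <= J)%N -> c <= th ^+ J.
Proof.
move=> th2; exists (Num.truncn `|c|).+1 => J JJ.
have /andP[_ /ltW h] := truncn_itv (normr_ge0 c).
apply: le_trans (ler_norm c) _; apply: le_trans h _.
apply: (@le_trans _ _ J%:R); first by rewrite ler_nat.
apply: (@le_trans _ _ (2 ^+ J)); first by rewrite -natrX ler_nat ltnW// ltn_expl.
by apply: lerXn2r; rewrite ?nnegrE// (le_trans _ th2).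
Qed.

Lemma geometric_le2 (R : realType) (th : R) J : 2 <= th ->
  \sum_(j < J) th^-1 ^+ j <= 2.
Proof.
move=> th2; have th0 : 0 < th by apply: lt_le_trans th2.
suff : \sum_(j < J) th^-1 ^+ j <= 2 - 2 * 2^-1 ^+ J.
  by move/le_trans; apply; rewrite gerBl mulr_ge0// exprn_ge0.
elim: J => [|J IH]; first by rewrite big_ord0 expr0; lra.
rewrite big_ord_recr /=.
have h : th^-1 ^+ J <= 2^-1 ^+ J.
  by apply: lerXn2r; rewrite ?nnegrE ?invr_ge0 ?(ltW th0)// lef_pV2 ?posrE.
rewrite exprS; set u := 2^-1 ^+ J in h IH *; lra.
Qed.

(** The places where a fibre of the projection contains at least
    [c * r ^ (n - s)] points of [X], up to an error [2 * r]. *)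
Definition concentration (R : realType) (d n : nat) (s : R) (F : set 'rV[R]_d)
    (X : seq 'rV[R]_d) (c r : R) (L : {vspace 'rV[R]_d}) : set 'rV[R]_d :=
  [set x | F x /\ c <=
    (count (fun z => (enorm (oproj L (z - x)) <= 2 * r)%R) X)%:R
      * r `^ s * r^-1 ^+ n].

Arguments concentration {R d} n s F X c r L.

(** For a generic subspace the set of places where the net of mesh
    [lam ^- J] puts more than about [lam ^ ((s - n + 2 eps) J)] points in a
    fibre is covered by balls with small sum of [n]-th powers of radii.

    Such a place is a place of concentration at the scale [lam ^- J]; take the
    coarsest scale [lam ^- j] at which the smoothed projection is at least
    [th ^ (j + J)]. Since its total mass is bounded, that scale tends to 0 with
    [lam ^- J], and [scale_cover] applies there. *)
Lemma concentration_cover (R : realType) (d n : nat) (hnd : (n < d)%N)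
    (s eps D0 : R) (F : set 'rV[R]_d)
    (gamma : probability (grass_borel R (ltnW hnd)) R) :
  (0 < n)%N -> n%:R < s <= d%:R -> 0 < eps -> ahlfors_regular s F ->
  (0 < diam F)%E -> (diam F <= D0%:E)%E -> is_haar gamma ->
  exists th lam C : R, exists X : nat -> seq 'rV[R]_d,
  exists W : nat -> grassmannian R (ltnW hnd) -> R,
  [/\ [/\ 2 <= th, 1 < lam & lam `^ eps = th],
      0 <= C,
      forall J, (forall z, z \in X J -> F z) /\
        (forall x, F x -> exists2 z, z \in X J & enorm (x - z) <= lam^-1 ^+ J),
      forall J, [/\ bdmeas (W J : grass_borel R (ltnW hnd) -> R),
        (forall L, 0 <= W J L) & \int[gamma]_L W J L <= C * th^-1 ^+ J] &
      forall delta : R, 0 < delta -> exists J0 : nat, forall J, (J0 <= J)%N ->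
        forall L : grassmannian R (ltnW hnd),
        (hausdorff_premeasure n%:R delta
          (concentration n s F (X J) (3 ^+ d * th ^+ (2 * J)) (lam^-1 ^+ J) (val L))
         <= (W J L)%:E)%E].
Proof.
move=> n0 /andP[ns sd] eps0 regF dF0 dFD inv.
have nR : 0 < n%:R :> R by rewrite ltr0n.
have s0 : 0 < s by exact: lt_trans ns.
have d0 : (0 < d)%N by exact: leq_ltn_trans (leq0n n) (hnd).
have [K1 K11 cntle] := ahlfors_count_le (ltW s0) regF.
have [K2 K21 cntge] := ahlfors_count_ge (ltW s0) regF.
have D00 : 0 < D0 by rewrite -lte_fin (lt_le_trans dF0).
pose Mp : R := 2 * d%:R * 2 ^+ d * d%:R ^+ n.
have Mp0 : 0 <= Mp by rewrite /Mp !mulr_ge0// exprn_ge0.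
(* This [th] makes [Mp * theta J j <= theta J j.+1] below, which is the
   drop between neighbouring scales that [scale_cover] needs. *)
pose th := 2 + Mp; have th2 : 2 <= th by rewrite lerDl.
have th0 : 0 < th by exact: lt_le_trans th2.
have th1 : 1 <= th by apply: le_trans th2; rewrite ler1n.
pose lam := th `^ eps^-1.
have lamE : lam `^ eps = th.
  by rewrite /lam -powRrM mulVf ?powRr1 ?gt_eqF// ltW.
have lam1 : 1 < lam.
  rewrite ltNge; apply/negP => lam_le1.
  have : lam `^ eps <= 1 `^ eps.
    by apply: ge0_ler_powR; rewrite ?nnegrE ?powR_ge0// ltW.
  by rewrite powR1 lamE; lra.
have lam0 : 0 < lam by exact: lt_trans lam1.
pose Rj j := lam^-1 ^+ j.
have Rj0 j : 0 < Rj j by rewrite exprn_gt0 ?invr_gt0.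
have Rjmono j J : (j <= J)%N -> Rj J <= Rj j.
  by move=> jJ; apply: ler_wiXn2l; rewrite ?invr_ge0 ?(ltW lam0)// invf_le1// ltW.
have Rj1 j : Rj j <= 1 by have := Rjmono 0%N j (leq0n j); rewrite /Rj expr0.
have RjS j : lam * Rj j.+1 = Rj j by rewrite /Rj exprS mulVKf// gt_eqF.
pose D1 := D0 + 1.
have FD x y : F x -> F y -> enorm (x - y) <= D1.
  move=> Fx Fy; rewrite /D1; have := le_trans (le_diam Fx Fy) dFD.
  by rewrite lee_fin => h; lra.
have [x0 Fx0] : F !=set0.
  apply/set0P/negP => /eqP F0; move: dF0; rewrite F0 diam_set0.
  by rewrite ltNge leNye.
have sep_bound r (Y : seq 'rV[R]_d) : 0 < r -> r <= D1 ->
    (forall y, y \in Y -> F y) ->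
    pairwise (fun x y => r < enorm (x - y)) Y ->
    (size Y)%:R <= K1 * (D1 / r) `^ s.
  move=> r0 rD YF sY; apply: (cntle Y x0) => //; first by rewrite r0.
  by move=> z zY; split; [exact: YF|exact: FD (YF z zY) Fx0].
have sep_boundN r : 0 < r -> r <= D1 -> exists N : nat, forall Y : seq 'rV[R]_d,
    (forall y, y \in Y -> F y) ->
    pairwise (fun x y => r < enorm (x - y)) Y -> (size Y <= N)%N.
  move=> r0 rD; exists (Num.truncn (K1 * (D1 / r) `^ s)) => Y YF sY.
  rewrite -ltnS -(ltr_nat R).
  have /andP[_] := truncn_itv (le_trans (ler0n _ _) (sep_bound r Y r0 rD YF sY)).
  exact: le_lt_trans (sep_bound r Y r0 rD YF sY).
have D11 : 1 <= D1 by rewrite lerDr ltW.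
have exX J : exists X : seq 'rV[R]_d, [/\ forall x, x \in X -> F x,
    pairwise (fun x y => Rj J < enorm (x - y)) X &
    forall x, F x -> exists2 z, z \in X & enorm (x - z) <= Rj J].
  have [N HN] := sep_boundN (Rj J) (Rj0 J) (le_trans (Rj1 J) D11).
  exact: (@maximal_separated R _ (fun x y => enorm (x - y)) F (Rj J) N).
have {exX}/choice[X XP] := exX.
pose m J := Rj J `^ s.
have m0 J : 0 < m J by rewrite powR_gt0.
pose K0 := K1 * D1 `^ s.
have D1s : 1 <= D1 `^ s by rewrite -[leLHS](powRr0 D1) ler_powR// ltW.
have K0K1 : K1 <= K0 by rewrite ler_peMr// (le_trans _ K11).
have K00 : 0 <= K0 by rewrite (le_trans _ K0K1)// (le_trans _ K11).
have mass J : (size (X J))%:R * m J <= K0.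
  have [XF sX _] := XP J.
  have h := sep_bound (Rj J) (X J) (Rj0 J) (le_trans (Rj1 J) D11) XF sX.
  apply: le_trans (ler_wpM2r (ltW (m0 J)) h) _.
  rewrite -mulrA /m -powRM ?divr_ge0 ?(ltW (Rj0 J)) ?(le_trans ler01 D11)//.
  by rewrite divfK// gt_eqF.
pose La := (lam ^+ 2 - 1) / d%:R.
have La0 : 0 < La.
  by rewrite divr_gt0 ?ltr0n// subr_gt0 expr_gt1// ltW.
pose theta J j := th ^+ (j + J).
have theta0 J j : 0 < theta J j by rewrite exprn_gt0.
pose C1 := 4 * K2 * 3 ^+ d * lam ^+ n * (2 ^+ d.+1 * (2 * n).+1%:R ^+ n).
have C10 : 0 <= C1.
  by rewrite /C1 !mulr_ge0 ?exprn_ge0 ?(ltW lam0)// (le_trans _ K21).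
pose w J j := 6 ^+ n * C1 * (Rj j ^+ n * (Rj j `^ s)^-1 * (theta J j)^-1).
have w0 J j : 0 <= w J j.
  apply: mulr_ge0; first by rewrite mulr_ge0// exprn_ge0.
  apply: mulr_ge0; last by rewrite invr_ge0 ltW.
  by apply: mulr_ge0; [rewrite exprn_ge0// ltW|rewrite invr_ge0 powR_ge0].
pose E J j L := energy n d (X J) (m J) La (Rj j) L.
pose W J (L : grassmannian R (ltnW hnd)) := \sum_(j < J.+1) w J j * E J j (val L).
have E0 J j (L : grassmannian R (ltnW hnd)) : 0 <= E J j (val L).
  apply: energy_ge0; rewrite ?n0 ?hnd ?(ltW La0) ?Rj0//.
  exact/eqP/(valP L).
have sn : s + 1 <= (n + 4 * d)%:R.
  have n1 : 1 <= n%:R :> R by rewrite ler1n.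
  have dd : 0 <= d%:R :> R by [].
  by rewrite natrD natrM; lra.
have [C2 C20 Emean] := energy_mean n0 (ltW s0) sn.
pose C3 := 6 ^+ n * C1 * (C2 * La ^+ (2 * d) * K0 ^+ 2).
have C30 : 0 <= C3.
  have La1 : 0 <= La ^+ (2 * d) by rewrite exprn_ge0// ltW.
  have K01 : 0 <= K0 ^+ 2 by rewrite exprn_ge0.
  have six : 0 <= 6 ^+ n :> R by rewrite exprn_ge0.
  by apply: mulr_ge0; [exact: mulr_ge0|apply: mulr_ge0 => //; exact: mulr_ge0].
exists th, lam, (2 * C3), X, W; split => //.
- by rewrite mulr_ge0.
- by move=> J; have [? _ ?] := XP J; split.
- move=> J.
  have bE j : bdmeas (fun L : grass_borel R (ltnW hnd) =>
      w J j * E J j (val (L : grassmannian R (ltnW hnd)))).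
    apply: bdmeasM; first exact: bdmeas_cst.
    by apply: bdmeas_energy => //; exact: ltW.
  split.
  + by apply: bdmeas_sum.
  + by move=> L; apply: sumr_ge0 => j _; rewrite mulr_ge0.
  rewrite Rintegral_bdmeas_sum//.
  apply: (@le_trans _ _ (\sum_(j < J.+1) C3 * th^-1 ^+ J * th^-1 ^+ j)).
    apply: ler_sum => j _; rewrite Rintegral_bdmeasZ; last first.
      by apply: bdmeas_energy => //; exact: ltW.
    have [XF sX _] := XP J.
    have jJ : (j <= J)%N by rewrite -ltnS.
    have h : \int[gamma]_L E J j (val (L : grassmannian R (ltnW hnd))) <=
        C2 * La ^+ (2 * d) * K0 ^+ 2 * Rj j `^ s * (Rj j)^-1 ^+ n.
      apply: Emean => // x rho xX jrho.
      have Jrho : Rj J <= rho by exact: le_trans (Rjmono _ _ jJ) jrho.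
      have rho0 : 0 < rho by exact: lt_le_trans jrho.
      rewrite -size_filter.
      have c1 : (size [seq z <- X J | enorm (x - z) <= rho])%:R <=
          K1 * (rho / Rj J) `^ s.
        apply: (cntle _ x) => //; first by rewrite Rj0.
          move=> z; rewrite mem_filter => /andP[xz /XF Fz]; split => //.
          by rewrite enormB.
        exact: pairwise_filter.
      apply: le_trans (ler_wpM2r (ltW (m0 J)) c1) _.
      rewrite -mulrA /m -powRM ?divr_ge0 ?(ltW (Rj0 J)) ?(ltW rho0)//.
      by rewrite divfK ?gt_eqF// ler_wpM2r ?powR_ge0.
    apply: le_trans (ler_wpM2l (w0 J j) h) _.
    rewrite /w /theta exprD le_eqVlt; apply/orP; left; apply/eqP.
    rewrite /C3 !exprVn; field.
    by apply/and4P; split; apply: lt0r_neq0; [exact: exprn_gt0|exact: exprn_gt0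
      |exact: exprn_gt0 (Rj0 j)|exact: powR_gt0 (Rj0 j)].
  rewrite -mulr_sumr (_ : 2 * C3 * th^-1 ^+ J = C3 * th^-1 ^+ J * 2); last by ring.
  apply: ler_wpM2l; last first.
    exact: geometric_le2.
  by apply: mulr_ge0 => //; rewrite exprn_ge0// invr_ge0 ltW.
move=> delta delta0.
have fd0 : 0 < fine (diam F).
  by rewrite fine_gt0// dF0 (le_lt_trans dFD)// ltry.
have fdE : diam F = (fine (diam F))%:E.
  by rewrite fineK// fin_numE gt_eqF ?(lt_trans _ dF0)// lt_eqF// (le_lt_trans dFD)// ltry.
have fdD : fine (diam F) <= D0 by rewrite -lee_fin -fdE.
pose eta := Num.min (delta / 6) (fine (diam F) / 3).
have eta0 : 0 < eta by rewrite lt_min !divr_gt0.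
have eta6 : 6 * eta <= delta.
  have : eta <= delta / 6 by rewrite ge_min lexx.
  by clear; lra.
have eta3 : 3 * eta <= fine (diam F).
  have : eta <= fine (diam F) / 3 by rewrite ge_min lexx orbT.
  by clear; lra.
have [Ja HJa] := exprn_unbounded (K0 / eta ^+ n) th2.
have [Jb HJb] := exprn_unbounded (K0 + 1) th2.
exists (maxn Ja Jb) => J; rewrite geq_max => /andP[/HJa ha /HJb hb] L.
have K0p : 0 < K0 by apply: lt_le_trans K0K1; exact: lt_le_trans K11.
pose sm j x := smoothed n (X J) (m J) (val L) (Rj j ^+ 2) x.
have sm_le j x : sm j x <= K0 * (Rj j)^-1 ^+ n.
  have R2 : 0 < Rj j ^+ 2 by rewrite exprn_gt0.
  apply: le_trans (smoothed_le (X J) (val L) x (ltnW hnd) (ltW (m0 J)) R2) _.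
  rewrite sqrtr_sqr gtr0_norm// ler_wpM2r ?mass//.
  by rewrite exprn_ge0// invr_ge0 ltW.
have smallR j x : theta J j <= sm j x -> Rj j <= eta.
  move=> h; have h1 : K0 / eta ^+ n <= K0 * (Rj j)^-1 ^+ n.
    apply: le_trans (sm_le j x); apply: le_trans h; apply: le_trans ha _.
    by rewrite /theta exprD ler_peMl ?exprn_ege1// exprn_ge0// ltW.
  have en : 0 < eta ^+ n by rewrite exprn_gt0.
  have Rn : 0 < Rj j ^+ n := exprn_gt0 n (Rj0 j).
  move: h1; rewrite ler_pM2l// (exprVn (Rj j)) lef_pV2 ?posrE//.
  by rewrite ler_pXn2r// nnegrE ltW.
pose S j := if j is j'.+1 then
  [set x | F x /\ (j <= J)%N /\ theta J j <= sm j x /\ sm j' x <= theta J j']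
  else set0.
have cS : concentration n s F (X J) (3 ^+ d * th ^+ (2 * J)) (lam^-1 ^+ J) (val L)
    `<=` [set x | exists2 j, j \in index_iota 0 J.+1 & S j x].
  move=> x [Fx xc].
  have PJ : theta J J <= sm J x.
    apply: le_trans (smoothed_ge (X J) (val L) x (ltnW hnd) (ltW (m0 J)) (Rj0 J)).
    rewrite /theta addnn -mul2n.
    have -> : forall a : R, a * m J * (3^-1 ^+ d * (Rj J)^-1 ^+ n) =
      3^-1 ^+ d * (a * m J * (Rj J)^-1 ^+ n) by move=> a; ring.
    have h3 : 0 < 3^-1 ^+ d :> R by rewrite exprn_gt0.
    have := ler_wpM2l (ltW h3) xc.
    by rewrite mulrA -exprMn mulVf// expr1n mul1r.
  have exP : exists j, theta J j <= sm j x by exists J.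
  case: (ex_minnP exP) => j hj jmin.
  have jJ : (j <= J)%N by exact: jmin.
  exists j; first by rewrite mem_index_iota.
  case: j hj jmin jJ => [h0 _ _|j hj jmin jJ] /=.
    have := le_trans h0 (sm_le 0%N x).
    rewrite /theta /Rj expr0 invr1 expr1n mulr1 add0n => h.
    by have := le_trans hb h; rewrite gerDl ler10.
  split => //; split => //; split => //; rewrite leNgt; apply/negP => /ltW /jmin.
  by rewrite ltnn.
apply: le_trans (hausdorff_premeasure_le _ _ cS) _.
apply: le_trans (hausdorff_premeasure_big _ _ _ _) _.
rewrite /W -sumEFin -(big_mkord xpredT (fun j => (w J j * E J j (val L))%:E)).
apply: lee_sum => -[|j] _.
  by rewrite hausdorff_premeasure0 lee_fin mulr_ge0.
have [[x1 [Fx1 [jJ [hx1 _]]]]|S0] := pselect (S j.+1 !=set0); last first.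
  have SE : S j.+1 = set0 by apply/seteqP; split => // y Sy; case: S0; exists y.
  by rewrite SE hausdorff_premeasure0 lee_fin mulr_ge0.
have rs := smallR _ _ hx1.
set r := Rj j.+1 in rs *.
have r0 : 0 < r by exact: Rj0.
have rs0 : 0 < r `^ s by exact: powR_gt0.
have r3 : 0 < 3 * r by rewrite mulr_gt0.
have r3D : 3 * r <= D1 by rewrite /D1; clear -rs eta3 fdD; lra.
have [N HN] := sep_boundN (3 * r) r3 r3D.
have [XF _ covX] := XP J.
have rhor : 0 < Rj J <= r by rewrite Rj0 Rjmono.
have cnt x : F x ->
    (r / Rj J) `^ s <= K2 * (count (fun z => enorm (z - x) <= r) (X J))%:R.
  by move=> Fx; apply: cntge => //; rewrite fdE lee_fin; clear -rs r0 eta3; lra.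
have nd : (0 < n < d)%N by rewrite n0.
have dL : \dim (val L) = n by exact/eqP/(valP L).
have [||X' cX' sX'] := @scale_cover R d n d s K2 (Rj J) r lam (theta J j.+1)
  F (S j.+1) (X J) (val L) N nd dL d0 rhor lam1 (theta0 J j.+1) K21
  (fun x => @proj1 _ _) cnt HN.
- by move=> x [_ [_ []]].
- move=> x [_ [_ [_ h]]]; rewrite -/Mp /r RjS.
  apply: le_trans (ler_wpM2l Mp0 h) _.
  rewrite /theta addSn exprS; apply: ler_wpM2r; first by rewrite exprn_ge0// ltW.
  by rewrite lerDr.
rewrite -/C1 -/(E J j.+1 (val L)) in sX'.
have cS' : S j.+1 `<=` [set x | exists2 z, z \in X' & eball z (3 * r) x].
  by move=> x /cX'[z zX xz]; exists z.
apply: le_trans (hausdorff_premeasure_le _ _ cS') _.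
apply: le_trans (hausdorff_premeasure_big _ _ _ _) _.
have r6 : 2 * (3 * r) <= delta by clear -rs eta6; lra.
apply: le_trans (lee_sum _ (fun z _ => hausdorff_premeasure_eball n z (ltW r3) r6)) _.
rewrite sumEFin lee_fin big_const_seq count_predT iter_addr addr0 -[leLHS]mulr_natr.
have t0 : 0 < theta J j.+1 by exact: theta0.
have h : (size X')%:R <= C1 * E J j.+1 (val L) / (r `^ s * theta J j.+1).
  by rewrite ler_pdivlMr ?mulr_gt0// mulrA.
have r6n : 0 <= (2 * (3 * r)) ^+ n by rewrite exprn_ge0// mulr_ge0// ltW.
apply: le_trans (ler_wpM2l r6n h) _.
rewrite le_eqVlt; apply/orP; left; apply/eqP.
rewrite /w -/r mulrA exprMn invfM (_ : 2 * 3 = 6); last by ring.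
ring.
Qed.

(** * From covering numbers to dimensions *)

Lemma compact_diam (R : realType) (d : nat) (F : set 'rV[R]_d) :
  compact F -> exists2 D : R, 0 < D & (diam F <= D%:E)%E.
Proof.
move=> /compact_bounded[M [_ HM]].
have {HM} HM x : F x -> enorm x <= d%:R * (`|M| + 1).
  move=> Fx; have xM : `|x| <= `|M| + 1.
    by apply: HM Fx; rewrite (le_lt_trans (ler_norm M))// ltrDl.
  apply: le_trans (enorm_le_sum x) _.
  rewrite mulr_natl -[in leRHS](card_ord d) -sumr_const; apply: ler_sum => i _.
  apply: le_trans xM; rewrite [leRHS]/Num.norm /= mx_normrE.
  by apply/bigmax_geP; right => /=; exists (0, i).
exists (2 * (d%:R * (`|M| + 1)) + 1).
  by rewrite ltr_wpDl// !mulr_ge0// addr_ge0.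
apply: diam_le => x y Fx Fy; rewrite lee_fin.
have := enorm_dist x 0 y; rewrite subr0 sub0r enormN.
by have := HM x Fx; have := HM y Fy; lra.
Qed.

Lemma upper_box_dim_gt (R : realType) (d : nat) (A : set 'rV[R]_d) (a e : R) :
  0 < e -> (a%:E < upper_box_dim A)%E ->
  exists2 delta : R, 0 < delta < e &
    ((delta^-1 `^ a)%:E < covering_number A delta)%E.
Proof.
move=> e0 aA; pose V := [set x : R | 0 < x < Num.min e 2^-1].
have FV : nbhs (0 : R)^'+ V.
  near=> x; rewrite /V /=; apply/andP; split; near: x; first exact: nbhs_right_gt.
  by apply: nbhs_right_lt; rewrite lt_min e0 invr_gt0 ltr0n.
have : (a%:E < ereal_sup ((fun delta : R =>
    lne (covering_number A delta) * ((ln delta^-1)^-1)%:E)%E @` V))%E.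
  by apply: lt_le_trans aA _; apply: ereal_inf_lbound; exists V.
move=> /ereal_sup_gt[_ [delta /andP[d0 dV] <-] h].
have /andP[de d2] : (delta < e) && (delta < 2^-1) by rewrite -lt_min.
exists delta; first by rewrite d0.
have u0 : 0 < ln delta^-1.
  by rewrite ln_gt0// invf_gt1// (lt_trans d2)// invf_lt1// ltr1n.
move: h; rewrite lte_pdivlMr//; case: covering_number => [c| |] /=.
- case: ifPn => // c0; rewrite -EFinM !lte_fin => h.
  have cp : c \is Num.pos by rewrite posrE ltNge.
  by rewrite -[ltRHS](lnK cp) /powR gt_eqF ?invr_gt0// ltr_expR.
- by move=> _; exact: ltry.
- by rewrite ltNge leNye.
Unshelve. all: by end_near. Qed.

(** The net points within [rho] of the fibre through [x] project near the
    image of [x], and the balls around them cover the fibre. *)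
Lemma covering_number_slice_le (R : realType) (d : nat) (F : set 'rV[R]_d)
    (X : seq 'rV[R]_d) (L : {vspace 'rV[R]_d}) (x : 'rV[R]_d) (rho delta : R) :
  0 <= rho <= delta ->
  (forall y, F y -> exists2 z, z \in X & enorm (y - z) <= rho) ->
  (covering_number (F `&` slice x L) delta <=
   (count (fun z => (enorm (oproj L (z - x)) <= 2 * rho)%R) X)%:R%:E)%E.
Proof.
move=> /andP[rho0 rd] cov; rewrite -size_filter; set Y := seq.filter _ X.
apply: ereal_inf_lbound; exists (size Y) => //.
exists (fun i => nth 0 Y i) => y [Fy [v Lv vy]].
have [z zX yz] := cov y Fy.
have zY : z \in Y.
  rewrite mem_filter zX andbT.
  have -> : z - x = (z - y) - (- v) by rewrite -vy opprK opprD addrA subrK.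
  have Lv' : orthc L (- v) by move=> w /Lv; rewrite dotvNl => ->; rewrite oppr0.
  rewrite oprojB (oproj_orth Lv') subr0.
  apply: le_trans (enorm_oproj_le L _) _; rewrite enormB.
  by apply: le_trans yz _; rewrite ler_peMl// ler1n.
have zs : (index z Y < size Y)%N by rewrite index_mem.
exists (Ordinal zs) => //=.
by rewrite /eball /= nth_index// (le_trans yz).
Qed.

Lemma exprn_unbounded_gt1 (R : realType) (lam c : R) : 1 < lam ->
  exists J, c <= lam ^+ J.
Proof.
move=> lam1; have l0 : 0 < lam - 1 by rewrite subr_gt0.
have bern J : J%:R * (lam - 1) <= lam ^+ J.
  elim: J => [|J IH]; first by rewrite mul0r expr0.
  have h1 : 1 <= lam ^+ J by rewrite exprn_ege1// ltW.
  have : (lam - 1) * 1 <= (lam - 1) * lam ^+ J by rewrite ler_wpM2l// ltW.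
  by rewrite -[J.+1%:R]natr1 exprS; set u := lam ^+ J in IH *; lra.
exists (Num.truncn (`|c| / (lam - 1))).+1.
apply: le_trans (ler_norm c) _; apply: le_trans (bern _).
rewrite -ler_pdivrMr//; apply: ltW.
by have /andP[] := truncn_itv (divr_ge0 (normr_ge0 c) (ltW l0)).
Qed.

(** A fibre of large box dimension needs many balls at arbitrarily small
    scales, and the net points near the fibre provide a cover. *)
Lemma concentration_box_dim (R : realType) (d n : nat) (s eps lam th : R)
    (F : set 'rV[R]_d) (X : nat -> seq 'rV[R]_d) (L : {vspace 'rV[R]_d})
    (x : 'rV[R]_d) (J0 : nat) :
  n%:R < s -> 0 < eps -> 2 <= th -> 1 < lam -> lam `^ eps = th ->
  (forall J y, F y -> exists2 z, z \in X J & enorm (y - z) <= lam^-1 ^+ J) ->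
  F x -> ((s - n%:R + 3 * eps)%:E < upper_box_dim (F `&` slice x L))%E ->
  exists2 J, (J0 <= J)%N &
    concentration n s F (X J) (3 ^+ d * th ^+ (2 * J)) (lam^-1 ^+ J) L x.
Proof.
move=> ns eps0 th2 lam1 lamE cov Fx; set a := s - n%:R + 3 * eps => aU.
have lam0 : 0 < lam by exact: lt_trans lam1.
have a0 : 0 < a by rewrite addr_gt0 ?subr_gt0 ?mulr_gt0.
have [J1 HJ1] := exprn_unbounded (3 ^+ d * lam `^ a) th2.
pose J2 := maxn J0 J1.
have e0 : 0 < lam^-1 ^+ J2 by rewrite exprn_gt0 ?invr_gt0.
have [delta /andP[d0 de] dcov] := upper_box_dim_gt e0 aU.
have exJ : exists J, lam^-1 ^+ J <= delta.
  have [J HJ] := exprn_unbounded_gt1 delta^-1 lam1; exists J.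
  by rewrite exprVn -[leRHS]invrK lef_pV2// ?posrE ?invr_gt0 ?exprn_gt0.
(* At the first mesh that is at most [delta] also [delta < lam * mesh]. *)
case: (ex_minnP exJ) => J Jd Jmin.
have J2J : (J2 < J)%N.
  rewrite ltnNge; apply/negP => JJ2; have := le_lt_trans Jd de.
  by rewrite ltNge ler_wiXn2l// ?invr_ge0 ?invf_le1// ltW.
case: J Jd Jmin J2J => // J Jd Jmin; rewrite ltnS => J2J.
have dJ : delta < lam^-1 ^+ J.
  by rewrite ltNge; apply/negP => /Jmin; rewrite ltnn.
exists J.+1; first by rewrite (leq_trans (leq_maxl _ _) (leqW J2J)).
split => //; set q := lam^-1 ^+ J.+1 in Jd *.
have q0 : 0 < q by rewrite exprn_gt0 ?invr_gt0.
have qE : q^-1 = lam ^+ J.+1 by rewrite /q exprVn invrK.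
have hc := covering_number_slice_le L x (F := F) (X := X J.+1)
  (rho := q) (delta := delta) _ (cov J.+1).
rewrite (ltW q0) Jd in hc; have {hc} := lt_le_trans dcov (hc isT).
rewrite lte_fin; set N := (count _ _)%:R => /ltW hN.
have dq : (lam^-1 * q^-1) `^ a <= delta^-1 `^ a.
  apply: ge0_ler_powR; rewrite ?nnegrE ?mulr_ge0 ?invr_ge0 ?(ltW a0) ?(ltW lam0) ?(ltW q0) ?(ltW d0)//.
  rewrite -invfM lef_pV2 ?posrE ?mulr_gt0//.
  by apply: ltW; rewrite /q exprS mulVKf// gt_eqF.
have {dq hN} hN := le_trans dq hN.
have key : 3 ^+ d * th ^+ (2 * J.+1) <= (lam^-1 * q^-1) `^ a * q `^ s * q^-1 ^+ n.
  have pq : (q^-1) `^ a * q `^ s * q^-1 ^+ n = th ^+ J.+1 * th ^+ (2 * J.+1).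
    have -> : q^-1 ^+ n = q^-1 `^ n%:R by rewrite powR_mulrn// invr_ge0 ltW.
    rewrite mulrAC -powRD; last by rewrite invr_eq0 (gt_eqF q0) implybT.
    have -> : a + n%:R = s + 3 * eps by rewrite /a; lra.
    rewrite powRD; last by rewrite invr_eq0 (gt_eqF q0) implybT.
    rewrite mulrAC -powRM ?invr_ge0 ?(ltW q0)// mulVf ?gt_eqF// powR1 mul1r.
    rewrite qE -(powR_mulrn _ (ltW lam0)) -powRrM.
    have -> : J.+1%:R * (3 * eps) = eps * (3 * J.+1)%:R by rewrite natrM; ring.
    by rewrite powRrM lamE powR_mulrn ?mulSn ?exprD// (le_trans _ th2).
  rewrite powRM ?invr_ge0 ?(ltW lam0) ?(ltW q0)// -!mulrA (mulrA (q^-1 `^ a)) pq.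
  rewrite mulrA ler_wpM2r ?exprn_ge0 ?(le_trans _ th2)//.
  rewrite -powR_inv1; last exact: ltW.
  rewrite -powRrM mulN1r powRN mulrC ler_pdivlMr ?powR_gt0//.
  by apply: HJ1; rewrite (leq_trans (leq_maxr _ _) (leqW J2J)).
apply: le_trans key _.
by rewrite ler_wpM2r ?exprn_ge0 ?invr_ge0 ?(ltW q0)// ler_wpM2r// powR_ge0.
Qed.

(** * Null sets *)

Lemma hausdorff_dim_le (R : realType) (d : nat) (s : R) (S : set 'rV[R]_d) :
  0 <= s -> (forall delta, 0 < delta -> hausdorff_premeasure s delta S = 0%E) ->
  (hausdorff_dim S <= s%:E)%E.
Proof.
move=> s0 S0; apply: ereal_inf_lbound; exists s => //; split => //.
apply/eqP; rewrite eq_le hausdorff_measure_ge0 andbT.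
by apply: ge_ereal_sup => _ [delta /S0 -> <-].
Qed.

(** A Borel-Cantelli argument for Hausdorff premeasures. *)
Lemma hausdorff_premeasure_limsup (R : realType) (d : nat) (s delta : R)
    (A : nat -> set 'rV[R]_d) (S : set 'rV[R]_d) (w : nat -> R) (J0 : nat) :
  (forall J, 0 <= w J) -> (\sum_(0 <= J <oo) (w J)%:E < +oo)%E ->
  (forall J, (J0 <= J)%N -> (hausdorff_premeasure s delta (A J) <= (w J)%:E)%E) ->
  (forall J1 x, S x -> exists2 J, (J1 <= J)%N & A J x) ->
  hausdorff_premeasure s delta S = 0%E.
Proof.
move=> w0 woo Aw SA; apply/eqP; rewrite eq_le hausdorff_premeasure_ge0 andbT.
have tail0 := nneseries_tail_cvg woo (fun k _ => w0 k).
have tail_le N : (J0 <= N)%N -> (hausdorff_premeasure s delta S <=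
    \sum_(N <= k <oo) (w k)%:E)%E.
  move=> JN; have SB : S `<=` \bigcup_k A (k + N)%N.
    move=> x /(SA N)[J NJ AJx]; exists (J - N)%N => //.
    by rewrite subnK.
  apply: le_trans (hausdorff_premeasure_le _ _ SB) _.
  apply: le_trans (hausdorff_premeasure_bigcup _ _ _) _.
  rewrite -(@nneseries_addn _ (EFin \o w) N); last by move=> k; rewrite lee_fin.
  apply: lee_nneseries => k _; first by move=> _; exact: hausdorff_premeasure_ge0.
  by apply: Aw; rewrite (leq_trans JN)// leq_addl.
rewrite -(cvg_lim _ tail0)//; apply: lime_ge.
  by apply/cvg_ex; exists 0%E; exact: tail0.
by exists J0 => // N /= JN; exact: tail_le.
Qed.

Lemma ae_imp (R : realType) dT (T : measurableType dT)
    (P : probability T R) (A B : T -> Prop) :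
  (forall x, A x -> B x) -> {ae P, forall x, A x} -> {ae P, forall x, B x}.
Proof. by move=> AB; apply: filterS. Qed.

Lemma ae_summable (R : realType) dT (T : measurableType dT)
    (P : probability T R) (W : nat -> T -> R) (C th : R) :
  2 <= th -> 0 <= C -> (forall J, bdmeas (W J)) -> (forall J x, 0 <= W J x) ->
  (forall J, \int[P]_x W J x <= C * th^-1 ^+ J) ->
  {ae P, forall x, (\sum_(0 <= J <oo) (W J x)%:E < +oo)%E}.
Proof.
move=> th2 C0 bW W0 intW.
pose f x := (\sum_(0 <= J <oo) (W J x)%:E)%E.
have mW J : measurable_fun setT (fun x => (W J x)%:E).
  by have /integrableP[] := bdmeas_integrable P (bW J).
have f0 x : (0 <= f x)%E by apply: nneseries_ge0 => J _ _; rewrite lee_fin.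
have intf : P.-integrable setT f.
  apply/integrableP; split.
    by apply: ge0_emeasurable_sum => [k x _ _|k _]; rewrite ?lee_fin.
  under eq_integral do rewrite gee0_abs//.
  rewrite integral_nneseries//; last by move=> k x _; rewrite lee_fin.
  apply: (@le_lt_trans _ _ (C * 2)%:E); last exact: ltry.
  apply: lime_le.
    apply: is_cvg_nneseries => k _ _; apply: integral_ge0 => x _.
    by rewrite lee_fin.
  apply: nearW => N; rewrite big_mkord.
  under eq_bigr do rewrite EFin_Rintegral//.
  rewrite sumEFin lee_fin.
  apply: (@le_trans _ _ (\sum_(J < N) C * th^-1 ^+ J)).
    by apply: ler_sum => J _; exact: intW.
  by rewrite -mulr_sumr ler_wpM2l// geometric_le2.
apply: filterS (integrable_ae measurableT intf) => x /(_ I).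
by rewrite fin_numElt => /andP[].
Qed.

(** The exceptional sets of [concentration_cover] are summable for a generic
    subspace, and a point with a fibre of large dimension lies in infinitely
    many of them. *)
Lemma large_slice_null (R : realType) (d n : nat) (hnd : (n < d)%N)
    (s eps D0 : R) (F : set 'rV[R]_d)
    (gamma : probability (grass_borel R (ltnW hnd)) R) :
  (0 < n)%N -> n%:R < s <= d%:R -> 0 < eps -> ahlfors_regular s F ->
  (0 < diam F)%E -> (diam F <= D0%:E)%E -> is_haar gamma ->
  {ae gamma, forall L : grassmannian R (ltnW hnd), forall delta : R, 0 < delta ->
    hausdorff_premeasure n%:R delta
      [set x | F x /\ ((s - n%:R + 3 * eps)%:E <
        upper_box_dim (F `&` slice x (val L)))%E] = 0%E}.
Proof.
move=> n0 sn eps0 regF dF0 dFD haar.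
have [th [lam [C [X [W [[th2 lam1 lamE] C0 XP WP cover]]]]]] :=
  concentration_cover n0 sn eps0 regF dF0 dFD haar.
have ns : n%:R < s by have /andP[] := sn.
have aeS : {ae gamma, forall L, (\sum_(0 <= J <oo) (W J L)%:E < +oo)%E}.
  by apply: (ae_summable th2 C0) => J; have [] := WP J.
apply: ae_imp aeS => L WL delta delta0.
have [J0 HJ0] := cover delta delta0.
apply: (hausdorff_premeasure_limsup (w := fun J => W J L) _ WL
  (fun J JJ => HJ0 J JJ L)).
  by move=> J; have [_ ->] := WP J.
move=> J1 x [Fx Ux]; apply: (concentration_box_dim J1 ns eps0 th2 lam1 lamE) => //.
by move=> J y Fy; have [_] := XP J; exact.
Qed.

Lemma hausdorff_premeasure_diam0 (R : realType) (d n : nat) (delta : R)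
    (F : set 'rV[R]_d) : (0 < n)%N -> 0 < delta -> (diam F <= 0)%E ->
  hausdorff_premeasure n%:R delta F = 0%E.
Proof.
move=> n0 delta0 dF; apply/eqP; rewrite eq_le hausdorff_premeasure_ge0 andbT.
have [[x0 Fx0]|F0] := pselect (F !=set0); last first.
  rewrite (_ : F = set0) ?hausdorff_premeasure0//.
  by apply/seteqP; split => // x Fx; case: F0; exists x.
have FB : F `<=` eball x0 0.
  move=> x Fx; have := le_trans (le_diam Fx Fx0) dF.
  by rewrite lee_fin.
apply: le_trans (hausdorff_premeasure_le _ _ FB) _.
apply: le_trans (hausdorff_premeasure_eball n x0 (lexx 0) _) _.
  by rewrite mulr0 ltW.
by rewrite mulr0 expr0n lee_fin gtn_eqF.
Qed.

Theorem theorem1p3 (R : realType) (d n : nat) (hn1 : (1 <= n)%N)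
    (hnd : (n < d)%N) (s : R) (hs : n%:R < s <= d%:R)
    (F : set 'rV[R]_d) (hFc : compact F) (hF : ahlfors_regular s F)
    (gamma : probability (grass_borel R (ltnW hnd)) R)
    (hgamma : is_haar gamma) :
  {ae gamma, forall L : grassmannian R (ltnW hnd),
    (hausdorff_dim
       [set x | F x /\
         (s - n%:R)%:E < upper_box_dim (F `&` slice x (val L))]
     <= (n%:R : R)%:E)%E}.
Proof.
have [D0 D00 dFD] := compact_diam hFc.
have [dF0|dF0] := leP (diam F) 0%E.
  (* Here [F] has at most one point, which is a null set as [0 < n]. *)
  apply: aeW => L; apply: hausdorff_dim_le => // delta delta0.
  apply/eqP; rewrite eq_le hausdorff_premeasure_ge0 andbT.
  rewrite -(hausdorff_premeasure_diam0 hn1 delta0 dF0).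
  by apply: hausdorff_premeasure_le => x [].
(* A dimension above [s - n] exceeds [s - n + 3 / (k + 1)] for some [k]. *)
have e0 k : 0 < k.+1%:R^-1 :> R by rewrite invr_gt0.
have := ae_foralln (fun k => large_slice_null hn1 hs (e0 k) hF dF0 dFD hgamma).
apply: ae_imp => L HL; apply: hausdorff_dim_le => // delta delta0.
apply/eqP; rewrite eq_le hausdorff_premeasure_ge0 andbT.
pose S k := [set x | F x /\ ((s - n%:R + 3 * k.+1%:R^-1)%:E <
        upper_box_dim (F `&` slice x (val L)))%E].
apply: (@le_trans _ _ (hausdorff_premeasure n%:R delta (\bigcup_k S k))).
  apply: hausdorff_premeasure_le => x [Fx].
  case Eu : (upper_box_dim _) => [u| |] // h.
  - have h3 : (s - n%:R) / 3 < u / 3 by rewrite ltr_pM2r.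
    have [k hk] := ltr_add_invr h3; exists k => //; split => //.
    by rewrite Eu lte_fin; move: hk; set v := k.+1%:R^-1 => hk; lra.
  - by exists 0%N => //; split => //; rewrite Eu ltry.
apply: le_trans (hausdorff_premeasure_bigcup _ _ _) _.
by rewrite eseries0// => k _ _; exact: HL.
Qed.
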